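(* Let $d\ge 1$ be an integer, $b$ a prime and $v\ge 0$ an integer. Let $1\leq p,q<\infty$ and $0<r<1/\max(p,q)$. There exists a constant $C_{p,q,r,d,b,v}>0$ such that for every positive integer $n$ and every order $1$ digital $(v,n,d)$-net $\mathcal{P}_n^b$ over $\mathbb{F}_b$ we have \[ \left\|D_{\mathcal{P}_n^b}\,|\,S_{p,q}^rF([0,1)^d)\right\|\leq C_{p,q,r,d,b,v}\,b^{n(r-1)}\,n^{(d-1)/q}. \]
   Context: Discrepancy function: for a finite family $\mathcal{P}$ of $N$ points in $[0,1)^d$ (points counted with multiplicity), $D_{\mathcal{P}}(x)=\frac1N\sum_{z\in\mathcal{P}}\chi_{[0,x)}(z)-x_1\cdots x_d$ for $x=(x_1,\ldots,x_d)\in[0,1)^d$, where $\chi_{[0,x)}$ is the characteristic function of $[0,x)=[0,x_1)\times\cdots\times[0,x_d)$. Digital nets: let $b$ be prime and let $\mathbb{F}_b$ be the field with $b$ elements, identified with $\{0,1,\ldots,b-1\}$ with arithmetic modulo $b$. For $s,n\in\mathbb{N}$ with $s\ge n$ let $C_1,\ldots,C_d$ be $s\times n$ matrices over $\mathbb{F}_b$. For $\nu\in\{0,\ldots,b^n-1\}$ with $b$-adic expansion $\nu=\nu_0+\nu_1b+\cdots+\nu_{n-1}b^{n-1}$ put $\bar\nu=(\nu_0,\ldots,\nu_{n-1})^\top\in\mathbb{F}_b^n$, $C_i\bar\nu=(x_{i,\nu,1},\ldots,x_{i,\nu,s})^\top\in\mathbb{F}_b^s$, $x_{i,\nu}=x_{i,\nu,1}b^{-1}+\cdots+x_{i,\nu,s}b^{-s}\in[0,1)$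 and $x_\nu=(x_{1,\nu},\ldots,x_{d,\nu})$. The family $\mathcal{P}_n^b=\{x_0,\ldots,x_{b^n-1}\}$ of $N=b^n$ points (with multiplicity) is called a digital net over $\mathbb{F}_b$. Order $\sigma$ digital $(v,n,d)$-net: let $\sigma\in\mathbb{N}$, $s\ge\sigma n$, and let $0\le v\le\sigma n$ be an integer. Let $c_{i,1},\ldots,c_{i,s}\in\mathbb{F}_b^n$ be the rows of $C_i$. If for all choices of $0\le\eta_i\le s$ and indices $1\le\lambda_{i,\eta_i}<\cdots<\lambda_{i,1}\le s$ ($1\le i\le d$) with \[\sum_{i=1}^d\left(\lambda_{i,1}+\cdots+\lambda_{i,\min(\eta_i,\sigma)}\right)\le\sigma n-v\] the vectors $c_{1,\lambda_{1,1}},\ldots,c_{1,\lambda_{1,\eta_1}},\ldots,c_{d,\lambda_{d,1}},\ldots,c_{d,\lambda_{d,\eta_d}}$ are linearly independent over $\mathbb{F}_b$, then $\mathcal{P}_n^b$ is called an order $\sigma$ digital $(v,n,d)$-net over $\mathbb{F}_b$. Triebel-Lizorkin spaces with dominating mixed smoothness: let $\mathcal{F}$ be the Fourier transform on tempered distributions $\mathcal{S}'(\mathbb{R}^d)$. Fix $\varphi_0\in\mathcal{S}(\mathbb{R})$ with $\varphi_0(x)=1$ for $|x|\le1$ and $\varphi_0(x)=0$ for $|x|>\frac32$; put $\varphi_k(x)=\varphi_0(2^{-k}x)-\varphi_0(2^{-k+1}x)$ for $k\in\mathbb{N}$ and $\varphi_{\bar k}(x)=\varphi_{k_1}(x_1)\cdots\varphi_{k_d}(x_d)$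 for $\bar k=(k_1,\ldots,k_d)\in\mathbb{N}_0^d$. For $0<p<\infty$, $0<q\le\infty$, $r\in\mathbb{R}$, $S_{p,q}^rF(\mathbb{R}^d)$ consists of all $f\in\mathcal{S}'(\mathbb{R}^d)$ with finite quasi-norm \[\|f|S_{p,q}^rF(\mathbb{R}^d)\|=\Big\|\Big(\sum_{\bar k\in\mathbb{N}_0^d}2^{r(k_1+\cdots+k_d)q}\,|\mathcal{F}^{-1}(\varphi_{\bar k}\mathcal{F}f)(\cdot)|^q\Big)^{1/q}\Big|\,L_p(\mathbb{R}^d)\Big\|\] (supremum if $q=\infty$). Let $\mathcal{D}'([0,1)^d)$ be the space of distributions dual to the smooth complex-valued functions on $\mathbb{R}^d$ with compact support in the interior of $[0,1)^d$. $S_{p,q}^rF([0,1)^d)$ consists of all $f\in\mathcal{D}'([0,1)^d)$ with finite quasi-norm $\|f|S_{p,q}^rF([0,1)^d)\|=\inf\{\|g|S_{p,q}^rF(\mathbb{R}^d)\|:\ g\in S_{p,q}^rF(\mathbb{R}^d),\ g|_{[0,1)^d}=f\}$. *)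

(* Defs.v *)
From HB Require Import structures.
From mathcomp Require Import all_boot all_order all_algebra.
From mathcomp Require Import all_classical all_reals all_analysis.
From mathcomp Require Import complex.
Set Implicit Arguments.
Unset Strict Implicit.
Unset Printing Implicit Defensive.
Import Order.TTheory GRing.Theory Num.Theory numFieldNormedType.Exports.
Local Open Scope classical_set_scope.
Local Open Scope ring_scope.

Section ConsMeasure.
Context d (T : measurableType d) (R : realType) (n : nat).
Variables (mu : {sigma_finite_measure set T -> \bar R})
  (m : {sigma_finite_measure set (n.-tuple T) -> \bar R}).

Definition consT (p : T * n.-tuple T) : n.+1.-tuple T := [tuple of p.1 :: p.2].

Lemma measurable_consT : measurable_fun [set: T * n.-tuple T] consT.
Proof. exact: measurable_cons. Qed.

Definition cons_measure : set (n.+1.-tuple T) -> \bar R :=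
  pushforward (mu \x m)%E consT.

Let cons_measure0 : cons_measure set0 = 0%E.
Proof. by rewrite /cons_measure /pushforward preimage_set0 measure0. Qed.

Let cons_measure_ge0 A : (0 <= cons_measure A)%E.
Proof. exact: (measure_ge0 (mu \x m)%E). Qed.

Let cons_measure_sigma_additive : semi_sigma_additive cons_measure.
Proof.
have pre A : measurable A -> measurable (consT @^-1` A).
  by move=> mA; rewrite -[X in measurable X]setTI; exact: measurable_consT.
move=> F mF tF mUF; rewrite /cons_measure /pushforward preimage_bigcup.
apply: (@measure_semi_sigma_additive _ _ _ (mu \x m)%E).
- by move=> i; exact: pre.
- apply/trivIsetP => /= i j _ _ ij; rewrite -preimage_setI.
  by move/trivIsetP : tF => /(_ _ _ _ _ ij) ->//; rewrite preimage_set0.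
- by rewrite -preimage_bigcup; exact: pre.
Qed.

HB.instance Definition _ := isMeasure.Build _ _ _ cons_measure
  cons_measure0 cons_measure_ge0 cons_measure_sigma_additive.

Let cons_measure_sigma_finite : sigma_finite setT cons_measure.
Proof.
have /sigma_finiteP[F [FT ndF Foo]] := sigma_finiteT mu.
have /sigma_finiteP[G [GT ndG Goo]] := sigma_finiteT m.
pose u (t : n.+1.-tuple T) : T * n.-tuple T := (thead t, [tuple of behead t]).
have mU : measurable_fun setT u.
  apply/measurable_fun_pairP; split; last exact: measurable_behead.
  exact: (@measurable_tnth _ T n.+1 ord0).
have uK : cancel consT u.
  by move=> [x t]; rewrite /u /consT; congr pair; apply/val_inj.
exists (fun i => u @^-1` (F i `*` G i)).
  rewrite -preimage_bigcup -[LHS](@preimage_setT _ _ u); congr (_ @^-1` _).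
  rewrite -setXTT FT GT predeqE => -[x y]; split.
    move=> [/= [i _ Fix] [k _ Gky]]; exists (maxn i k) => //; split.
    - by move: x Fix; exact/subsetPset/ndF/leq_maxl.
    - by move: y Gky; exact/subsetPset/ndG/leq_maxr.
  by move=> [i _ []/= ? ?]; split; exists i.
move=> i; have [mF Fi] := Foo i; have [mG Gi] := Goo i; split.
  by rewrite -[X in measurable X]setTI; apply: mU => //; exact: measurableX.
rewrite /cons_measure /pushforward -comp_preimage.
rewrite (_ : u \o consT = id); last by apply/funext => p; exact: uK.
by rewrite preimage_id product_measure1E// lte_mul_pinfty// ge0_fin_numE.
Qed.

HB.instance Definition _ := @Measure_isSigmaFinite.Build _ _ _ cons_measure
  cons_measure_sigma_finite.

End ConsMeasure.

Fixpoint lebesgue (R : realType) (n : nat) :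
    {sigma_finite_measure set (n.-tuple (measurableTypeR R)) -> \bar R} :=
  match n with
  | 0 => @dirac _ (0.-tuple (measurableTypeR R)) [tuple] R
  | n'.+1 => cons_measure (@lebesgue_measure R) (lebesgue R n')
  end.

(** Points of R^d are row vectors; measure-theoretically a row vector is
    identified with the tuple of its coordinates. *)
Section EuclideanSpace.
Context (R : realType) (d : nat).
Implicit Types (f g : 'rV[R]_d -> R[i]) (D : set 'rV[R]_d).

Definition row_of (t : d.-tuple (measurableTypeR R)) : 'rV[R]_d :=
  \row_i tnth t i.

Definition cintegrable D f : Prop :=
  (lebesgue R d).-integrable (row_of @^-1` D)
    (fun t => (complex.Re (f (row_of t)))%:E) /\
  (lebesgue R d).-integrable (row_of @^-1` D)
    (fun t => (complex.Im (f (row_of t)))%:E).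

Definition cintegral D f : R[i] :=
  Complex
    (\int[lebesgue R d]_(t in row_of @^-1` D) complex.Re (f (row_of t)))
    (\int[lebesgue R d]_(t in row_of @^-1` D) complex.Im (f (row_of t))).

Definition dot (x y : 'rV[R]_d) : R := \sum_i x 0 i * y 0 i.

(** The sequence [s] lists the coordinates to differentiate along; as [s]
    varies one gets all the D^alpha, alpha in N_0^d. *)
Definition rpartial (s : seq 'I_d) (f : 'rV[R]_d -> R) : 'rV[R]_d -> R :=
  foldr (fun i h => 'D_(delta_mx 0 i) h) f s.

Definition rsmooth (f : 'rV[R]_d -> R) : Prop :=
  forall s : seq 'I_d, continuous (rpartial s f) /\
    forall (i : 'I_d) (x : 'rV[R]_d), derivable (rpartial s f) x (delta_mx 0 i).

Definition partial (s : seq 'I_d) f : 'rV[R]_d -> R[i] := fun x =>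
  Complex (rpartial s (fun y => complex.Re (f y)) x)
          (rpartial s (fun y => complex.Im (f y)) x).

Definition smooth f : Prop :=
  rsmooth (fun x => complex.Re (f x)) /\ rsmooth (fun x => complex.Im (f x)).

Definition schwartz_seminorm (m : nat) (s : seq 'I_d) f : \bar R :=
  ereal_sup (range (fun x : 'rV[R]_d =>
    ((1 + `|x|) ^+ m * Normc.normc (partial s f x))%:E)).

Definition schwartz f : Prop :=
  smooth f /\ forall m s, (schwartz_seminorm m s f < +oo)%E.

Definition schwartz_cvg (u : nat -> 'rV[R]_d -> R[i]) f : Prop :=
  forall m s,
    (fun j => schwartz_seminorm m s (fun x => u j x - f x)) @ \oo --> 0%E.

(** A distribution is represented by a functional defined on all functions
    R^d -> C, of which only the values at test functions are meaningful: every
    property below, as well as equality, is tested on test functions only. *)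
Definition functional : Type := ('rV[R]_d -> R[i]) -> R[i].
Implicit Types T : functional.

Definition tempered T : Prop :=
  (forall (a : R[i]) f g, schwartz f -> schwartz g ->
     T (fun x => a * f x + g x) = a * T f + T g) /\
  (forall (u : nat -> 'rV[R]_d -> R[i]) f,
     (forall j, schwartz (u j)) -> schwartz f -> schwartz_cvg u f ->
     (fun j => Normc.normc (T (u j) - T f)) @ \oo --> (0 : R)).

Definition expi (t : R) : R[i] := Complex (cos t) (sin t).

(** unitary normalisation, (2 pi)^(-d/2) int exp(-i x.xi) f(x) dx *)
Definition fourier_const : R[i] := ((2 * pi) `^ (- (d%:R / 2)))%:C%C.

Definition fourier f : 'rV[R]_d -> R[i] := fun xi =>
  fourier_const * cintegral setT (fun x => expi (- dot x xi) * f x).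

Definition inv_fourier f : 'rV[R]_d -> R[i] := fun x =>
  fourier_const * cintegral setT (fun xi => expi (dot x xi) * f xi).

Definition dfourier T : functional := fun f => T (fourier f).
Definition dinv_fourier T : functional := fun f => T (inv_fourier f).
Definition dmul (h : 'rV[R]_d -> R[i]) T : functional :=
  fun f => T (fun x => h x * f x).

(** [T] is the regular distribution given by the continuous function [g];
    there is at most one such [g]. *)
Definition represents g T : Prop :=
  continuous (fun x => complex.Re (g x)) /\
  continuous (fun x => complex.Im (g x)) /\
  forall f, schwartz f ->
    cintegrable setT (fun x => g x * f x) /\
    T f = cintegral setT (fun x => g x * f x).

(** Only used for distributions whose Fourier transform has compact support,
    which are (smooth) functions by the Paley-Wiener-Schwartz theorem. *)
Definition density T : 'rV[R]_d -> R[i] :=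
  xget (fun=> 0) [set g | represents g T].

Definition dyadic1 (phi0 : R -> R[i]) (k : nat) (x : R) : R[i] :=
  if k is 0 then phi0 x else phi0 (x / 2 ^+ k) - phi0 (x / 2 ^+ k.-1).

Definition dyadic (phi0 : R -> R[i]) (k : {ffun 'I_d -> nat})
    (x : 'rV[R]_d) : R[i] :=
  \prod_i dyadic1 phi0 (k i) (x 0 i).

Definition dyadic_block phi0 T (k : {ffun 'I_d -> nat}) : 'rV[R]_d -> R[i] :=
  density (dinv_fourier (dmul (dyadic phi0 k) (dfourier T))).

(** meant for finite [q] *)
Definition SF_quasinorm phi0 (p q r : R) T : \bar R :=
  Lnorm (lebesgue R d) p%:E (fun t =>
    poweR (\esum_(k in [set: {ffun 'I_d -> nat}])
      (2 `^ (r * (\sum_i k i)%:R * q) *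
       Normc.normc (dyadic_block phi0 T k (row_of t)) `^ q)%:E) q^-1).

Definition SF_space phi0 (p q r : R) : set functional :=
  [set T | tempered T /\ (SF_quasinorm phi0 p q r T < +oo)%E].

Definition cube : set 'rV[R]_d := [set x | forall i, 0 <= x 0 i < 1].

Definition cube_test f : Prop :=
  smooth f /\ compact (closure [set x | f x != 0]) /\
  closure [set x | f x != 0] `<=` interior cube.

Definition restricts_to T U : Prop := forall f, cube_test f -> T f = U f.

(** Quasi-norm of the distribution [U] on the interior of the cube; it is [+oo]
    when no element of [SF_space] restricts to [U], so that a finite value
    expresses membership of [U] in the space on the cube. *)
Definition SF_cube_quasinorm phi0 (p q r : R) (U : functional) : \bar R :=
  ereal_inf [set SF_quasinorm phi0 p q r T |
    T in [set T | SF_space phi0 p q r T /\ restricts_to T U]].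

(** regular distribution on the cube with density [h] *)
Definition cube_distribution (h : 'rV[R]_d -> R) : functional :=
  fun f => cintegral cube (fun x => (h x)%:C%C * f x).

Definition discrepancy (N : nat) (P : 'I_N -> 'rV[R]_d) (x : 'rV[R]_d) : R :=
  N%:R^-1 * (\sum_(z < N) [forall i, 0 <= P z 0 i < x 0 i]%:R) - \prod_i x 0 i.

End EuclideanSpace.

Definition dyadic_cutoff (R : realType) (phi0 : R -> R[i]) : Prop :=
  [/\ schwartz (fun x : 'rV[R]_1 => phi0 (x 0 0)),
      forall x, `|x| <= 1 -> phi0 x = 1 &
      forall x, 3 / 2 < `|x| -> phi0 x = 0].

Section DigitalNets.
Context (d b s n : nat).
Implicit Types (C : 'I_d -> 'M['F_b]_(s, n)).

(** base-[b] digits of [nu], least significant first *)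
Definition digits (nu : nat) : 'cV['F_b]_n :=
  \col_(k < n) ((nu %/ b ^ k) %% b)%:R.

Definition digital_net (R : realType) C (nu : 'I_(b ^ n)) : 'rV[R]_d :=
  \row_i \sum_(j < s) ((C i *m digits nu) j 0 : nat)%:R / b%:R ^+ j.+1.

(** [lam i] is the decreasing sequence lambda_(i,1) > ... > lambda_(i,eta_i),
    with row indices starting at 0, hence the [l.+1]. *)
Definition order_net (sigma v : nat) C : Prop :=
  [/\ (sigma * n <= s)%N, (v <= sigma * n)%N &
    forall lam : 'I_d -> seq 'I_s,
      (forall i, sorted (fun k l : 'I_s => (l < k)%N) (lam i)) ->
      (\sum_i \sum_(l <- take sigma (lam i)) l.+1 <= sigma * n - v)%N ->
      free (flatten
        [seq [seq row l (C i) | l <- lam i] | i <- enum 'I_d])].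

End DigitalNets.

(* Main.v *)
(** The dyadic block of the discrepancy function at frequency k is an explicit combination of
    products of one-dimensional kernels with rapid decay at scale 2^-k_i, evaluated at the
    points of the net and, for the volume term, integrated.  Write k_i = kappa_i log_2 b up to
    a bounded error.  A net of order 1 has the right number of points in every elementary box
    of total level at most n - v; telescoping each kernel over b-adic levels, only the
    increments of total level beyond n - v survive.  For the coordinates in J this bounds the
    block by (L+2)^d b^-L times an average over the net of the decaying kernels, where
    L = (n - v - sum of the kappa_i over J)_+.  Together with the weight
    prod (1 + x_i^2), which the cubic decay of the kernels absorbs, this gives for m = max p q,
    as r m < 1,
      2^(r m |k|) int |block|^m weight^m <= C b^((r-1) n m) tau^(distance),  tau < 1,
    where the distance is that of the level of k to n, plus the frequencies outside J.  Since
    O(n^(d-1)) frequencies lie at bounded distance, Jensen's inequality for the sum over k and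
    Young's inequality (from L_m down to L_p, using the weight) give the bound. *)
Require Import Defs.
From mathcomp Require Import all_boot all_order all_algebra.
From mathcomp Require Import all_classical all_reals all_analysis.
From mathcomp Require Import measurable_realfun complex ring lra zify.
Set Implicit Arguments.
Unset Strict Implicit.
Unset Printing Implicit Defensive.
Import Order.TTheory GRing.Theory Num.Theory numFieldNormedType.Exports.
Local Open Scope classical_set_scope.
Local Open Scope ring_scope.
Local Notation Re := complex.Re.
Local Notation Im := complex.Im.
Local Notation normc := Normc.normc.

(** * Integrals of complex functions *)

Section ComplexNorm.
Context {R : realType}.
Implicit Types z w : R[i].

(** The infimum over extensions is bounded by a single one, the discrepancy function set to zero
    outside the cube. It jumps across the faces x_i = 1, which brings a term at z = 1 into every
    one-dimensional kernel and forces the expansion over subsets J. A coordinate outside J sees only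
    the jump: the net gives no cancellation there, and what remains is localisation to width 2^-k_i,
    worth 2^((r m - 1) k_i) in the sum. For the coordinates in J, of total level T with L = n - T
    (up to v), the L_m balance is b^(r m T - m L - (m - 1) T - T) = b^((r - 1) n m) b^(-r m L), so r
    > 0 gives the decay below level n. Above level n the supremum bound saturates at b^-n, and r m <
    1 makes the excess summable. The m-th power is reduced to a first power by a supremum bound over
    x. Hence only L_1 norms of explicit products are computed, and no maximal inequality enters. *)

Lemma normcE2 z : normc z = Num.sqrt (Re z ^+ 2 + Im z ^+ 2).
Proof. by case: z. Qed.

Lemma normc_ge0 z : 0 <= normc z.
Proof. by rewrite normcE2 sqrtr_ge0. Qed.

Lemma normcD z w : normc (z + w) <= normc z + normc w.
Proof. exact: le_normcD. Qed.

Lemma normcNE z : normc (- z) = normc z.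
Proof. exact: normcN. Qed.

Lemma normcB z w : normc (z - w) <= normc z + normc w.
Proof. by rewrite (le_trans (normcD _ _))// normcNE. Qed.

Lemma normc_real (x : R) : normc x%:C%C = `|x|.
Proof. by rewrite normcE2/= expr0n/= addr0 sqrtr_sqr. Qed.

Lemma normc_ge_absRe z : `|Re z| <= normc z.
Proof. by rewrite normcE2 -sqrtr_sqr ler_wsqrtr// lerDl sqr_ge0. Qed.

Lemma normc_ge_absIm z : `|Im z| <= normc z.
Proof. by rewrite normcE2 -sqrtr_sqr ler_wsqrtr// lerDr sqr_ge0. Qed.

Lemma normc_le_ReIm z : normc z <= `|Re z| + `|Im z|.
Proof.
rewrite normcE2 -[leRHS]ger0_norm ?addr_ge0// -sqrtr_sqr ler_wsqrtr//.
rewrite sqrrD !real_normK ?num_real// addrAC lerDl mulrn_wge0//.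
Qed.

Lemma normc_sum (I : Type) (s : seq I) (P : pred I) (F : I -> R[i]) :
  normc (\sum_(i <- s | P i) F i) <= \sum_(i <- s | P i) normc (F i).
Proof.
elim/big_rec2: _ => [|i y1 y2 _ h]; first by rewrite Normc.normc0.
by rewrite (le_trans (normcD _ _))// lerD2l.
Qed.

Lemma normc_prod (I : Type) (s : seq I) (P : pred I) (F : I -> R[i]) :
  normc (\prod_(i <- s | P i) F i) = \prod_(i <- s | P i) normc (F i).
Proof.
elim/big_rec2: _ => [|i y1 y2 _ h]; first by rewrite Normc.normc1.
by rewrite Normc.normcM h.
Qed.

Lemma cReD z w : Re (z + w) = Re z + Re w.
Proof. by case: z; case: w. Qed.
Lemma cImD z w : Im (z + w) = Im z + Im w.
Proof. by case: z; case: w. Qed.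
Lemma cReN z : Re (- z) = - Re z.
Proof. by case: z. Qed.
Lemma cImN z : Im (- z) = - Im z.
Proof. by case: z. Qed.
Lemma cReM z w : Re (z * w) = Re z * Re w - Im z * Im w.
Proof. by case: z; case: w. Qed.
Lemma cImM z w : Im (z * w) = Re z * Im w + Im z * Re w.
Proof. by case: z; case: w. Qed.

Lemma eqReIm z w : Re z = Re w -> Im z = Im w -> z = w.
Proof. by case: z; case: w => /= ? ? ? ? -> ->. Qed.

End ComplexNorm.

Section RealIntegrable.
Context d (T : measurableType d) (R : realType) (mu : {measure set T -> \bar R}).
Implicit Types h k : T -> R.

Lemma rintegrableD h k : mu.-integrable setT (EFin \o h) ->
  mu.-integrable setT (EFin \o k) ->
  mu.-integrable setT (EFin \o (fun x => h x + k x)).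
Proof. by move=> ih ik; have := integrableD measurableT ih ik. Qed.

Lemma rintegrableB h k : mu.-integrable setT (EFin \o h) ->
  mu.-integrable setT (EFin \o k) ->
  mu.-integrable setT (EFin \o (fun x => h x - k x)).
Proof. by move=> ih ik; have := integrableB measurableT ih ik. Qed.

Lemma rintegrableZ (c : R) h : mu.-integrable setT (EFin \o h) ->
  mu.-integrable setT (EFin \o (fun x => c * h x)).
Proof. by move=> ih; have := integrableZl measurableT c ih. Qed.

End RealIntegrable.

Section ComplexIntegral.
Context d (T : measurableType d) (R : realType) (mu : {measure set T -> \bar R}).
Implicit Types f g : T -> R[i].

Definition cmeas d' (X : measurableType d') (f : X -> R[i]) :=
  measurable_fun setT (fun x => Re (f x)) /\
  measurable_fun setT (fun x => Im (f x)).

Definition cint f : R[i] :=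
  Complex (\int[mu]_x Re (f x)) (\int[mu]_x Im (f x)).

Definition cinteg f :=
  mu.-integrable setT (EFin \o (fun x => Re (f x))) /\
  mu.-integrable setT (EFin \o (fun x => Im (f x))).

Lemma eq_cint f g : f =1 g -> cint f = cint g.
Proof. by move=> /funext ->. Qed.

Lemma cmeas_cst d' (X : measurableType d') (c : R[i]) : cmeas (fun _ : X => c).
Proof. by split; exact: measurable_cst. Qed.

Lemma cmeasM d' (X : measurableType d') (f g : X -> R[i]) :
  cmeas f -> cmeas g -> cmeas (fun x => f x * g x).
Proof.
move=> [f1 f2] [g1 g2]; split.
  by under eq_fun do rewrite cReM; apply: measurable_funB; exact: measurable_funM.
by under eq_fun do rewrite cImM; apply: measurable_funD; exact: measurable_funM.
Qed.

Lemma cmeas_prod d' (X : measurableType d') (I : Type) (s : seq I)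
    (F : I -> X -> R[i]) :
  (forall i, cmeas (F i)) -> cmeas (fun x => \prod_(i <- s) F i x).
Proof.
move=> mF; elim: s => [|a s ih].
  by under eq_fun do rewrite big_nil; exact: cmeas_cst.
by under eq_fun do rewrite big_cons; exact: cmeasM.
Qed.

Lemma cmeas_real d' (X : measurableType d') (h : X -> R) :
  measurable_fun setT h -> cmeas (fun x => (h x)%:C%C).
Proof. by move=> mh; split => //; exact: measurable_cst. Qed.

Lemma cmeas_comp d' (X : measurableType d') d'' (Y : measurableType d'')
    (f : Y -> R[i]) (h : X -> Y) :
  cmeas f -> measurable_fun setT h -> cmeas (fun x => f (h x)).
Proof.
move=> [f1 f2] mh; split.
  exact: (measurableT_comp f1 mh).
exact: (measurableT_comp f2 mh).
Qed.

Lemma integrable_dom (h A : T -> R) : measurable_fun setT h ->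
  (forall x, `|h x| <= A x) -> mu.-integrable setT (EFin \o A) ->
  mu.-integrable setT (EFin \o h).
Proof.
move=> mh hA; apply: le_integrable => //; first exact/measurable_EFinP.
by move=> x _ /=; rewrite lee_fin (le_trans (hA x))// ler_norm.
Qed.

Lemma cinteg_dom f (A : T -> R) : cmeas f -> (forall x, normc (f x) <= A x) ->
  mu.-integrable setT (EFin \o A) -> cinteg f.
Proof.
move=> [mf1 mf2] fA iA; split; apply: (integrable_dom _ _ iA) => // x.
  exact: le_trans (normc_ge_absRe _) (fA x).
exact: le_trans (normc_ge_absIm _) (fA x).
Qed.

(** Real and imaginary parts are bounded separately, whence the factor 2; it only affects
    constants. *)
Lemma cint_bound f (A : T -> R) : cinteg f -> (forall x, normc (f x) <= A x) ->
  mu.-integrable setT (EFin \o A) -> normc (cint f) <= 2 * \int[mu]_x A x.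
Proof.
move=> [i1 i2] fA iA; rewrite (le_trans (normc_le_ReIm _))//= mulr2n mulrDl mul1r.
apply: lerD; (apply: (le_trans (le_normr_Rintegral _ _)) => //;
  apply: le_Rintegral => //; first exact: integrable_norm) => x _.
  exact: le_trans (normc_ge_absRe _) (fA x).
exact: le_trans (normc_ge_absIm _) (fA x).
Qed.

Lemma cintegD f g : cinteg f -> cinteg g -> cinteg (fun x => f x + g x).
Proof.
move=> [f1 f2] [g1 g2]; split.
  by under eq_fun do rewrite cReD; exact: rintegrableD.
by under eq_fun do rewrite cImD; exact: rintegrableD.
Qed.

Lemma cintegZ (c : R[i]) f : cinteg f -> cinteg (fun x => c * f x).
Proof.
move=> [f1 f2]; split.
  under eq_fun do rewrite cReM.
  by apply: rintegrableB; exact: rintegrableZ.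
under eq_fun do rewrite cImM.
by apply: rintegrableD; exact: rintegrableZ.
Qed.

Lemma cintD f g : cinteg f -> cinteg g ->
  cint (fun x => f x + g x) = cint f + cint g.
Proof.
move=> [f1 f2] [g1 g2]; apply: eqReIm; rewrite /= -RintegralD//.
  by under eq_Rintegral do rewrite cReD.
by under eq_Rintegral do rewrite cImD.
Qed.

Lemma cintZ (c : R[i]) f : cinteg f -> cint (fun x => c * f x) = c * cint f.
Proof.
move=> [f1 f2].
apply: eqReIm; rewrite ?cReM ?cImM/= -!RintegralZl//.
  by rewrite -RintegralB; [under eq_Rintegral do rewrite cReM| |exact: rintegrableZ|exact: rintegrableZ].
by rewrite -RintegralD; [under eq_Rintegral do rewrite cImM| |exact: rintegrableZ|exact: rintegrableZ].
Qed.

Lemma cinteg0 : cinteg (fun=> 0).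
Proof. by split; exact: (@integrable0 _ _ _ mu setT). Qed.

Lemma cint0 : cint (fun=> 0) = 0.
Proof. by apply: eqReIm => /=; rewrite Rintegral_cst ?mul0r. Qed.

Lemma cinteg_sum (I : Type) (s : seq I) (F : I -> T -> R[i]) :
  (forall i, cinteg (F i)) -> cinteg (fun x => \sum_(i <- s) F i x).
Proof.
move=> mF; elim: s => [|a s ih].
  by under eq_fun do rewrite big_nil; exact: cinteg0.
by under eq_fun do rewrite big_cons; exact: cintegD.
Qed.

Lemma cint_sum (I : Type) (s : seq I) (F : I -> T -> R[i]) :
  (forall i, cinteg (F i)) ->
  cint (fun x => \sum_(i <- s) F i x) = \sum_(i <- s) cint (F i).
Proof.
move=> mF; elim: s => [|a s ih].
  by under eq_cint do rewrite big_nil; rewrite cint0 big_nil.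
under eq_cint do rewrite big_cons.
by rewrite big_cons cintD ?ih//; exact: cinteg_sum.
Qed.

End ComplexIntegral.

(** * Fubini's theorem for functions with a product majorant *)

Section DominatedFubini.
Context d1 d2 (X : measurableType d1) (Y : measurableType d2) (R : realType).
Variables (m1 : {sigma_finite_measure set X -> \bar R})
  (m2 : {sigma_finite_measure set Y -> \bar R}) (A : X -> R) (B : Y -> R).
Hypotheses (iA : m1.-integrable setT (EFin \o A))
  (iB : m2.-integrable setT (EFin \o B)).

Section real.
Variable f : X * Y -> R.
Hypotheses (mf : measurable_fun setT f)
  (fAB : forall x y, `|f (x, y)| <= A x * B y).

Lemma integrable_sectionl x : m2.-integrable setT (EFin \o (fun y => f (x, y))).
Proof.
apply: (@integrable_dom _ _ _ m2 _ (fun y => A x * B y)) => //.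
  by apply: measurableT_comp => //; exact: pair1_measurable.
exact: rintegrableZ.
Qed.

Lemma integrable_sectionr y : m1.-integrable setT (EFin \o (fun x => f (x, y))).
Proof.
apply: (@integrable_dom _ _ _ m1 _ (fun x => B y * A x)) => //.
- by apply: measurableT_comp => //; exact: pair2_measurable.
- by move=> x; rewrite mulrC.
exact: rintegrableZ.
Qed.

Lemma integrable_prod_dom : (m1 \x m2)%E.-integrable setT (EFin \o f).
Proof.
have mE : measurable_fun setT (EFin \o f) by exact/measurable_EFinP.
apply/(integrable12ltyP m1 m2 mE).
have iBa : m2.-integrable setT (EFin \o (fun y => `|B y|)) by exact: integrable_norm.
have iAa : m1.-integrable setT (EFin \o (fun y => `|A y|)) by exact: integrable_norm.
(* Neither [A] nor [B] is assumed nonnegative, so their absolute values are integrated. *)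
apply: (@le_lt_trans _ _ (\int[m1]_x ((\int[m2]_y `|B y|) * `|A x|)%:E)%E); last first.
  have iZ := rintegrableZ (\int[m2]_y `|B y|) iAa.
  exact: (integral_fune_lt_pinfty measurableT iZ).
apply: ge0_le_integral => //.
- by move=> x _; exact: integral_ge0.
- have := @measurable_fun_fubini_tonelli_F _ _ _ _ _ m2 (fun z => `|(f z)%:E|)%E.
  apply => //.
  by apply: measurableT_comp => //.
- apply/measurable_EFinP; apply: measurable_funM => //.
  by apply/measurable_EFinP; exact: (measurable_int m1).
move=> x _.
rewrite mulrC -RintegralZl// /Rintegral fineK; last first.
  by apply: integrable_fin_num => //; exact: rintegrableZ.
apply: ge0_le_integral => //.
- apply/measurable_EFinP; apply: measurableT_comp => //.
  by apply: measurableT_comp => //; exact: pair1_measurable.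
- apply/measurable_EFinP; apply: measurable_funM => //.
  by apply/measurable_EFinP; exact: (measurable_int m2).
by move=> y _; rewrite lee_fin -normrM (le_trans (fAB x y))// ler_norm.
Qed.

Lemma fubini_F_fine :
  fubini_F m2 (EFin \o f) = EFin \o (fun x => \int[m2]_y f (x, y)).
Proof.
apply/funext => x; rewrite /fubini_F /Rintegral /= fineK//.
by apply: integrable_fin_num => //; exact: integrable_sectionl.
Qed.

Lemma fubini_G_fine :
  fubini_G m1 (EFin \o f) = EFin \o (fun y => \int[m1]_x f (x, y)).
Proof.
apply/funext => x; rewrite /fubini_G /Rintegral /= fineK//.
by apply: integrable_fin_num => //; exact: integrable_sectionr.
Qed.

Lemma integrable_Rintegral_l :
  m1.-integrable setT (EFin \o (fun x => \int[m2]_y f (x, y))).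
Proof. by rewrite -fubini_F_fine; exact: integrable_fubini_F integrable_prod_dom. Qed.

Lemma Rfubini_prod :
  \int[m1]_x \int[m2]_y f (x, y) = \int[(m1 \x m2)%E]_z f z.
Proof.
rewrite /Rintegral -(integral12_prod_meas1 integrable_prod_dom).
by rewrite fubini_F_fine.
Qed.

Lemma Rfubini :
  \int[m1]_x \int[m2]_y f (x, y) = \int[m2]_y \int[m1]_x f (x, y).
Proof.
rewrite Rfubini_prod /Rintegral -(integral21_prod_meas1 integrable_prod_dom).
by rewrite fubini_G_fine.
Qed.

End real.

Section cplx.
Variable f : X * Y -> R[i].
Hypotheses (mf : cmeas f) (fAB : forall x y, normc (f (x, y)) <= A x * B y).

Let f1 x y : `|Re (f (x, y))| <= A x * B y.
Proof. exact: le_trans (normc_ge_absRe _) (fAB x y). Qed.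
Let f2 x y : `|Im (f (x, y))| <= A x * B y.
Proof. exact: le_trans (normc_ge_absIm _) (fAB x y). Qed.

Lemma cinteg_section x : cinteg m2 (fun y => f (x, y)).
Proof.
split; first exact: (integrable_sectionl mf.1 f1).
exact: (integrable_sectionl mf.2 f2).
Qed.

Lemma cinteg_prod_dom : cinteg (m1 \x m2)%E f.
Proof.
split; first exact: (integrable_prod_dom mf.1 f1).
exact: (integrable_prod_dom mf.2 f2).
Qed.

Lemma cinteg_cint : cinteg m1 (fun x => cint m2 (fun y => f (x, y))).
Proof.
split; first exact: (integrable_Rintegral_l mf.1 f1).
exact: (integrable_Rintegral_l mf.2 f2).
Qed.

Lemma cfubini_prod :
  cint m1 (fun x => cint m2 (fun y => f (x, y))) = cint (m1 \x m2)%E f.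
Proof.
apply: eqReIm; first exact: (Rfubini_prod mf.1 f1).
exact: (Rfubini_prod mf.2 f2).
Qed.

Lemma cfubini :
  cint m1 (fun x => cint m2 (fun y => f (x, y))) =
  cint m2 (fun y => cint m1 (fun x => f (x, y))).
Proof.
apply: eqReIm; first exact: (Rfubini mf.1 f1).
exact: (Rfubini mf.2 f2).
Qed.

End cplx.
End DominatedFubini.

(** * Tensor products *)

Section TupleLebesgue.
Context {R : realType}.
Local Notation mu := (@lebesgue_measure R).
Local Notation TR := (measurableTypeR R).

Lemma tnth_consT0 n (p : TR * n.-tuple TR) : tnth (consT p) ord0 = p.1.
Proof. by []. Qed.

Lemma tnth_consTS n (p : TR * n.-tuple TR) i :
  tnth (consT p) (lift ord0 i) = tnth p.2 i.
Proof. by rewrite /consT tnthS/=; congr tnth; apply/val_inj. Qed.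

Lemma integrable_consT n (f : n.+1.-tuple TR -> \bar R) :
  measurable_fun setT f ->
  (mu \x lebesgue R n)%E.-integrable setT (f \o @consT _ _ n) ->
  (lebesgue R n.+1).-integrable setT f.
Proof.
move=> mf h.
have := @integrable_pushforward _ _ _ _ R _ (@measurable_consT _ TR n) _ setT f mf h measurableT.
by move=> /integrableP[? ?]; apply/integrableP; split.
Qed.

Lemma integral_consT n (f : n.+1.-tuple TR -> \bar R) :
  measurable_fun setT f ->
  (mu \x lebesgue R n)%E.-integrable setT (f \o @consT _ _ n) ->
  (\int[lebesgue R n.+1]_t f t = \int[mu \x lebesgue R n]_z f (consT z))%E.
Proof.
move=> mf h.
exact: (@integral_pushforward _ _ _ _ R _ (@measurable_consT _ TR n) _ setT f mf h measurableT).
Qed.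

Lemma integral_lebesgue0 (f : 0.-tuple TR -> \bar R) : measurable_fun setT f ->
  (\int[lebesgue R 0]_t f t = f [tuple])%E.
Proof.
move=> mf; have := @integral_dirac _ _ [tuple] R setT measurableT f mf.
by rewrite diracE in_setT mul1e.
Qed.

Lemma measurable_coord n (i : 'I_n) d (Y : measurableType d) (h : TR -> Y) :
  measurable_fun setT h -> measurable_fun setT (fun t : n.-tuple TR => h (tnth t i)).
Proof. by move=> mh; apply: (measurableT_comp mh); exact: measurable_tnth. Qed.

Lemma measurable_prodr d (X : measurableType d) (I : Type) (s : seq I)
    (F : I -> X -> R) :
  (forall i, measurable_fun setT (F i)) ->
  measurable_fun setT (fun x => \prod_(i <- s) F i x).
Proof.
move=> mF; elim: s => [|a s ih].
  by under eq_fun do rewrite big_nil; exact: measurable_cst.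
by under eq_fun do rewrite big_cons; exact: measurable_funM.
Qed.

Lemma rmeas (h : TR -> R) : mu.-integrable setT (EFin \o h) -> measurable_fun setT h.
Proof. by move=> ih; apply/measurable_EFinP; exact: measurable_int ih. Qed.

(** Integrability and the value are proved in one induction, because Fubini in the step needs the
    integrability of the tail product. *)
Lemma tensor_integral n (A : 'I_n -> R -> R) :
  (forall i, mu.-integrable setT (EFin \o A i)) ->
  (lebesgue R n).-integrable setT (EFin \o (fun t => \prod_i A i (tnth t i))) /\
  \int[lebesgue R n]_t (\prod_i A i (tnth t i)) = \prod_i \int[mu]_x A i x.
Proof.
elim: n A => [|n ih] A iA.
  split.
    under eq_fun do rewrite big_ord0.
    apply/integrableP; split; first exact: measurable_cst.
    rewrite integral_lebesgue0 ?ltry//; exact: measurable_cst.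
  under eq_Rintegral do rewrite big_ord0.
  by rewrite big_ord0 /Rintegral integral_lebesgue0.
have [iB eB] := ih (fun i => A (lift ord0 i)) (fun i => iA _).
have mf : measurable_fun setT (fun t : n.+1.-tuple TR => \prod_i A i (tnth t i)).
  by apply: measurable_prodr => i; apply: measurable_coord; exact: rmeas.
pose f (z : TR * n.-tuple TR) := A ord0 z.1 * \prod_i A (lift ord0 i) (tnth z.2 i).
have fE : (fun t : n.+1.-tuple TR => \prod_i A i (tnth t i)) \o @consT _ _ n = f.
  apply/funext => z /=; rewrite big_ord_recl tnth_consT0; congr (_ * _).
  by apply: eq_bigr => i _; rewrite tnth_consTS.
have mf' : measurable_fun setT f.
  by rewrite -fE; apply: measurableT_comp => //; exact: measurable_consT.
have nA := integrable_norm (iA ord0).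
have nB := integrable_norm iB.
have fAB x y : `|f (x, y)| <= `|A ord0 x| * `|\prod_i A (lift ord0 i) (tnth y i)|.
  by rewrite /f/= normrM.
have iprod : (mu \x lebesgue R n)%E.-integrable setT
    ((EFin \o (fun t : n.+1.-tuple TR => \prod_i A i (tnth t i))) \o @consT _ _ n).
  rewrite -compA fE.
  exact: (integrable_prod_dom nA nB mf' fAB).
split; first by apply: integrable_consT => //; exact/measurable_EFinP.
rewrite {1}/Rintegral integral_consT//; last exact/measurable_EFinP.
transitivity (\int[(mu \x lebesgue R n)%E]_z f z).
  by rewrite /Rintegral; congr fine; apply: eq_integral => z _; rewrite -fE.
rewrite -(Rfubini_prod nA nB mf' fAB) big_ord_recl -eB.
rewrite -RintegralZr//.
apply: eq_Rintegral => x _; rewrite /f /=.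
by rewrite RintegralZl.
Qed.

Lemma ctensor_dom n (h : 'I_n -> R -> R[i]) (A : 'I_n -> R -> R) :
  (forall i x, normc (h i x) <= A i x) -> forall t : n.-tuple TR,
  normc (\prod_i h i (tnth t i)) <= \prod_i A i (tnth t i).
Proof.
move=> hA t; rewrite normc_prod; apply: ler_prod => i _.
by rewrite normc_ge0 hA.
Qed.

Lemma ctensor_meas n (h : 'I_n -> R -> R[i]) :
  (forall i, cmeas (h i : TR -> R[i])) ->
  cmeas (fun t : n.-tuple TR => \prod_i h i (tnth t i)).
Proof.
move=> mh; apply: (@cmeas_prod _ _ _ _ _ (fun i (t : n.-tuple TR) => h i (tnth t i))) => i.
by apply: (cmeas_comp (mh i)); exact: measurable_tnth.
Qed.

Lemma ctensor_integral n (h : 'I_n -> R -> R[i]) (A : 'I_n -> R -> R) :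
  (forall i, cmeas (h i : TR -> R[i])) ->
  (forall i x, normc (h i x) <= A i x) ->
  (forall i, mu.-integrable setT (EFin \o A i)) ->
  cint (lebesgue R n) (fun t => \prod_i h i (tnth t i)) = \prod_i cint mu (h i).
Proof.
elim: n h A => [|n ih] h A mh hA iA.
  rewrite big_ord0; under eq_cint do rewrite big_ord0.
  by apply: eqReIm; rewrite /= /Rintegral integral_lebesgue0//.
have := ih (fun i => h (lift ord0 i)) (fun i => A (lift ord0 i)) (fun i => mh _)
  (fun i => hA _) (fun i => iA _) => eB.
have [iB _] := tensor_integral (fun i => iA (lift ord0 i)).
pose F (z : TR * n.-tuple TR) := h ord0 z.1 * \prod_i h (lift ord0 i) (tnth z.2 i).
have FE z : \prod_i h i (tnth (consT z) i) = F z.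
  rewrite big_ord_recl tnth_consT0; congr (_ * _).
  by apply: eq_bigr => i _; rewrite tnth_consTS.
have mF : cmeas F.
  apply: cmeasM; first by apply: cmeas_comp (mh ord0) _; exact: measurable_fst.
  apply: (cmeas_comp (ctensor_meas (fun i => mh (lift ord0 i)))).
  exact: measurable_snd.
have Fdom x y : normc (F (x, y)) <= A ord0 x * \prod_i A (lift ord0 i) (tnth y i).
  rewrite /F/= Normc.normcM ler_pM ?normc_ge0//.
  exact: (ctensor_dom (fun i => hA (lift ord0 i))).
have [iF1 iF2] := cinteg_prod_dom (iA ord0) iB mF Fdom.
have [mt1 mt2] := ctensor_meas mh.
transitivity (cint (mu \x lebesgue R n)%E F).
  apply: eqReIm.
    rewrite /= /Rintegral integral_consT; last 2 first.
    - exact/measurable_EFinP.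
    - by rewrite (_ : _ \o _ = EFin \o (fun x => Re (F x)))//; apply/funext => z /=; rewrite FE.
    by congr fine; apply: eq_integral => z _; rewrite FE.
  rewrite /= /Rintegral integral_consT; last 2 first.
  - exact/measurable_EFinP.
  - by rewrite (_ : _ \o _ = EFin \o (fun x => Im (F x)))//; apply/funext => z /=; rewrite FE.
  by congr fine; apply: eq_integral => z _; rewrite FE.
rewrite -(cfubini_prod (iA ord0) iB mF Fdom) big_ord_recl -eB.
have ig : cinteg (lebesgue R n) (fun t => \prod_i h (lift ord0 i) (tnth t i)).
  apply: (cinteg_dom (ctensor_meas (fun i => mh (lift ord0 i))) _ iB).
  exact: (ctensor_dom (fun i => hA (lift ord0 i))).
rewrite [RHS]mulrC -cintZ; last exact: cinteg_dom (mh _) (hA _) (iA _).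
by apply: eq_cint => x; rewrite /F /= cintZ// mulrC.
Qed.

End TupleLebesgue.

(** * The weight 1 / (1 + x^2) *)

Section Eta.
Context {R : realType}.
Local Notation mu := (@lebesgue_measure R).
Implicit Types x y s : R.

(** All decay is measured by this function. It is the derivative of [atan], which gives its integral
    and its sums over unit steps, and its inverse is one coordinate of the weight [wgt]. *)
Definition eta x : R := (1 + x ^+ 2)^-1.

Lemma eta_den_gt0 x : 0 < 1 + x ^+ 2.
Proof. by rewrite ltr_pwDl// sqr_ge0. Qed.

Lemma eta_gt0 x : 0 < eta x.
Proof. by rewrite invr_gt0 eta_den_gt0. Qed.

Lemma eta_ge0 x : 0 <= eta x.
Proof. exact/ltW/eta_gt0. Qed.

Lemma eta_le1 x : eta x <= 1.
Proof. exact: (oneDsqrV_le1 x). Qed.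

Lemma continuous_eta : continuous eta.
Proof. exact: continuous_oneDsqrV. Qed.

Lemma etaN x : eta (- x) = eta x.
Proof. by rewrite /eta sqrrN. Qed.

Lemma eta_norm x : eta `|x| = eta x.
Proof. by rewrite /eta real_normK ?num_real. Qed.

Lemma ler_eta x y : 0 <= x -> x <= y -> eta y <= eta x.
Proof.
move=> x0 xy; rewrite /eta lef_pV2 ?posrE ?eta_den_gt0// lerD2l.
by rewrite lerXn2r// nnegrE// (le_trans x0).
Qed.

Lemma continuous_affine (a b : R) : continuous (fun x => a * x + b).
Proof.
by move=> x; apply: cvgD; [apply: cvgM; [exact: cvg_cst|exact: cvg_id]|exact: cvg_cst].
Qed.

Lemma derive1_affine (a b : R) : derive1 (fun x => a * x + b) = cst a.
Proof.
apply/funext => x; rewrite derive1E derive_val/=.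
by rewrite addr0 /GRing.scale/= mulr1.
Qed.

Lemma integral_etaT : (\int[mu]_x (eta x)%:E = pi%:E)%E.
Proof.
rewrite ge0_symfun_integralT.
- rewrite (_ : [set x | _] = `[0, +oo[%classic); last first.
    by apply/seteqP; split => x/=; rewrite in_itv/= andbT.
  by rewrite integral0y_oneDsqr -EFinM mulrC divfK.
- by move=> x; exact: eta_ge0.
- exact: continuous_eta.
- by move=> x; rewrite /= etaN.
Qed.

Lemma cvg_scaleB_pinfty s a : 0 < s -> s * x + a @[x --> +oo%R] --> +oo%R.
Proof.
move=> s0; apply/cvgryPge => M; near=> x.
rewrite -lerBlDr -ler_pdivrMl//.
Unshelve. all: end_near. Qed.

Lemma cvg_scaleB_ninfty s a : 0 < s -> s * x + a @[x --> -oo%R] --> -oo%R.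
Proof.
move=> s0; apply/cvgrNyPle => M; near=> x.
rewrite -lerBrDr -ler_pdivlMl//.
Unshelve. all: end_near. Qed.

Lemma integral_eta_scale s a : 0 < s ->
  (\int[mu]_x (eta (s * x + a))%:E = (pi / s)%:E)%E.
Proof.
move=> s0; pose F x := s * x + a.
have dF : derive1 F = cst s by exact: derive1_affine.
have h : (\int[mu]_x (eta x)%:E = \int[mu]_x (s * eta (F x))%:E)%E.
  rewrite (@increasing_ge0_integration_by_substitutionT _ F)//.
  - by apply: eq_integral => x _ /=; rewrite dF /= mulrC.
  - by move=> x y xy; rewrite /F ltrD2r ltr_pM2l.
  - by rewrite dF => x; exact: cvg_cst.
  - by rewrite dF; exact: is_cvg_cst.
  - by rewrite dF; exact: is_cvg_cst.
  - exact: cvg_scaleB_ninfty.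
  - exact: cvg_scaleB_pinfty.
  - exact: continuous_eta.
  - by move=> x; exact: eta_ge0.
have mF : measurable_fun setT F.
  apply: continuous_measurable_fun. exact: continuous_affine.
have me : measurable_fun setT (fun x => (eta (F x))%:E).
  apply/measurable_EFinP; apply: (measurableT_comp _ mF).
  apply: continuous_measurable_fun; exact: continuous_eta.
move: h; rewrite integral_etaT.
under eq_integral do rewrite EFinM.
rewrite ge0_integralZl//; last 2 first.
- by move=> x _; rewrite lee_fin eta_ge0.
- by rewrite lee_fin ltW.
move=> h; have : (s^-1%:E * pi%:E = s^-1%:E * (s%:E * \int[mu]_x (eta (F x))%:E))%E by rewrite h.
rewrite muleA -!EFinM mulVf ?gt_eqF// mul1e mulrC => <- //.
Qed.

Lemma measurable_eta_scale s a : measurable_fun setT (fun x => eta (s * x + a)).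
Proof.
apply: continuous_measurable_fun => x.
apply: (@continuous_comp _ _ _ (fun x => s * x + a)); last exact: continuous_eta.
exact: continuous_affine.
Qed.

Lemma integrable_eta_scale s a : 0 < s ->
  mu.-integrable setT (EFin \o (fun x => eta (s * x + a))).
Proof.
move=> s0; apply/integrableP; split.
  apply/measurable_EFinP; exact: measurable_eta_scale.
under eq_integral do rewrite /= ger0_norm ?eta_ge0//.
by rewrite integral_eta_scale ?ltry.
Qed.

Lemma Rintegral_eta_scale s a : 0 < s ->
  \int[mu]_x eta (s * x + a) = pi / s.
Proof. by move=> s0; rewrite /Rintegral integral_eta_scale. Qed.

Lemma integrable_eta : mu.-integrable setT (EFin \o eta).
Proof.
have := @integrable_eta_scale 1 0 ltr01.
by under eq_fun do rewrite mul1r addr0.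
Qed.

Lemma Rintegral_eta : \int[mu]_x eta x = pi.
Proof. by rewrite /Rintegral integral_etaT. Qed.

(** Peetre's inequality: 1 + x^2 <= 2 (1 + y^2) (1 + (x + y)^2). It lets the argument of [eta] be
    moved at a cost depending only on the displacement. *)
Lemma eta_shift x y : eta (x + y) <= 2 * eta x * (1 + y ^+ 2).
Proof.
have b0 := eta_den_gt0 x; have a0 := eta_den_gt0 (x + y).
rewrite /eta -[leLHS]div1r ler_pdivrMr// -(ler_pM2l b0) mulr1.
have -> : (1 + x ^+ 2) * (2 * (1 + x ^+ 2)^-1 * (1 + y ^+ 2) * (1 + (x + y) ^+ 2)) =
   2 * (1 + y ^+ 2) * (1 + (x + y) ^+ 2).
  by rewrite !mulrA [_ * 2]mulrC -!mulrA mulVKf// gt_eqF.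
have := sqr_ge0 (x + y + y); have := sqr_ge0 ((x + y) * y).
rewrite exprMn !expr2; nra.
Qed.

End Eta.

(** * Measurability on R^d and regular tempered distributions *)

Section RowVectors.
Context {R : realType}.
Local Notation TR := (measurableTypeR R).

Lemma row_ofE n (t : n.-tuple TR) i : row_of t 0 i = tnth t i.
Proof. by rewrite mxE. Qed.

Lemma coord_le_norm n (x : 'rV[R]_n) i : `|x 0 i| <= `|x|.
Proof.
rewrite [leRHS]/Num.norm/= mx_normrE.
by apply: (@le_bigmax_cond _ _ _ _ (0, i) predT (fun ij => `|x ij.1 ij.2|)).
Qed.

(** Links the topology of row vectors to the product sigma-algebra of tuples: an open set is a
    countable union of cubes with rational centre and radius 1 / (k + 1). *)
Lemma open_measurable_row n (O : set 'rV[R]_n) : open O ->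
  measurable ((@row_of R n) @^-1` O).
Proof.
move=> oO.
pose G (qk : 'rV[rat]_n * nat) : set 'rV[R]_n :=
  [set x | forall i, ball (ratr (qk.1 0 i) : R) (qk.2.+1%:R^-1) (x 0 i)].
(* Cubes that leave [O] are replaced by the empty set, so the union runs over a whole countable
   type. *)
pose F (qk : 'rV[rat]_n * nat) : set (n.-tuple TR) :=
  if asbool (G qk `<=` O) then (@row_of R n) @^-1` (G qk) else set0.
have -> : (@row_of R n) @^-1` O = \bigcup_qk F qk.
  apply/seteqP; split => [t /= Ot|t [qk _]]; last first.
    by rewrite /F; case: asboolP => // GO /GO.
  have /nbhs_ballP[e /= e0 eO] : nbhs (row_of t) O by exact: open_nbhs_nbhs.
  have [k ke] : exists k : nat, k.+1%:R^-1 < e / 2.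
    have [k _ /(_ k (leqnn k)) h] := near_infty_natSinv_lt (PosNum (divr_gt0 e0 (ltr0Sn _ 1))).
    by exists k.
  have hq i : exists q : rat, ball (ratr q : R) (k.+1%:R^-1) (row_of t 0 i).
    have k0 : (0 : R) < k.+1%:R^-1 by rewrite invr_gt0.
    have /rat_in_itvoo[q] : row_of t 0 i - k.+1%:R^-1 < row_of t 0 i + k.+1%:R^-1.
      by rewrite ltrBlDr -addrA ltrDl addr_gt0.
    rewrite in_itv/= => /andP[q1 q2]; exists q.
      by rewrite /ball/= ltr_distl q1 q2.
  have [q qP] := choice hq.
  exists (\row_i q i, k) => //; rewrite /F; case: asboolP => /= [_|GO].
    by move=> i; rewrite /G/= mxE; exact: qP.
  exfalso; apply: GO => x Gx; apply: eO; split => // i j.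
  rewrite (ord1 i).
  have := Gx j; rewrite /= mxE => h1; have h2 := qP j.
  have h3 := ball_triangle (ball_sym h2) h1.
  by apply: le_ball h3; rewrite (le_trans (ltW (ltrD ke ke)))// -splitr.
apply: countable_bigcupT_measurable; first exact: countableP.
move=> qk; rewrite /F; case: ifPn => _ //.
have -> : (@row_of R n) @^-1` (G qk) =
    \big[setI/setT]_i ((fun t => tnth t i) @^-1` (ball (ratr (qk.1 0 i) : R) (qk.2.+1%:R^-1))).
  rewrite -bigcap_seq; apply/seteqP; split => t /=.
    by move=> h i _ /=; have := h i; rewrite row_ofE.
  by move=> h i; rewrite row_ofE; apply: h; rewrite /= mem_index_enum.
apply: bigsetI_measurable => i _; rewrite -[X in measurable X]setTI.
by apply: measurable_tnth => //; exact: measurable_ball.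
Qed.

Lemma continuous_measurable_row n (g : 'rV[R]_n -> R) : continuous g ->
  measurable_fun setT (fun t : n.-tuple TR => g (row_of t)).
Proof.
move=> /continuousP cg; apply: (measurability _ (RGenOpens.measurableE R)).
move=> _ [_ [a [b ->] <-]]; rewrite setTI.
exact: (open_measurable_row (cg _ (interval_open _ _))).
Qed.

End RowVectors.

Section Schwartz.
Context {R : realType} (n : nat).
Local Notation TR := (measurableTypeR R).
Implicit Types (f g h : 'rV[R]_n -> R[i]).

Lemma partial_nil f x : partial [::] f x = f x.
Proof. by rewrite /partial/=; case: (f x). Qed.

Definition teta (x : 'rV[R]_n) : R := \prod_i eta (x 0 i).

Lemma teta_ge0 x : 0 <= teta x.
Proof. by apply: prodr_ge0 => i _; exact: eta_ge0. Qed.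

Lemma teta_le1 x : teta x <= 1.
Proof. by apply: prodr_ile1 => i; rewrite eta_ge0 eta_le1. Qed.

(** Each coordinate costs one factor (1 + |x|)^2, whence the exponent 2 n. Thus a single Schwartz
    seminorm yields an integrable majorant. *)
Lemma teta_weight x : 1 <= (1 + `|x|) ^+ (2 * n) * teta x.
Proof.
have -> : (1 + `|x|) ^+ (2 * n) * teta x = \prod_(i < n) ((1 + `|x|) ^+ 2 * eta (x 0 i)).
  by rewrite big_split/= prodr_const card_ord exprM.
elim/big_ind: _ => // [a b|i _]; first exact: mulr_ege1.
rewrite /eta ler_pdivlMr ?eta_den_gt0// mul1r//.
have := coord_le_norm x i; have := normr_ge0 (x 0 i).
by rewrite -(real_normK (num_real (x 0 i))) !expr2; nra.
Qed.

Lemma teta_integral :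
  (lebesgue R n).-integrable setT (EFin \o (fun t => teta (row_of t))) /\
  \int[lebesgue R n]_t teta (row_of t) = pi ^+ n.
Proof.
have [h1 h2] := @tensor_integral R n (fun=> eta) (fun=> integrable_eta).
have E : (fun t => teta (row_of t)) = (fun t : n.-tuple TR => \prod_i eta (tnth t i)).
  by apply/funext => t; apply: eq_bigr => i _; rewrite row_ofE.
by rewrite E h2 prodr_const card_ord Rintegral_eta.
Qed.

Lemma seminorm_bound f x : (schwartz_seminorm (2 * n) [::] f < +oo)%E ->
  normc (f x) <= fine (schwartz_seminorm (2 * n) [::] f) * teta x.
Proof.
move=> foo.
have ub : (((1 + `|x|) ^+ (2 * n) * normc (f x))%:E <= schwartz_seminorm (2 * n) [::] f)%E.
  by apply: ereal_sup_ubound; exists x; rewrite // partial_nil.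
have fin : schwartz_seminorm (2 * n) [::] f \is a fin_num.
  rewrite ge0_fin_numE//; apply: le_trans ub.
  by rewrite lee_fin mulr_ge0 ?normc_ge0// exprn_ge0// addr_ge0.
move: ub; rewrite -{1}(fineK fin) lee_fin => ub.
apply: le_trans (ler_wpM2r (teta_ge0 x) ub).
rewrite mulrAC -[leLHS]mul1r ler_wpM2r ?normc_ge0//; exact: teta_weight.
Qed.

Lemma schwartz_bound f : schwartz f ->
  exists2 C : R, 0 <= C & forall x, normc (f x) <= C * teta x.
Proof.
move=> [_ fs]; exists (fine (schwartz_seminorm (2 * n) [::] f)).
  apply: fine_ge0; apply: le_trans (ereal_sup_ubound _); last by exists 0.
  by rewrite lee_fin mulr_ge0 ?normc_ge0// exprn_ge0// addr_ge0.
by move=> x; exact: seminorm_bound (fs _ _).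
Qed.

Lemma schwartz_cmeas f : schwartz f -> cmeas (fun t : n.-tuple TR => f (row_of t)).
Proof.
move=> [[s1 s2] _]; split.
  exact: (continuous_measurable_row (s1 [::]).1).
exact: (continuous_measurable_row (s2 [::]).1).
Qed.

Variables (h : 'rV[R]_n -> R[i]) (B : R).
Hypotheses (mh : cmeas (fun t : n.-tuple TR => h (row_of t)))
  (hB : forall x, normc (h x) <= B).

Lemma cinteg_bounded_schwartz f C : cmeas (fun t : n.-tuple TR => f (row_of t)) ->
  (forall x, normc (f x) <= C * teta x) ->
  cinteg (lebesgue R n) (fun t => h (row_of t) * f (row_of t)).
Proof.
move=> mf fC; apply: (@cinteg_dom _ _ _ _ _ (fun t => (B * C) * teta (row_of t))).
- exact: cmeasM.
- move=> t; rewrite Normc.normcM -mulrA ler_pM ?normc_ge0//.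
- by apply: rintegrableZ; exact: teta_integral.1.
Qed.

(** Continuity needs only the seminorm without derivatives and with exponent 2 n, as it dominates
    the difference by a multiple of [teta]. *)
Lemma tempered_bounded : tempered (fun f => cintegral setT (fun x => h x * f x)).
Proof.
have cE f : cintegral setT (fun x => h x * f x) =
  cint (lebesgue R n) (fun t => h (row_of t) * f (row_of t)) by [].
have B0 : 0 <= B by exact: le_trans (normc_ge0 _) (hB 0).
split=> [a f g sf sg|u f su sf uf].
  have [C _ fC] := schwartz_bound sf; have [D _ gD] := schwartz_bound sg.
  have If := cinteg_bounded_schwartz (schwartz_cmeas sf) fC.
  have Ig := cinteg_bounded_schwartz (schwartz_cmeas sg) gD.
  rewrite !cE -cintZ// -cintD//; last exact: cintegZ.
  by apply: eq_cint => t; rewrite mulrDr mulrCA.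
have := uf (2 * n)%N [::] => /fine_cvgP[ufin ucvg].
have key : \forall j \near \oo, normc (cintegral setT (fun x => h x * u j x) -
    cintegral setT (fun x => h x * f x)) <=
    (2 * B * pi ^+ n) * fine (schwartz_seminorm (2 * n) [::] (fun x => u j x - f x)).
  near=> j.
  have jfin : schwartz_seminorm (2 * n) [::] (fun x => u j x - f x) \is a fin_num.
    by near: j.
  have [C _ fC] := schwartz_bound sf; have [D _ gD] := schwartz_bound (su j).
  have If := cinteg_bounded_schwartz (schwartz_cmeas sf) fC.
  have Ig := cinteg_bounded_schwartz (schwartz_cmeas (su j)) gD.
  have E : cintegral setT (fun x => h x * u j x) - cintegral setT (fun x => h x * f x) =
     cint (lebesgue R n) (fun t => h (row_of t) * u j (row_of t) + (-1) * (h (row_of t) * f (row_of t))).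
    by rewrite cintD//; [rewrite cintZ// mulN1r|exact: cintegZ].
  set S := fine _.
  have dS x : normc (u j x - f x) <= S * teta x.
    by apply: (@seminorm_bound (fun x => u j x - f x)); rewrite ltey_eq jfin.
  rewrite E (le_trans (cint_bound _ _ (rintegrableZ (B * S) teta_integral.1)))//.
  - by apply: cintegD => //; exact: cintegZ.
  - move=> t; rewrite mulN1r -mulrBr Normc.normcM -mulrA ler_pM ?normc_ge0//.
  - rewrite RintegralZl//; last exact: teta_integral.1.
    by rewrite teta_integral.2; lra.
apply: (@squeeze_cvgr _ _ _ _ (cst 0) (fun j => (2 * B * pi ^+ n) * fine (schwartz_seminorm (2 * n) [::] (fun x => u j x - f x)))).
- near=> j; rewrite normc_ge0/=; near: j; exact: key.
- exact: cvg_cst.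
- by rewrite -[X in _ --> X](mulr0 (2 * B * pi ^+ n)); apply: cvgMl_tmp.
Unshelve. all: end_near. Qed.

End Schwartz.

(** * Smooth functions of compact support *)

Section Smooth1.
Context {R : realType}.
Implicit Types (f g : R -> R) (x : R).

(** k-fold differentiability, by recursion on the derivative: closure under sums, products and
    affine substitutions then follows by induction on k. *)
Fixpoint cn k f : Prop :=
  if k is k'.+1 then (forall x, derivable f x 1) /\ cn k' (derive1 f) else True.

Definition smooth1 f := forall k, cn k f.

Lemma smooth1_derivable f x : smooth1 f -> derivable f x 1.
Proof. by move=> /(_ 1%N)[]. Qed.

Lemma smooth1_derive1 f : smooth1 f -> smooth1 (derive1 f).
Proof. by move=> sf k; have [] := sf k.+1. Qed.

Lemma smooth1_continuous f : smooth1 f -> continuous f.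
Proof.
by move=> sf x; apply/differentiable_continuous/derivable1_diffP/smooth1_derivable.
Qed.

Lemma cnW k f : cn k.+1 f -> cn k f.
Proof. by elim: k f => // k ih f [df cf]; split => //; exact: ih. Qed.

Lemma derive1_is f x (df : R) : is_derive x 1 f df -> derive1 f x = df.
Proof. by move=> h; rewrite derive1E derive_val. Qed.

Lemma is_derive_of_derivable f x : derivable f x 1 -> is_derive x 1 f (derive1 f x).
Proof. by move=> h; rewrite derive1E; exact: DeriveDef. Qed.

Lemma cn_cst k (c : R) : cn k (cst c).
Proof.
elim: k c => //= k ih c; split; first by move=> x; exact: derivable_cst.
have -> : derive1 (cst c) = cst 0; last exact: ih.
by apply/funext => x; apply: derive1_is; exact: is_derive_cst.
Qed.

Lemma cnD k f g : cn k f -> cn k g -> cn k (fun x => f x + g x).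
Proof.
elim: k f g => //= k ih f g [df cf] [dg cg]; split; first by move=> x; exact: derivableD.
have -> : derive1 (fun x => f x + g x) = (fun x => derive1 f x + derive1 g x); last exact: ih.
apply/funext => x; apply: derive1_is.
by apply: is_deriveD; exact: is_derive_of_derivable.
Qed.

Lemma cnM k f g : cn k f -> cn k g -> cn k (fun x => f x * g x).
Proof.
elim: k f g => //= k ih f g [df cf] [dg cg]; split; first by move=> x; exact: derivableM.
have -> : derive1 (fun x => f x * g x) = (fun x => f x * derive1 g x + g x * derive1 f x).
  apply/funext => x; apply: derive1_is.
  by apply: is_deriveM; exact: is_derive_of_derivable.
by apply: cnD; apply: ih => //; [exact: (@cnW k f)|exact: (@cnW k g)].
Qed.

Lemma cn_affine k f (a b : R) : cn k f -> cn k (fun x => f (a * x + b)).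
Proof.
elim: k f => //= k ih f [df cf].
have H x : is_derive x 1 (fun x => f (a * x + b)) (a * derive1 f (a * x + b)).
  have h1 := is_derive_of_derivable (df (a * x + b)).
  have h2 : is_derive x 1 (fun x => a * x + b) a.
    by apply: is_derive_eq; rewrite /GRing.scale/= ?(mulr1,addr0,mulr0,add0r).
  have := @is_derive1_comp R f (fun x => a * x + b) x (derive1 f (a * x + b)) a.
  by rewrite [_ * derive1 f _]mulrC; apply.
split; first by move=> x; exact: ex_derive.
have -> : derive1 (fun x => f (a * x + b)) = (fun x => cst a x * derive1 f (a * x + b)).
  by apply/funext => x; rewrite (derive1_is (H x)).
by apply: cnM; [exact: cn_cst|exact: ih].
Qed.

Lemma smooth1_cst c : smooth1 (cst c). Proof. by move=> k; exact: cn_cst. Qed.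
Lemma smooth1D f g : smooth1 f -> smooth1 g -> smooth1 (fun x => f x + g x).
Proof. by move=> sf sg k; exact: cnD. Qed.
Lemma smooth1M f g : smooth1 f -> smooth1 g -> smooth1 (fun x => f x * g x).
Proof. by move=> sf sg k; exact: cnM. Qed.
Lemma smooth1_affine f a b : smooth1 f -> smooth1 (fun x => f (a * x + b)).
Proof. by move=> sf k; exact: cn_affine. Qed.

Lemma smooth1_derive1n f k : smooth1 f -> smooth1 (derive1n k f).
Proof. by elim: k => //= k ih sf; exact/smooth1_derive1/ih. Qed.

Definition supp_in (A : R) f := forall x, A < `|x| -> f x = 0.

Lemma supp_in_derive1 A f : supp_in A f -> supp_in A (derive1 f).
Proof.
move=> sA x Ax; rewrite derive1E.
rewrite (@near_eq_derive _ _ _ _ (cst 0)) ?derive_cst ?oner_neq0//.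
near=> y; apply: sA; near: y.
by apply: (cvgr_gt `|x|) => //; apply: cvg_norm; exact: cvg_id.
Unshelve. all: end_near. Qed.

Lemma supp_in_derive1n A f k : supp_in A f -> supp_in A (derive1n k f).
Proof. by elim: k => //= k ih sf; exact/supp_in_derive1/ih. Qed.

Lemma supp_bounded A f : supp_in A f -> continuous f ->
  exists2 C, 0 <= C & forall x, `|f x| <= C.
Proof.
move=> sA cf; pose M := Num.max A 0.
have M0 : - M <= M by rewrite ge0_cp// le_max lexx orbT.
have [c _ cmax] := @EVT_max R (fun x => `|f x|) (- M) M M0 (continuous_subspaceT (fun x => cvg_norm (cf x))).
exists `|f c| => // x; have [xM|xM] := leP `|x| M.
  by apply: cmax; rewrite in_itv/= -ler_norml.
by rewrite sA ?normr0// (le_lt_trans _ xM)// le_max lexx.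
Qed.

End Smooth1.

Section TensorDerivative.
Context {R : realType} (n : nat).
Implicit Types (F : 'rV[R]_n -> R) (x : 'rV[R]_n).

(** The parameter is the i-th coordinate itself, not the displacement, so a partial derivative at x
    is an ordinary derivative at x_i. *)
Definition line x (i : 'I_n) (s : R) : 'rV[R]_n := x + (s - x 0 i) *: delta_mx 0 i.

Lemma line_diffquot F x i :
  (fun h : R => h^-1 *: ((F \o shift x) (h *: delta_mx 0 i) - F x)) =
  (fun h : R => h^-1 *: (((fun s => F (line x i s)) \o shift (x 0 i)) (h *: 1) - F (line x i (x 0 i)))).
Proof.
apply/funext => h /=; rewrite /line subrr scale0r addr0 /GRing.scale/= mulr1 addrK.
by congr (_ * (F _ - _)); rewrite addrC.
Qed.

Lemma derivable_line F x i : derivable (fun s => F (line x i s)) (x 0 i) 1 ->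
  derivable F x (delta_mx 0 i).
Proof. by rewrite /derivable line_diffquot. Qed.

Lemma derivable_lineE F x i : derivable F x (delta_mx 0 i) ->
  derivable (fun s => F (line x i s)) (x 0 i) 1.
Proof. by rewrite /derivable line_diffquot. Qed.

Lemma derive_line F x i : 'D_(delta_mx 0 i) F x = 'D_1 (fun s => F (line x i s)) (x 0 i).
Proof. by rewrite /derive line_diffquot. Qed.

Definition tens (B : 'I_n -> R -> R) x : R := \prod_j B j (x 0 j).

Lemma lineE x i s j : line x i s 0 j = if j == i then s else x 0 j.
Proof.
rewrite !mxE eqxx/= [j == i]eq_sym; case: eqVneq => [->|_]; last by rewrite mulr0 addr0.
by rewrite mulr1 addrC subrK.
Qed.

Lemma tens_line B x i s :
  tens B (line x i s) = (\prod_(j | j != i) B j (x 0 j)) * B i s.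
Proof.
rewrite /tens (bigD1 i)//= lineE eqxx mulrC; congr (_ * _).
by apply: eq_bigr => j /negPf ji; rewrite lineE ji.
Qed.

Lemma derivable_tens B x i : derivable (B i) (x 0 i) 1 ->
  derivable (tens B) x (delta_mx 0 i).
Proof.
move=> dB; apply: derivable_line; under eq_fun do rewrite tens_line.
exact: derivableM.
Qed.

Lemma derive_tens B x i : derivable (B i) (x 0 i) 1 ->
  'D_(delta_mx 0 i) (tens B) x =
  tens (fun j => if j == i then derive1 (B j) else B j) x.
Proof.
move=> dB; rewrite derive_line; under eq_fun do rewrite tens_line.
rewrite deriveM// derive_cst scaler0 addr0 /tens [RHS](bigD1 i)//= eqxx mulrC -derive1E.
rewrite /GRing.scale/=; congr (_ * _).
by apply: eq_bigr => j /negPf ->.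
Qed.

Lemma rpartial_tens B s : (forall j, smooth1 (B j)) ->
  rpartial s (tens B) = tens (fun j => derive1n (count_mem j s) (B j)).
Proof.
move=> sB; elim: s => [|i s ih] //=.
rewrite ih; apply/funext => x; rewrite derive_tens; last first.
  exact/smooth1_derivable/smooth1_derive1n.
apply: eq_bigr => j _; rewrite [i == j]eq_sym.
by case: eqVneq => [->|_] //=; rewrite add1n.
Qed.

Lemma continuous_tens B : (forall j, continuous (B j)) -> continuous (tens B).
Proof.
move=> cB; rewrite /tens; elim: (index_enum _) => [|j s ih] x.
  by under eq_fun do rewrite big_nil; exact: cst_continuous.
under eq_fun do rewrite big_cons.
have h1 : {for x, continuous (fun y : 'rV[R]_n => B j (y 0 j))}.
  apply: (@continuous_comp _ _ _ (fun y : 'rV[R]_n => y 0 j) (B j)); last exact: cB.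
  exact: coord_continuous.
exact: (continuousM h1 (ih x)).
Qed.

Lemma rsmooth_tens B : (forall j, smooth1 (B j)) -> rsmooth (tens B).
Proof.
move=> sB s; rewrite rpartial_tens//; split.
  by apply: continuous_tens => j; exact: smooth1_continuous (smooth1_derive1n _ (sB j)).
by move=> i x; apply: derivable_tens; exact/smooth1_derivable/smooth1_derive1n.
Qed.

Lemma rpartial0 s : rpartial s (fun _ : 'rV[R]_n => (0 : R)) = (fun=> 0).
Proof. by elim: s => //= i s ->; apply/funext => x; rewrite derive_cst. Qed.

Lemma schwartz_tens B A : (forall j, smooth1 (B j)) -> (forall j, supp_in A (B j)) ->
  schwartz (fun x => (tens B x)%:C%C).
Proof.
move=> sB sA; split.
  split; first exact: rsmooth_tens.
  move=> s; rewrite rpartial0; split; first by move=> x; exact: cst_continuous.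
  by move=> i x; exact: derivable_cst.
move=> m s; pose D j := derive1n (count_mem j s) (B j).
have hD (j : 'I_n) : exists C : R, 0 <= C /\ forall y : R, `|D j y| <= C.
  have [||C C0 hC] := @supp_bounded R A (D j).
  - exact: supp_in_derive1n.
  - exact: smooth1_continuous (smooth1_derive1n _ (sB j)).
  by exists C.
have {hD} [C hC] := choice hD.
pose M := (1 + `|A|) ^+ m * \prod_j C j.
apply: (@le_lt_trans _ _ M%:E); last exact: ltry.
apply: ub_ereal_sup => _ [x _ <-]; rewrite lee_fin.
have -> : normc (partial s (fun x => (tens B x)%:C%C) x) = `|tens D x|.
  by rewrite /partial rpartial0 -normc_real/= rpartial_tens.
(* In the cube of half-side |A| both factors are bounded; outside it one factor of the tensor
   product vanishes. *)
have [|xA] := boolP [forall j, `|x 0 j| <= `|A|].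
  move=> /forallP xA; rewrite /M ler_pM ?exprn_ge0 ?addr_ge0//.
    rewrite lerXn2r ?nnegrE ?addr_ge0// lerD2l [leLHS]/Num.norm/= mx_normrE.
    by apply: bigmax_le => // -[i j] _ /=; rewrite (ord1 i).
  rewrite /tens normr_prod; apply: ler_prod => j _.
  by rewrite normr_ge0 (hC j).2.
move: xA; rewrite negb_forall => /existsP[j]; rewrite -ltNge => xA.
have -> : tens D x = 0.
  have Dj0 : D j (x 0 j) = 0.
    by apply: (supp_in_derive1n _ (sA j)); exact: le_lt_trans (ler_norm _) xA.
  by rewrite /tens (bigD1 j)//= Dj0 mul0r.
rewrite normr0 mulr0 /M mulr_ge0 ?exprn_ge0 ?addr_ge0//.
by apply: prodr_ge0 => i _; exact: (hC i).1.
Qed.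

End TensorDerivative.

(** * Bump functions and uniqueness of the density *)

Section Cutoff.
Context {R : realType}.

Lemma smooth1_derive1nP (f : R -> R) :
  (forall k x, derivable (derive1n k f) x 1) -> smooth1 f.
Proof.
move=> df k; have : forall m, cn k (derive1n m f); last by move/(_ 0%N).
by elim: k => //= k ih m; split => //; exact: (ih m.+1).
Qed.

Lemma rsmooth_smooth1 (f : R -> R) :
  rsmooth (fun x : 'rV[R]_1 => f (x 0 0)) -> smooth1 f.
Proof.
move=> sf.
have lineE1 (x : 'rV[R]_1) s : line x 0 s 0 0 = s by rewrite lineE eqxx.
have key k : (forall x : 'rV[R]_1,
    rpartial (nseq k (0 : 'I_1)) (fun x : 'rV[R]_1 => f (x 0 0)) x = derive1n k f (x 0 0)) /\
    (forall t : R, derivable (derive1n k f) t 1).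
  elim: k => [|k [ihE ihd]].
    split=> // t; have [_ /(_ 0 (const_mx t))] := sf [::].
    by move=> /derivable_lineE /=; under eq_fun do rewrite lineE1; rewrite mxE.
  have E : forall x : 'rV[R]_1,
    rpartial (nseq k.+1 (0 : 'I_1)) (fun x : 'rV[R]_1 => f (x 0 0)) x = derive1n k.+1 f (x 0 0).
    move=> x /=; move/funext : ihE => ->.
    by rewrite derive_line; under eq_fun do rewrite lineE1; rewrite derive1E.
  split=> // t; have [_ /(_ 0 (const_mx t))] := sf (nseq k.+1 0).
  move/funext : E => ->.
  by move=> /derivable_lineE /=; under eq_fun do rewrite lineE1; rewrite mxE.
by apply: smooth1_derive1nP => k; exact: (key k).2.
Qed.

Variable phi0 : R -> R[i].
Hypothesis hphi0 : dyadic_cutoff phi0.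

Lemma cutoff_smooth : smooth1 (fun t => Re (phi0 t)) /\ smooth1 (fun t => Im (phi0 t)).
Proof. by case: hphi0 => [[[s1 s2] _] _ _]; split; exact: rsmooth_smooth1. Qed.

(** The given cutoff supplies the test functions; squaring its real part makes it nonnegative
    without any assumption on its sign. *)
Definition bump (t : R) : R := Re (phi0 t) * Re (phi0 t).

Lemma bump_ge0 t : 0 <= bump t.
Proof. by rewrite /bump -expr2 sqr_ge0. Qed.

Lemma bump1 t : `|t| <= 1 -> bump t = 1.
Proof. by case: hphi0 => _ h _ /h; rewrite /bump => ->; rewrite mulr1. Qed.

Lemma bump0 t : 3 / 2 < `|t| -> bump t = 0.
Proof. by case: hphi0 => _ _ h /h; rewrite /bump => ->; rewrite mulr0. Qed.

(** Scaled so that |t - a| >= e gives an argument of modulus at least 2 > 3 / 2, where the bump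
    vanishes, and |t - a| <= e / 2 one of modulus at most 1. The expanded affine form fits
    [smooth1_affine]. *)
Definition abump (a e t : R) : R := bump (2 / e * t + - (2 / e * a)).

Lemma abumpE a e t : abump a e t = bump (2 / e * (t - a)).
Proof. by rewrite /abump mulrBr. Qed.

Lemma abump_smooth a e : smooth1 (abump a e).
Proof. by apply: smooth1_affine; apply: smooth1M; exact: cutoff_smooth.1. Qed.

Lemma abump0 a e t : 0 < e -> e <= `|t - a| -> abump a e t = 0.
Proof.
move=> e0 h; rewrite abumpE bump0// normrM ger0_norm ?divr_ge0 ?(ltW e0)//.
apply: (@lt_le_trans _ _ (2 / e * e)); last by rewrite ler_pM2l ?divr_gt0.
by rewrite divfK ?gt_eqF//; lra.
Qed.

Lemma abump1 a e t : 0 < e -> `|t - a| <= e / 2 -> abump a e t = 1.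
Proof.
move=> e0 h; rewrite abumpE bump1// normrM ger0_norm ?divr_ge0 ?(ltW e0)//.
apply: (@le_trans _ _ (2 / e * (e / 2))); first by rewrite ler_pM2l ?divr_gt0.
by rewrite mulrA divfK ?gt_eqF// divff.
Qed.

Lemma abump_supp (a e A : R) : 0 < e -> `|a| + e <= A -> supp_in A (abump a e).
Proof.
move=> e0 aA t At; apply: abump0 => //.
by have := ler_normB t a; have := ler_normD (t - a) a; rewrite subrK; lra.
Qed.

Lemma supp_eta_bound (f : R -> R) A : supp_in A f -> continuous f ->
  exists2 C, 0 <= C & forall x, `|f x| <= C * eta x.
Proof.
move=> sA cf.
have [||C C0 hC] := @supp_bounded R A (fun x => f x * (1 + x ^+ 2)).
- by move=> x Ax; rewrite sA ?mul0r.
- by move=> x; apply: cvgM; [exact: cf|exact: continuous_oneDsqr].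
exists C => // x; rewrite /eta ler_pdivlMr ?eta_den_gt0//.
by have := hC x; rewrite normrM [X in _ * X]ger0_norm ?(ltW (eta_den_gt0 x)).
Qed.

Lemma supp_integrable (f : R -> R) A : supp_in A f -> continuous f ->
  (@lebesgue_measure R).-integrable setT (EFin \o f).
Proof.
move=> sA cf; have [C _ hC] := supp_eta_bound sA cf.
apply: (@integrable_dom _ _ _ (@lebesgue_measure R) f (fun x => C * eta x)) => //.
  exact: continuous_measurable_fun.
by apply: rintegrableZ; exact: integrable_eta.
Qed.

Lemma abump_integral_gt0 a e : 0 < e ->
  0 < \int[@lebesgue_measure R]_x abump a e x.
Proof.
move=> e0.
have iA : (@lebesgue_measure R).-integrable setT (EFin \o abump a e).
  by apply: (@supp_integrable _ (`|a| + e)); [exact: abump_supp|exact/smooth1_continuous/abump_smooth].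
have h : \int[@lebesgue_measure R]_(x in `[a - e / 2, a + e / 2]) (1 : R) <=
    \int[@lebesgue_measure R]_x abump a e x.
  rewrite [leLHS]Rintegral_mkcond; apply: le_Rintegral => //.
    rewrite -restrict_EFin; apply/integrable_restrict => //; rewrite setTI.
    apply: continuous_compact_integrable; first exact: segment_compact.
    by apply: continuous_subspaceT; exact: cst_continuous.
  move=> x _; rewrite patchE; case: ifPn => [|_]; last exact: bump_ge0.
  by rewrite inE/= in_itv/= => hx; rewrite abump1// ler_distl.
apply: lt_le_trans h; rewrite Rintegral_cst// mul1r.
have h : lebesgue_measure [set` `[a - e / 2, a + e / 2]] = e%:E :> \bar R.
  rewrite lebesgue_measure_itv/= lte_fin ifT; first by rewrite -EFinB; congr EFin; lra.
  by lra.
by rewrite [X in fine X](_ : _ = e%:E).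
Qed.

Section Unique.
Context {n : nat}.
Implicit Types (u : 'rV[R]_n -> R) (a : 'rV[R]_n) (g : 'rV[R]_n -> R[i]) (T : functional R n).
Local Notation TR := (measurableTypeR R).

Definition rowbump a e : 'rV[R]_n -> R := tens (fun j => abump (a 0 j) e).

Lemma rowbump_schwartz a e : 0 < e -> schwartz (fun x => (rowbump a e x)%:C%C).
Proof.
move=> e0; apply: (@schwartz_tens _ _ _ (`|a| + e)) => j.
  exact: abump_smooth.
by apply: abump_supp => //; rewrite lerD2r coord_le_norm.
Qed.

Lemma rowbump_ge0 a e x : 0 <= rowbump a e x.
Proof. by apply: prodr_ge0 => j _; exact: bump_ge0. Qed.

Lemma rowbump_integral a e : 0 < e ->
  (lebesgue R n).-integrable setT (EFin \o (fun t => rowbump a e (row_of t))) /\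
  0 < \int[lebesgue R n]_t rowbump a e (row_of t).
Proof.
move=> e0.
have [|h1 h2] := @tensor_integral R n (fun j => abump (a 0 j) e).
  move=> j; apply: (@supp_integrable _ (`|a 0 j| + e)); first exact: abump_supp.
  exact/smooth1_continuous/abump_smooth.
have -> : (fun t => rowbump a e (row_of t)) = (fun t : n.-tuple TR => \prod_j abump (a 0 j) e (tnth t j)).
  by apply/funext => t; apply: eq_bigr => j _; rewrite row_ofE.
split=> //; rewrite h2; apply: prodr_gt0 => j _; exact: abump_integral_gt0.
Qed.

Lemma rowbump_pos u a : continuous u -> 0 < u a ->
  (forall e, 0 < e -> (lebesgue R n).-integrable setT
     (EFin \o (fun t => u (row_of t) * rowbump a e (row_of t)))) ->
  exists2 e, 0 < e & 0 < \int[lebesgue R n]_t (u (row_of t) * rowbump a e (row_of t)).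
Proof.
move=> cu ua iu.
have hlt : u a / 2 < u a by rewrite ltr_pdivrMr// ltr_pMr// ltr1n.
have /nbhs_ballP[e /= e0 eu] : nbhs a [set x | u a / 2 < u x].
  apply: open_nbhs_nbhs; split => //.
  by move/continuousP : cu => /(_ _ (@open_gt _ (u a / 2))).
exists e => //; have [i1 i2] := rowbump_integral a e0.
apply: (@lt_le_trans _ _ (\int[lebesgue R n]_t (u a / 2 * rowbump a e (row_of t)))).
  by rewrite RintegralZl// mulr_gt0// divr_gt0.
apply: le_Rintegral => //; [exact: rintegrableZ|exact: iu|].
move=> t _; have [h|] := boolP [forall j, `|row_of t 0 j - a 0 j| < e].
  apply: ler_wpM2r; first exact: rowbump_ge0.
  apply/ltW/eu; split => // i j; rewrite (ord1 i) /ball/= distrC.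
  by move/forallP : h; apply.
rewrite negb_forall => /existsP[j]; rewrite -leNgt => h.
by rewrite /rowbump /tens (bigD1 j)//= abump0// mul0r !mulr0.
Qed.

Lemma represents_rowbump g T a e : represents g T -> 0 < e ->
  [/\ (lebesgue R n).-integrable setT (EFin \o (fun t => Re (g (row_of t)) * rowbump a e (row_of t))),
     (lebesgue R n).-integrable setT (EFin \o (fun t => Im (g (row_of t)) * rowbump a e (row_of t))),
     \int[lebesgue R n]_t (Re (g (row_of t)) * rowbump a e (row_of t)) = Re (T (fun x => (rowbump a e x)%:C%C)) &
     \int[lebesgue R n]_t (Im (g (row_of t)) * rowbump a e (row_of t)) = Im (T (fun x => (rowbump a e x)%:C%C))].
Proof.
move=> [_ [_ h]] e0; have [[i1 i2] ->] := h _ (rowbump_schwartz a e0).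
have E1 x : Re (g x * (rowbump a e x)%:C%C) = Re (g x) * rowbump a e x.
  by rewrite cReM/= mulr0 subr0.
have E2 x : Im (g x * (rowbump a e x)%:C%C) = Im (g x) * rowbump a e x.
  by rewrite cImM/= mulr0 add0r.
split => /=.
- by move: i1; under eq_fun do rewrite E1.
- by move: i2; under eq_fun do rewrite E2.
- by under [in RHS]eq_Rintegral do rewrite E1.
- by under [in RHS]eq_Rintegral do rewrite E2.
Qed.

(** Fundamental lemma of the calculus of variations: if u1 a > u2 a, a narrow bump at a would
    separate the two integrals. Equality follows by applying it in both directions. *)
Lemma le_of_rowbump u1 u2 : continuous u1 -> continuous u2 ->
  (forall a e, 0 < e -> [/\
    (lebesgue R n).-integrable setT (EFin \o (fun t => u1 (row_of t) * rowbump a e (row_of t))),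
    (lebesgue R n).-integrable setT (EFin \o (fun t => u2 (row_of t) * rowbump a e (row_of t))) &
    \int[lebesgue R n]_t (u1 (row_of t) * rowbump a e (row_of t)) =
    \int[lebesgue R n]_t (u2 (row_of t) * rowbump a e (row_of t))]) ->
  forall a, u1 a <= u2 a.
Proof.
move=> c1 c2 h a; rewrite leNgt; apply/negP => ua.
have ie e : 0 < e -> (lebesgue R n).-integrable setT
     (EFin \o (fun t => (u1 (row_of t) - u2 (row_of t)) * rowbump a e (row_of t))).
  move=> e0; have [i1 i2 _] := h a e e0.
  by under eq_fun do rewrite mulrBl; exact: rintegrableB.
have [||e e0] := @rowbump_pos (fun x => u1 x - u2 x) a _ _ ie.
- by move=> x; exact: (continuousB (c1 x) (c2 x)).
- by rewrite subr_gt0.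
have [i1 i2 E] := h a e e0.
under eq_Rintegral do rewrite mulrBl.
by rewrite RintegralB// E subrr ltxx.
Qed.

Lemma represents_unique g1 g2 T :
  represents g1 T -> represents g2 T -> g1 = g2.
Proof.
move=> r1 r2.
have le12 (h1 h2 : 'rV[R]_n -> R[i]) : represents h1 T -> represents h2 T ->
    forall x, Re (h1 x) <= Re (h2 x) /\ Im (h1 x) <= Im (h2 x).
  move=> s1 s2 x; have [c1 [c1' _]] := s1; have [c2 [c2' _]] := s2.
  split.
    apply: (@le_of_rowbump (fun y => Re (h1 y)) (fun y => Re (h2 y))) => // a e e0.
    have [i1 _ e1 _] := represents_rowbump a s1 e0.
    have [i2 _ e2 _] := represents_rowbump a s2 e0.
    by split => //; rewrite e1 e2.
  apply: (@le_of_rowbump (fun y => Im (h1 y)) (fun y => Im (h2 y))) => // a e e0.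
  have [_ i1 _ e1] := represents_rowbump a s1 e0.
  have [_ i2 _ e2] := represents_rowbump a s2 e0.
  by split => //; rewrite e1 e2.
by apply/funext => x; apply: eqReIm; apply/eqP; rewrite eq_le;
  rewrite ?(le12 _ _ r1 r2 x).1 ?(le12 _ _ r2 r1 x).1 ?(le12 _ _ r1 r2 x).2 ?(le12 _ _ r2 r1 x).2.
Qed.

(** [density] is a choice, so it is computed by exhibiting one continuous representative and
    invoking uniqueness. *)
Lemma densityE g T : represents g T -> density T = g.
Proof.
move=> r; rewrite /density; apply: (represents_unique _ r).
exact: (@xgetPex _ _ [set g | represents g T]) (ex_intro _ g r).
Qed.

End Unique.

End Cutoff.

(** * Oscillatory integrals *)

Section TrigIntegrals.
Context {R : realType}.
Local Notation mu := (@lebesgue_measure R).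
Implicit Types (u v f F : R -> R) (t x : R).

Lemma contD f F : continuous f -> continuous F -> continuous (fun x => f x + F x).
Proof. by move=> cf cg x; exact: (continuousD (cf x) (cg x)). Qed.
Lemma contM f F : continuous f -> continuous F -> continuous (fun x => f x * F x).
Proof. by move=> cf cg x; exact: (continuousM (cf x) (cg x)). Qed.
Lemma contN f : continuous f -> continuous (fun x => - f x).
Proof. by move=> cf x; exact: (continuousN (cf x)). Qed.

Lemma is_derive_continuous f (df : R -> R) : (forall x, is_derive x 1 f (df x)) -> continuous f.
Proof. by move=> h x; apply/differentiable_continuous/derivable1_diffP; have := h x => -[]. Qed.

Lemma ftc_interval F f (a b : R) : a <= b -> (forall x, is_derive x 1 F (f x)) ->
  continuous f -> \int[mu]_(x in `[a, b]) f x = F b - F a.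
Proof.
rewrite le_eqVlt => /predU1P[<-|ab] dF cf.
  by rewrite set_itv1 Rintegral_set1 subrr.
have cF := is_derive_continuous dF.
rewrite /Rintegral (@continuous_FTC2 _ f F)//.
- exact: continuous_subspaceT.
- split.
  + by move=> x _; have := dF x => -[].
  + by apply: cvg_at_right_filter; exact: cF.
  + by apply: cvg_at_left_filter; exact: cF.
- by move=> x _; apply: derive1_is.
Qed.

(** Integration by parts without boundary terms: it is applied to F = trigonometric function times
    test function. *)
Lemma ftc_supp F f A : (forall x, is_derive x 1 F (f x)) -> continuous f ->
  supp_in A F -> supp_in A f -> \int[mu]_x f x = 0.
Proof.
move=> dF cf sF sf; pose B := `|A| + 1.
have AB : A < B by rewrite /B (le_lt_trans (ler_norm A))// ltrDl.
have B0 : 0 <= B by rewrite addr_ge0.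
have -> : \int[mu]_x f x = \int[mu]_(x in `[- B, B]) f x.
  rewrite [RHS]Rintegral_mkcond; apply: eq_Rintegral => x _.
  rewrite patchE; case: ifPn => //; rewrite notin_setE/= in_itv/= => /negP h.
  by apply: sf; rewrite (lt_trans AB)// ltNge ler_norml.
rewrite (ftc_interval _ dF cf); last by rewrite ge0_cp.
by rewrite !sF ?subrr// ?normrN ger0_norm.
Qed.

Definition cosint u t := \int[mu]_x (cos (t * x) * u x).
Definition sinint u t := \int[mu]_x (sin (t * x) * u x).

Definition test A u := smooth1 u /\ supp_in A u.

Lemma test_derive1 A u : test A u -> test A (derive1 u).
Proof. by move=> [h1 h2]; split; [exact: smooth1_derive1|exact: supp_in_derive1]. Qed.

Lemma smooth1_id : smooth1 (@id R).
Proof.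
case=> //= k; split; first by move=> x; exact: derivable_id.
have -> : derive1 (@id R) = cst 1 by apply/funext => x; rewrite derive1_id.
exact: cn_cst.
Qed.

Lemma test_mulx A u : test A u -> test A (fun x => x * u x).
Proof.
move=> [h1 h2]; split; first by apply: smooth1M => //; exact: smooth1_id.
by move=> x Ax; rewrite h2// mulr0.
Qed.

Lemma testZ A (c : R) u : test A u -> test A (fun x => c * u x).
Proof.
move=> [h1 h2]; split; first by apply: (smooth1M (smooth1_cst c)).
by move=> x Ax; rewrite h2// mulr0.
Qed.

Lemma testN A u : test A u -> test A (fun x => - u x).
Proof. by move=> /(testZ (-1)); under eq_fun do rewrite mulN1r. Qed.

Lemma test_integrable A u : test A u -> mu.-integrable setT (EFin \o u).
Proof. by move=> [h1 h2]; apply: supp_integrable h2 _; exact: smooth1_continuous. Qed.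

Lemma is_derive_sint t x : is_derive x 1 (fun x => sin (t * x)) (t * cos (t * x)).
Proof.
have h2 : is_derive x 1 (fun x => t * x) t.
  by apply: is_derive_eq; rewrite /GRing.scale/= ?(mulr1,addr0,mulr0,add0r).
have := @is_derive1_comp R sin (fun x => t * x) x _ _ (is_derive_sin _) h2.
by rewrite [_ * t]mulrC.
Qed.

Lemma is_derive_cost t x : is_derive x 1 (fun x => cos (t * x)) (- (t * sin (t * x))).
Proof.
have h2 : is_derive x 1 (fun x => t * x) t.
  by apply: is_derive_eq; rewrite /GRing.scale/= ?(mulr1,addr0,mulr0,add0r).
have := @is_derive1_comp R cos (fun x => t * x) x _ _ (is_derive_cos _) h2.
by rewrite [_ * t]mulrC mulrN.
Qed.

Lemma continuous_sint t : continuous (fun x => sin (t * x)).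
Proof. exact: is_derive_continuous (is_derive_sint t). Qed.
Lemma continuous_cost t : continuous (fun x => cos (t * x)).
Proof. exact: is_derive_continuous (is_derive_cost t). Qed.

Lemma integrable_trig A u v : test A u -> continuous v -> (forall x, `|v x| <= 1) ->
  mu.-integrable setT (EFin \o (fun x => v x * u x)).
Proof.
move=> tu cv v1; apply: (@integrable_dom _ _ _ mu _ (fun x => `|u x|)).
- apply: measurable_funM; first exact: continuous_measurable_fun.
  by apply: continuous_measurable_fun; exact: smooth1_continuous tu.1.
- by move=> x; rewrite normrM ler_piMl.
- by apply: integrable_norm; exact: test_integrable tu.
Qed.

Lemma normr_sin x : `|sin x| <= 1.
Proof. by rewrite ler_norml sin_geN1 sin_le1. Qed.
Lemma normr_cos x : `|cos x| <= 1.
Proof. by rewrite ler_norml cos_geN1 cos_le1. Qed.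

Lemma integrable_cosint A u t : test A u ->
  mu.-integrable setT (EFin \o (fun x => cos (t * x) * u x)).
Proof.
move=> tu; apply: (@integrable_trig A u (fun x => cos (t * x))) => //.
  exact: continuous_cost.
by move=> x; exact: normr_cos.
Qed.

Lemma integrable_sinint A u t : test A u ->
  mu.-integrable setT (EFin \o (fun x => sin (t * x) * u x)).
Proof.
move=> tu; apply: (@integrable_trig A u (fun x => sin (t * x))) => //.
  exact: continuous_sint.
by move=> x; exact: normr_sin.
Qed.

Lemma trig_bound A u : test A u -> forall t,
  `|cosint u t| <= \int[mu]_x `|u x| /\ `|sinint u t| <= \int[mu]_x `|u x|.
Proof.
move=> tu t; have iu := test_integrable tu.
have ic := integrable_cosint t tu; have is_ := integrable_sinint t tu.
split; (apply: (le_trans (le_normr_Rintegral _ _)) => //);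
  (apply: le_Rintegral => //; [exact: integrable_norm|exact: integrable_norm|]) => x _;
  rewrite normrM ler_piMl//; [exact: normr_cos|exact: normr_sin].
Qed.

Lemma sinint_derive A u t : test A u -> sinint (derive1 u) t = - (t * cosint u t).
Proof.
move=> tu; have tu' := test_derive1 tu.
pose f x := sin (t * x) * derive1 u x + u x * (t * cos (t * x)).
have dF x : is_derive x 1 (fun x => sin (t * x) * u x) (f x).
  have := is_deriveM (is_derive_sint t x) (is_derive_of_derivable (smooth1_derivable tu.1)).
  by [].
have cf : continuous f.
  apply: contD; apply: contM.
  - exact: continuous_sint.
  - exact: smooth1_continuous tu'.1.
  - exact: smooth1_continuous tu.1.
  - by apply: contM; [exact: cst_continuous|exact: continuous_cost].
have f0 : \int[mu]_x f x = 0.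
  apply: (ftc_supp dF cf (A := A)) => x Ax; first by rewrite tu.2 ?mulr0.
  by rewrite /f tu.2// tu'.2// mulr0 mul0r addr0.
apply/eqP; rewrite -subr_eq0 opprK -f0 /sinint /cosint -RintegralZl//; last first.
  exact: integrable_cosint tu.
rewrite -RintegralD//; last 2 first.
- exact: integrable_sinint tu'.
- by apply: rintegrableZ; exact: integrable_cosint tu.
by apply/eqP/eq_Rintegral => x _; rewrite /f; ring.
Qed.

Lemma cosint_derive A u t : test A u -> cosint (derive1 u) t = t * sinint u t.
Proof.
move=> tu; have tu' := test_derive1 tu.
pose f x := cos (t * x) * derive1 u x + u x * (- (t * sin (t * x))).
have dF x : is_derive x 1 (fun x => cos (t * x) * u x) (f x).
  have := is_deriveM (is_derive_cost t x) (is_derive_of_derivable (smooth1_derivable tu.1)).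
  by [].
have cf : continuous f.
  apply: contD; apply: contM.
  - exact: continuous_cost.
  - exact: smooth1_continuous tu'.1.
  - exact: smooth1_continuous tu.1.
  - by apply: contN; apply: contM; [exact: cst_continuous|exact: continuous_sint].
have f0 : \int[mu]_x f x = 0.
  apply: (ftc_supp dF cf (A := A)) => x Ax; first by rewrite tu.2 ?mulr0.
  by rewrite /f tu.2// tu'.2// mulr0 mul0r addr0.
apply/eqP; rewrite -subr_eq0 -f0 /sinint /cosint -RintegralZl//; last first.
  exact: integrable_sinint tu.
rewrite -RintegralB//; last 2 first.
- exact: integrable_cosint tu'.
- by apply: rintegrableZ; exact: integrable_sinint tu.
by apply/eqP/eq_Rintegral => x _; rewrite /f; ring.
Qed.

(** Each integration by parts trades one factor t for a derivative of u and exchanges sine and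
    cosine, which is why both are bounded together. *)
Lemma trig_decay A k u : test A u -> exists2 C, 0 <= C & forall t,
  `|t| ^+ k * `|cosint u t| <= C /\ `|t| ^+ k * `|sinint u t| <= C.
Proof.
elim: k u => [|k ih] u tu.
  exists (\int[mu]_x `|u x|); first by apply: Rintegral_ge0.
  by move=> t; rewrite !mul1r; exact: trig_bound tu t.
have [C C0 hC] := ih _ (test_derive1 tu); exists C => // t.
have [h1 h2] := hC t.
by rewrite !exprSr -!mulrA -!normrM -(cosint_derive _ tu) -[t * cosint _ _]opprK -(sinint_derive _ tu) normrN.
Qed.

(** With z = t^2 one has (1 + z)^3 <= 4 (1 + z^3), so the decay of orders 0 and 6 suffices. *)
Lemma trig_eta A u : test A u -> exists2 C, 0 <= C & forall t,
  `|cosint u t| <= C * eta t ^+ 3 /\ `|sinint u t| <= C * eta t ^+ 3.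
Proof.
move=> tu; have [C C0 hC] := trig_decay 0 tu; have [D D0 hD] := trig_decay 6 tu.
exists (4 * (C + D)); first by rewrite mulr_ge0 ?addr_ge0.
have key (t y : R) : 0 <= y -> `|t| ^+ 0 * y <= C -> `|t| ^+ 6 * y <= D ->
    y <= 4 * (C + D) * eta t ^+ 3.
  move=> y0; rewrite mul1r => yC yD.
  rewrite /eta exprVn ler_pdivlMr ?exprn_gt0 ?eta_den_gt0//.
  move: yD; rewrite (exprM _ 2 3) real_normK ?num_real//.
  set z := t ^+ 2; have z0 : 0 <= z by exact: sqr_ge0.
  move=> yD.
  have h : (1 + z) ^+ 3 <= 4 * (1 + z ^+ 3).
    have : 0 <= (z - 1) ^+ 2 * (z + 1) by rewrite mulr_ge0 ?sqr_ge0// addr_ge0.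
    rewrite !exprS !expr0; nra.
  apply: (@le_trans _ _ (y * (4 * (1 + z ^+ 3)))); first exact: ler_wpM2l.
  nra.
move=> t; have [c1 c2] := hC t; have [d1 d2] := hD t.
by split; apply: key.
Qed.

(** Differentiation under the integral sign; the derivative in t is dominated by |y u(y)| uniformly
    in t. *)
Lemma derive_cosint A u t : test A u ->
  is_derive t 1 (cosint u) (- sinint (fun x => x * u x) t).
Proof.
move=> tu; have tx := test_mulx tu.
have It : `]t - 1, t + 1[%classic t by rewrite /= in_itv/=; apply/andP; split; lra.
have d1 (s y : R) : is_derive s 1 ((fun x y => cos (x * y) * u y) ^~ y) (- (y * sin (s * y)) * u y).
  have h : is_derive s 1 (fun s => cos (s * y)) (- (y * sin (s * y))).
    have := is_derive_cost y s; rewrite [y * s]mulrC.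
    by under eq_fun do rewrite mulrC.
  have := is_deriveM h (is_derive_cst (u y) s 1).
  by move=> h'; apply: (is_derive_eq h'); rewrite scaler0 add0r /GRing.scale/= mulrC.
have hh := @cvg_differentiation_under_integral R _ _ mu (fun x y => cos (x * y) * u y) setT measurableT
  t (t - 1) (t + 1) It (fun s _ => integrable_cosint s tu) (fun s y _ _ => @ex_derive _ _ _ _ _ _ _ (d1 s y))
  (fun y => `|y * u y|) (fun y => normr_ge0 _) (integrable_norm (test_integrable tx)).
have E : \int[mu]_y (partial1of2 (fun x y => cos (x * y) * u y) t y) = - sinint (fun x => x * u x) t.
  rewrite /sinint -[RHS]mulN1r -RintegralZl//; last exact: integrable_sinint tx.
  by apply: eq_Rintegral => y _; rewrite partial1of2E derive_val; ring.
have ub : forall s y, `]t - 1, t + 1[%classic s -> [set: R] y ->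
   `|partial1of2 (fun x y => cos (x * y) * u y) s y| <= `|y * u y|.
  move=> s y _ _; rewrite partial1of2E derive_val mulNr normrN mulrAC normrM ler_piMr//.
  exact: normr_sin.
have {}hh := hh ub; rewrite E in hh.
have hd : derivable (cosint u) t 1.
  rewrite /derivable; apply/cvg_ex; exists (- sinint (fun x => x * u x) t).
  by under eq_fun do rewrite /= [_ *: 1]mulr1.
by apply: DeriveDef => //; rewrite /derive; under eq_fun do rewrite /= [_ *: 1]mulr1; apply: cvg_lim.
Qed.

Lemma derive_sinint A u t : test A u ->
  is_derive t 1 (sinint u) (cosint (fun x => x * u x) t).
Proof.
move=> tu; have tx := test_mulx tu.
have It : `]t - 1, t + 1[%classic t by rewrite /= in_itv/=; apply/andP; split; lra.
have d1 (s y : R) : is_derive s 1 ((fun x y => sin (x * y) * u y) ^~ y) ((y * cos (s * y)) * u y).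
  have h : is_derive s 1 (fun s => sin (s * y)) ((y * cos (s * y))).
    have := is_derive_sint y s; rewrite [y * s]mulrC.
    by under eq_fun do rewrite mulrC.
  have := is_deriveM h (is_derive_cst (u y) s 1).
  by move=> h'; apply: (is_derive_eq h'); rewrite scaler0 add0r /GRing.scale/= mulrC.
have hh := @cvg_differentiation_under_integral R _ _ mu (fun x y => sin (x * y) * u y) setT measurableT
  t (t - 1) (t + 1) It (fun s _ => integrable_sinint s tu) (fun s y _ _ => @ex_derive _ _ _ _ _ _ _ (d1 s y))
  (fun y => `|y * u y|) (fun y => normr_ge0 _) (integrable_norm (test_integrable tx)).
have E : \int[mu]_y (partial1of2 (fun x y => sin (x * y) * u y) t y) = cosint (fun x => x * u x) t.
  by apply: eq_Rintegral => y _; rewrite partial1of2E derive_val; ring.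
have ub : forall s y, `]t - 1, t + 1[%classic s -> [set: R] y ->
   `|partial1of2 (fun x y => sin (x * y) * u y) s y| <= `|y * u y|.
  move=> s y _ _; rewrite partial1of2E derive_val mulrAC normrM ler_piMr//.
  exact: normr_cos.
have {}hh := hh ub; rewrite E in hh.
have hd : derivable (sinint u) t 1.
  rewrite /derivable; apply/cvg_ex; exists (cosint (fun x => x * u x) t).
  by under eq_fun do rewrite /= [_ *: 1]mulr1.
by apply: DeriveDef => //; rewrite /derive; under eq_fun do rewrite /= [_ *: 1]mulr1; apply: cvg_lim.
Qed.

(** The quotient vanishes near 0, so the pole is harmless. The derivative f'/x - (f/x)/x is built
    from quotients of the same kind, which closes the induction. *)
Lemma cn_divx k f : cn k f -> (forall x, `|x| < 1 -> f x = 0) -> cn k (fun x => f x / x).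
Proof.
elim: k f => //= k ih f [df cf] f0.
have dV x : x != 0 -> is_derive x 1 (fun x : R => x^-1) (- x ^- 2).
  move=> x0; have := @is_deriveV R id x 1 1 x0 (is_derive_id _ _).
  by rewrite /GRing.scale/= mulr1.
have near0 x : `|x| < 1 -> \forall y \near x, f y = 0.
  move=> x1; near=> y; apply: f0; near: y.
  by apply: (cvgr_lt `|x|) => //; apply: cvg_norm; exact: cvg_id.
have f'0 x : `|x| < 1 -> derive1 f x = 0.
  move=> x1; rewrite derive1E (@near_eq_derive _ _ _ _ (cst 0)) ?derive_cst ?oner_neq0//.
  exact: near0.
have D x : is_derive x 1 (fun x => f x / x) (derive1 f x / x + - 1 * (f x / x / x)).
  have [x1|x1] := ltP `|x| 1.
    rewrite f'0// f0// !mul0r mulr0 addr0.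
    apply: (@near_eq_is_derive _ _ _ (cst 0) (fun x => f x / x)).
    by near=> y; rewrite /= (near (near0 x x1) y)// mul0r.
  have x0 : x != 0 by rewrite -normr_gt0 (lt_le_trans ltr01).
  have := is_deriveM (is_derive_of_derivable (df x)) (dV x x0).
  rewrite /GRing.scale/= => h; apply: is_derive_eq h _.
  by field.
split; first by move=> x; have := D x => -[].
have -> : derive1 (fun x => f x / x) = (fun x => derive1 f x / x + (cst (-1) x) * (f x / x / x)).
  by apply/funext => x; apply: derive1_is; exact: D.
apply: cnD; first exact: ih.
apply: cnM; first exact: cn_cst.
apply: (ih (fun x => f x / x)); first by apply: (ih f) => //; exact: (@cnW _ k f).
by move=> x x1; rewrite f0// mul0r.
Unshelve. all: end_near. Qed.

Lemma test_divx A u : test A u -> (forall x, `|x| < 1 -> u x = 0) ->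
  test A (fun x => u x / x).
Proof.
move=> [su Au] u0; split; first by move=> k; exact: cn_divx.
by move=> x Ax; rewrite Au// mul0r.
Qed.

End TrigIntegrals.

(** * Convolution kernels of the dyadic blocks *)

Section Kernels.
Context {R : realType}.
Local Notation mu := (@lebesgue_measure R).
Implicit Types (a F f : R -> R[i]) (t x : R).

Definition cder F t (z : R[i]) :=
  is_derive t 1 (fun t => Re (F t)) (Re z) /\ is_derive t 1 (fun t => Im (F t)) (Im z).

Definition ccont f := continuous (fun t => Re (f t)) /\ continuous (fun t => Im (f t)).

Lemma cder_cont F f : (forall t, cder F t (f t)) -> ccont F.
Proof.
by move=> h; split; [exact: is_derive_continuous (fun x => (h x).1)|exact: is_derive_continuous (fun x => (h x).2)].
Qed.

Lemma ccont_cmeas f : ccont f -> cmeas (f : measurableTypeR R -> R[i]).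
Proof. by move=> [h1 h2]; split; apply: continuous_measurable_fun. Qed.

Definition ctest A a := test A (fun x => Re (a x)) /\ test A (fun x => Im (a x)).

Definition osc a t : R[i] := cint mu (fun x => expi (t * x) * a x).

Lemma ReJ A a t : ctest A a ->
  Re (osc a t) = cosint (fun x => Re (a x)) t - sinint (fun x => Im (a x)) t.
Proof.
move=> [h1 h2]; rewrite /osc/= /cosint /sinint -RintegralB//.
- by apply: eq_Rintegral => x _; rewrite cReM.
- exact: integrable_cosint h1.
- exact: integrable_sinint h2.
Qed.

Lemma ImJ A a t : ctest A a ->
  Im (osc a t) = cosint (fun x => Im (a x)) t + sinint (fun x => Re (a x)) t.
Proof.
move=> [h1 h2]; rewrite /osc/= /cosint /sinint -RintegralD//.
- by apply: eq_Rintegral => x _; rewrite cImM.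
- exact: integrable_cosint h2.
- exact: integrable_sinint h1.
Qed.

Lemma J_decay A a : ctest A a ->
  exists2 C, 0 <= C & forall t, normc (osc a t) <= C * eta t ^+ 3.
Proof.
move=> ta; have [h1 h2] := ta.
have [C C0 hC] := trig_eta h1; have [D D0 hD] := trig_eta h2.
exists (2 * (C + D)); first by rewrite mulr_ge0 ?addr_ge0.
move=> t; rewrite (le_trans (normc_le_ReIm _))// (ReJ _ ta) (ImJ _ ta).
have [c1 inv_2pi] := hC t; have [d1 d2] := hD t.
have := ler_normB (cosint (fun x => Re (a x)) t) (sinint (fun x => Im (a x)) t).
have := ler_normD (cosint (fun x => Im (a x)) t) (sinint (fun x => Re (a x)) t).
lra.
Qed.

(** This is i x a(x), the amplitude of the derivative of [osc a]. *)
Definition ix a x : R[i] := Complex (- (x * Im (a x))) (x * Re (a x)).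

Lemma ctest_ix A a : ctest A a -> ctest A (ix a).
Proof. by move=> [h1 h2]; split; [exact/testN/test_mulx|exact: test_mulx]. Qed.

Lemma J_der A a t : ctest A a -> cder (osc a) t (osc (ix a) t).
Proof.
move=> ta; have [h1 h2] := ta; have tx := ctest_ix ta.
have cN : cosint (fun x => Re (ix a x)) t = - cosint (fun x => x * Im (a x)) t.
  rewrite /cosint -[RHS]mulN1r -RintegralZl//.
    by apply: eq_Rintegral => x _; rewrite /ix /=; ring.
  exact: integrable_cosint (test_mulx h2).
have sN : sinint (fun x => Re (ix a x)) t = - sinint (fun x => x * Im (a x)) t.
  rewrite /sinint -[RHS]mulN1r -RintegralZl//.
    by apply: eq_Rintegral => x _; rewrite /ix /=; ring.
  exact: integrable_sinint (test_mulx h2).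
split.
  rewrite (ReJ _ tx) cN; under eq_fun do rewrite (ReJ _ ta).
  apply: (is_derive_eq (is_deriveB (derive_cosint t h1) (derive_sinint t h2))).
  by rewrite addrC.
rewrite (ImJ _ tx) sN; under eq_fun do rewrite (ImJ _ ta).
apply: (is_derive_eq (is_deriveD (derive_cosint t h2) (derive_sinint t h1))).
by rewrite addrC.
Qed.

(** Dividing the amplitude by i x integrates [osc] once, and this is legitimate because a vanishes
    near 0. The primitive is again an oscillatory integral, hence decays as fast. *)
Lemma J_anti A a : ctest A a -> (forall x, `|x| < 1 -> a x = 0) ->
  exists a', [/\ ctest A a', forall x, `|x| < 1 -> a' x = 0 & ix a' = a].
Proof.
move=> [h1 h2] a0; exists (fun x => Complex (Im (a x) / x) (- (Re (a x) / x))); split.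
- split; first by apply: test_divx => // x x1; rewrite a0.
  by apply: testN; apply: test_divx => // x x1; rewrite a0.
- by move=> x x1; rewrite a0//= mul0r oppr0.
apply/funext => x; have [->|x0] := eqVneq x 0.
  by rewrite /ix a0 ?normr0// !mul0r oppr0.
by apply: eqReIm; rewrite /= ?mulrN ?opprK mulrCA divff// mulr1.
Qed.

Variable phi0 : R -> R[i].
Hypothesis hphi0 : dyadic_cutoff phi0.

(** The unitary constants of a Fourier transform and of its inverse multiply to one such factor per
    coordinate. *)
Definition inv_2pi : R := (2 * pi)^-1.

Definition dyadic_bump x : R[i] := phi0 (x / 2) - phi0 x.

Lemma test_phi0 : ctest 3 phi0.
Proof.
have [s1 s2] := cutoff_smooth hphi0; case: hphi0 => _ _ h0.
by split; split => // x x3; rewrite h0//; lra.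
Qed.

Lemma ctestZ A (c : R) a : ctest A a -> ctest A (fun x => c%:C%C * a x).
Proof.
move=> [h1 h2]; split.
  by under eq_fun do rewrite cReM/= mul0r subr0; exact: testZ.
by under eq_fun do rewrite cImM/= mul0r addr0; exact: testZ.
Qed.

Lemma test_dyadic_bump : ctest 3 dyadic_bump.
Proof.
have [s1 s2] := cutoff_smooth hphi0; case: (hphi0) => _ _ h0.
have z x : 3 < `|x| -> dyadic_bump x = 0.
  move=> x3; have e : `|x / 2| = `|x| / 2 by rewrite normrM normfV (ger0_norm (ler0n _ 2)).
  by rewrite /dyadic_bump !h0 ?subrr// ?e; lra.
split; split; last first; try by move=> x /z ->.
- under eq_fun do rewrite cImD cImN -mulN1r.
  apply: smooth1D; last by apply: (smooth1M (smooth1_cst _)).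
  under eq_fun do rewrite mulrC -[_ * _]addr0.
  exact: (smooth1_affine 2^-1 0 s2).
- under eq_fun do rewrite cReD cReN -mulN1r.
  apply: smooth1D; last by apply: (smooth1M (smooth1_cst _)).
  under eq_fun do rewrite mulrC -[_ * _]addr0.
  exact: (smooth1_affine 2^-1 0 s1).
Qed.

Lemma dyadic_bump0 x : `|x| < 1 -> dyadic_bump x = 0.
Proof.
case: hphi0 => _ h _ x1.
have e : `|x / 2| = `|x| / 2 by rewrite normrM normfV (ger0_norm (ler0n _ 2)).
by rewrite /dyadic_bump !h ?subrr// ?e; have := normr_ge0 x; lra.
Qed.

Lemma dyadic1_bump k x : dyadic1 phi0 k.+1 x = dyadic_bump (x / 2 ^+ k).
Proof. by rewrite /dyadic1 /dyadic_bump/= exprS invfM mulrA mulrAC. Qed.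

(** The one-dimensional convolution kernel of the k-th dyadic piece, with the normalisation of both
    transforms included. *)
Definition psi k : R -> R[i] := osc (fun x => inv_2pi%:C%C * dyadic1 phi0 k x).

Lemma Rintegral_scale (g : R -> R) (C s : R) : 0 < s -> continuous g ->
  (forall x, `|g x| <= C * eta x) ->
  \int[mu]_x g (s * x) = s^-1 * \int[mu]_x g x.
Proof.
move=> s0 cg gC.
have C0 : 0 <= C by rewrite -(pmulr_lge0 _ (eta_gt0 0)) (le_trans _ (gC 0)).
(* The substitution rule is for nonnegative integrands: it is applied to g + C eta and to C eta, and
   the results are subtracted. *)
pose h x := g x + C * eta x.
have ch : continuous h by apply: contD => //; apply: contM; [exact: cst_continuous|exact: continuous_eta].
have h0 x : 0 <= h x by rewrite /h; have := gC x; rewrite ler_norml => /andP[]; lra.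
have ie : mu.-integrable setT (EFin \o (fun x => C * eta x)).
  by apply: rintegrableZ; exact: integrable_eta.
have ies : mu.-integrable setT (EFin \o (fun x => C * eta (s * x))).
  apply: rintegrableZ; have := @integrable_eta_scale R s 0 s0.
  by under eq_fun do rewrite addr0.
have cs : continuous (fun x => s * x).
  by apply: contM; [exact: cst_continuous|move=> x; exact: cvg_id].
have cgs : continuous (fun x => g (s * x)).
  by move=> x; apply: (@continuous_comp _ _ _ (fun x => s * x) g); [exact: cs|exact: cg].
have ig : mu.-integrable setT (EFin \o g).
  by apply: (@integrable_dom _ _ _ mu g _ _ gC ie); exact: continuous_measurable_fun.
have igs : mu.-integrable setT (EFin \o (fun x => g (s * x))).
  apply: (@integrable_dom _ _ _ mu _ _ _ (fun x => gC (s * x)) ies).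
  exact: continuous_measurable_fun.
have key (k : R -> R) : continuous k -> (forall x, 0 <= k x) ->
    \int[mu]_x k x = \int[mu]_x (s * k (s * x)).
  move=> ck k0; rewrite /Rintegral (@increasing_ge0_integration_by_substitutionT _ (fun x => s * x + 0))//.
  - congr fine; apply: eq_integral => x _; congr EFin.
    by rewrite -[LHS]/(k (s * x + 0) * derive1 (fun x0 => s * x0 + 0) x) derive1_affine addr0 mulrC.
  - by move=> x y xy; rewrite !addr0 ltr_pM2l.
  - by rewrite derive1_affine => x; exact: cvg_cst.
  - by rewrite derive1_affine; exact: is_cvg_cst.
  - by rewrite derive1_affine; exact: is_cvg_cst.
  - exact: cvg_scaleB_ninfty.
  - exact: cvg_scaleB_pinfty.
have E1 := key _ ch h0.
have ceta : continuous (fun x => C * eta x).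
  by apply: contM; [exact: cst_continuous|exact: continuous_eta].
have E2 := key _ ceta (fun x => mulr_ge0 C0 (eta_ge0 x)).
have igs' := rintegrableZ s igs; have ies' := rintegrableZ s ies.
move: E1; rewrite /h RintegralD//.
under [in RHS]eq_Rintegral do rewrite mulrDr.
rewrite RintegralD// E2 => /addIr ->.
by rewrite RintegralZl// mulKf// gt_eqF.
Qed.

Lemma J_scale A a (s : R) t : 0 < s -> ctest A a ->
  osc (fun x => a (s * x)) t = (s^-1)%:C%C * osc a (t / s).
Proof.
move=> s0 [h1 h2].
have bd (u : R -> R) (v : R -> R) : test A u -> continuous v -> (forall x, `|v x| <= 1) ->
   exists2 C, 0 <= C & forall x, `|v x * u x| <= C * eta x.
  move=> [su Au] cv v1; have [C C0 hC] := supp_eta_bound Au (smooth1_continuous su).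
  by exists C => // x; rewrite normrM (le_trans _ (hC x))// ler_piMl.
have ex x : t * x = t / s * (s * x) by rewrite mulrA divfK ?gt_eqF.
have [c1 inv_2pi] := (smooth1_continuous h1.1, smooth1_continuous h2.1).
have ccos := @continuous_cost R (t / s); have csin := @continuous_sint R (t / s).
have [C1 _ b1] := bd _ _ h1 ccos (fun x => normr_cos _).
have [C2 _ b2] := bd _ _ h2 csin (fun x => normr_sin _).
have [C3 _ b3] := bd _ _ h2 ccos (fun x => normr_cos _).
have [C4 _ b4] := bd _ _ h1 csin (fun x => normr_sin _).
apply: eqReIm; rewrite /osc ?cReM ?cImM/= mul0r ?subr0 ?addr0.
  pose g x := Re (expi (t / s * x) * a x).
  rewrite -(@Rintegral_scale g (C1 + C2))//.
  - by apply: eq_Rintegral => x _; rewrite /g ex.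
  - rewrite /g; under eq_fun do rewrite cReM/=.
    by apply: contD; [|apply: contN]; apply: contM.
  - move=> x; rewrite /g cReM/= (le_trans (ler_normB _ _))// mulrDl.
    by apply: lerD; [exact: b1|exact: b2].
pose g x := Im (expi (t / s * x) * a x).
rewrite -(@Rintegral_scale g (C3 + C4))//.
- by apply: eq_Rintegral => x _; rewrite /g ex.
- rewrite /g; under eq_fun do rewrite cImM/=.
  by apply: contD; apply: contM.
- move=> x; rewrite /g cImM/= (le_trans (ler_normD _ _))// mulrDl.
  by apply: lerD; [exact: b3|exact: b4].
Qed.

Definition a0 x := inv_2pi%:C%C * dyadic_bump x.

Lemma test_a0 : ctest 3 a0. Proof. exact/ctestZ/test_dyadic_bump. Qed.

Lemma psi_high k t : psi k.+1 t = (2 ^+ k)%:C%C * osc a0 (2 ^+ k * t).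
Proof.
have s0 : 0 < (2 ^+ k : R)^-1 by rewrite invr_gt0 exprn_gt0.
have := J_scale t s0 test_a0; rewrite !invrK [t * _]mulrC => <-.
by rewrite /psi; congr osc; apply/funext => x; rewrite dyadic1_bump /a0 [_ * x]mulrC.
Qed.

Lemma eta_half x : eta x <= 4 * eta (2 * x).
Proof.
rewrite /eta ler_pdivlMr ?eta_den_gt0// mulrC ler_pdivrMr ?eta_den_gt0//.
by rewrite exprMn; have := sqr_ge0 x; lra.
Qed.

Lemma exprn2_gt0 k : 0 < 2 ^+ k :> R. Proof. exact: exprn_gt0. Qed.

(** For k + 1 the kernel is one fixed profile dilated by 2^k; restating its decay at scale 2^(k+1)
    costs 4^3 = 64. *)
Lemma psi_bound : exists2 C, 0 <= C & forall k t,
  normc (psi k t) <= C * (2 ^+ k * eta (2 ^+ k * t) ^+ 3).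
Proof.
have [C C0 hC] := J_decay (ctestZ inv_2pi test_phi0).
have [D D0 hD] := J_decay test_a0.
exists (C + D * 64); first by rewrite addr_ge0 ?mulr_ge0.
move=> [|k] t.
  rewrite expr0 !mul1r (le_trans (hC t))// ler_wpM2r ?exprn_ge0 ?eta_ge0//.
  by rewrite lerDl mulr_ge0.
rewrite psi_high Normc.normcM normc_real ger0_norm ?(ltW (exprn2_gt0 _))//.
have h : eta (2 ^+ k * t) ^+ 3 <= 64 * eta (2 ^+ k.+1 * t) ^+ 3.
  rewrite (_ : 64 = 4 ^+ 3); last by rewrite -!natrX.
  rewrite -exprMn lerXn2r ?nnegrE ?mulr_ge0 ?eta_ge0//.
  by have := eta_half (2 ^+ k * t); rewrite mulrA -exprS.
have e0 : 0 <= eta (2 ^+ k.+1 * t) ^+ 3 by rewrite exprn_ge0 ?eta_ge0.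
apply: (@le_trans _ _ (2 ^+ k * (D * (64 * eta (2 ^+ k.+1 * t) ^+ 3)))).
  by rewrite ler_wpM2l ?(ltW (exprn2_gt0 _))// (le_trans (hD _))// ler_wpM2l.
rewrite [X in _ <= _ * (X * _)]exprS.
have p0 : 0 <= 2 ^+ k * eta (2 ^+ k.+1 * t) ^+ 3 :> R by rewrite mulr_ge0 ?(ltW (exprn2_gt0 _)).
have -> : 2 ^+ k * (D * (64 * eta (2 ^+ k.+1 * t) ^+ 3)) =
   (D * 64) * (2 ^+ k * eta (2 ^+ k.+1 * t) ^+ 3) by ring.
rewrite -[_ * _ * eta _ ^+ 3]mulrA; set p := 2 ^+ k * _ in p0 *.
have := mulr_ge0 C0 p0; have := mulr_ge0 D0 p0; lra.
Qed.

Lemma psi_cont k : ccont (psi k).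
Proof.
case: k => [|k]; first exact: cder_cont (fun t => J_der t (ctestZ inv_2pi test_phi0)).
have [h1 h2] := cder_cont (fun t => J_der t test_a0).
have cs : continuous (fun x : R => 2 ^+ k * x).
  by apply: contM; [exact: cst_continuous|move=> x; exact: cvg_id].
split.
  under eq_fun do rewrite psi_high cReM/= mul0r subr0.
  apply: contM; first exact: cst_continuous.
  by move=> x; apply: (@continuous_comp _ _ _ (fun x => 2 ^+ k * x) (fun t => Re (osc a0 t))); [exact: cs|exact: h1].
under eq_fun do rewrite psi_high cImM/= mul0r addr0.
apply: contM; first exact: cst_continuous.
by move=> x; apply: (@continuous_comp _ _ _ (fun x => 2 ^+ k * x) (fun t => Im (osc a0 t))); [exact: cs|exact: h2].
Qed.

Lemma antiderivative (f : R -> R) (C : R) : continuous f ->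
  (forall x, `|f x| <= C * eta x) -> exists F : R -> R, forall t, is_derive t 1 F (f t).
Proof.
move=> cf fC; exists (fun x => \int[mu]_(t in `]-oo, x]) f t) => t.
have fi : mu.-integrable setT (EFin \o f).
  apply: (@integrable_dom _ _ _ mu f _ _ fC); first exact: continuous_measurable_fun.
  by apply: rintegrableZ; exact: integrable_eta.
have fi' : mu.-integrable `]-oo, (t + 1)] (EFin \o f).
  by apply: (integrableS measurableT) => //.
have tt : t < t + 1 by rewrite ltrDl.
have [||h1 h2] := @continuous_FTC1 R f (BInfty R true) t (t + 1) tt fi'.
- by rewrite ltNyr.
- exact: cf.
by rewrite -h2; exact: is_derive_of_derivable.
Qed.

(** If F is a primitive of f and G one of x f(x), then x F - G is a primitive of F; the cubic decay
    makes x f(x) integrable. This serves k = 0, where the amplitude does not vanish at 0. *)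
Lemma antiderivative2 (f : R -> R) (C : R) : continuous f ->
  (forall x, `|f x| <= C * eta x ^+ 3) -> exists F X : R -> R,
  (forall t, is_derive t 1 F (f t)) /\ (forall t, is_derive t 1 X (F t)).
Proof.
move=> cf fC.
have C0 : 0 <= C by rewrite -(pmulr_lge0 _ (exprn_gt0 3 (eta_gt0 0))) (le_trans _ (fC 0)).
have e2 x : eta x ^+ 3 <= eta x.
  by rewrite exprS ler_piMr ?eta_ge0// exprn_ile1 ?eta_ge0 ?eta_le1.
have fC1 x : `|f x| <= C * eta x by rewrite (le_trans (fC x))// ler_wpM2l.
have [F dF] := antiderivative cf fC1.
have fC2 x : `|x * f x| <= C * eta x.
  rewrite normrM (le_trans (ler_wpM2l _ (fC x)))// mulrCA ler_wpM2l//.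
  rewrite exprS mulrCA ler_piMr ?eta_ge0// /eta exprVn ler_pdivrMr ?exprn_gt0 ?eta_den_gt0// mul1r.
  have := sqr_ge0 x; have := sqr_ge0 (`|x| - 1); rewrite -(real_normK (num_real x)).
  by rewrite !expr2; nra.
have cxf : continuous (fun x => x * f x).
  by apply: contM => // x; exact: cvg_id.
have [G dG] := antiderivative cxf fC2.
exists F, (fun x => x * F x - G x); split => // t.
apply: (is_derive_eq (is_deriveB (is_deriveM (is_derive_id t 1) (dF t)) (dG t))).
by rewrite /GRing.scale/= mulr1; ring.
Qed.

Lemma antiderivative2c f (C : R) : ccont f ->
  (forall x, normc (f x) <= C * eta x ^+ 3) -> exists F X,
  (forall t, cder F t (f t)) /\ (forall t, cder X t (F t)).
Proof.
move=> [c1 inv_2pi] fC.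
have [F1 [X1 [d1 e1]]] := antiderivative2 c1 (fun x => le_trans (normc_ge_absRe _) (fC x)).
have [F2 [X2 [d2 e2]]] := antiderivative2 inv_2pi (fun x => le_trans (normc_ge_absIm _) (fC x)).
exists (fun t => Complex (F1 t) (F2 t)), (fun t => Complex (X1 t) (X2 t)).
by split=> t; split; [exact: d1|exact: d2|exact: e1|exact: e2].
Qed.

Lemma cder_scale F f (s : R) : (forall t, cder F t (f t)) ->
  forall t, cder (fun t => F (s * t)) t (s%:C%C * f (s * t)).
Proof.
move=> dF t; have [h1 h2] := dF (s * t).
have ds : is_derive t 1 (fun x => s * x) s.
  by apply: is_derive_eq; rewrite /GRing.scale/= ?(mulr1,addr0,mulr0,add0r).
rewrite /cder cReM cImM/= !mul0r subr0 addr0 ![s * _ (f _)]mulrC.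
split.
  exact: (@is_derive1_comp R (fun t => Re (F t)) (fun x => s * x) t _ _ h1 ds).
exact: (@is_derive1_comp R (fun t => Im (F t)) (fun x => s * x) t _ _ h2 ds).
Qed.

Lemma cderZ F f (c : R) : (forall t, cder F t (f t)) ->
  forall t, cder (fun t => c%:C%C * F t) t (c%:C%C * f t).
Proof.
move=> dF t; have [h1 h2] := dF t.
rewrite /cder cReM cImM/= !mul0r subr0 addr0; split.
  under eq_fun do rewrite cReM/= mul0r subr0.
  apply: (is_derive_eq (is_deriveM (is_derive_cst c t 1) h1)).
  by rewrite /GRing.scale/= mulr0 addr0.
under eq_fun do rewrite cImM/= mul0r addr0.
apply: (is_derive_eq (is_deriveM (is_derive_cst c t 1) h2)).
by rewrite /GRing.scale/= mulr0 addr0.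
Qed.

(** For positive frequency the amplitude is divided by i x twice, so both primitives decay. For
    frequency 0 only the existence of primitives is claimed. *)
Lemma exist_Psi : exists (Psi X : nat -> R -> R[i]) (C : R), [/\ 0 <= C,
  forall k t, cder (Psi k) t (psi k t), forall k t, cder (X k) t (Psi k t) &
  forall k t, normc (Psi k.+1 t) <= C * eta (2 ^+ k.+1 * t) ^+ 3 /\
     normc (X k.+1 t) <= C * (2 ^+ k.+1)^-1 * eta (2 ^+ k.+1 * t) ^+ 3].
Proof.
have a00 x : `|x| < 1 -> a0 x = 0 by move=> x1; rewrite /a0 dyadic_bump0 ?mulr0.
have [a1 [t1 a10 e1]] := J_anti test_a0 a00.
have [a2 [t2 a20 e2]] := J_anti t1 a10.
have [C C0 hC] := J_decay t1; have [D D0 hD] := J_decay t2.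
have dP t : cder (osc a1) t (osc a0 t) by rewrite -e1; exact: J_der t1.
have dX t : cder (osc a2) t (osc a1 t) by rewrite -e2; exact: J_der t2.
have [P0 bP0] := J_decay (ctestZ inv_2pi test_phi0).
have c0 := psi_cont 0.
move=> hP0.
have [F [X0 [dF dX0]]] := antiderivative2c c0 hP0.
have h64 k t : eta (2 ^+ k * t) ^+ 3 <= 64 * eta (2 ^+ k.+1 * t) ^+ 3 :> R.
  rewrite (_ : 64 = 4 ^+ 3); last by rewrite -!natrX.
  rewrite -exprMn lerXn2r ?nnegrE ?mulr_ge0 ?eta_ge0//.
  by have := eta_half (2 ^+ k * t); rewrite mulrA -exprS.
exists (fun k => if k is k'.+1 then fun t => osc a1 (2 ^+ k' * t) else F).
exists (fun k => if k is k'.+1 then fun t => ((2 ^+ k')^-1)%:C%C * osc a2 (2 ^+ k' * t) else X0).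
have ge3 t : 0 <= eta t ^+ 3 :> R by rewrite exprn_ge0 ?eta_ge0.
(* 64 is the cost of passing from scale 2^k to 2^(k+1), and 128 includes the factor 2 in 2^-k = 2 *
   2^-(k+1). *)
exists (64 * C + 128 * D); split.
- by rewrite addr_ge0 ?mulr_ge0.
- move=> [|k] t; first exact: dF.
  by rewrite psi_high; exact: (@cder_scale _ _ (2 ^+ k) dP t).
- move=> [|k] t; first exact: dX0.
  have := cderZ (2 ^+ k)^-1 (@cder_scale _ _ (2 ^+ k) dX) t.
  by rewrite mulrA -rmorphM mulVf ?gt_eqF ?exprn2_gt0// mul1r.
move=> k t; set e := eta (2 ^+ k.+1 * t) ^+ 3.
have e0 : 0 <= e by exact: ge3.
have k0 : 0 < (2 ^+ k)^-1 :> R by rewrite invr_gt0 exprn2_gt0.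
have hk := h64 k t; rewrite -/e in hk.
split.
  apply: (le_trans (hC _)).
  by have := ler_wpM2l C0 hk; have := mulr_ge0 D0 e0; lra.
rewrite Normc.normcM normc_real ger0_norm ?(ltW k0)// exprS invfM.
apply: (@le_trans _ _ ((2 ^+ k)^-1 * (D * (64 * e)))).
  by rewrite ler_wpM2l ?(ltW k0)// (le_trans (hD _))// ler_wpM2l.
have := mulr_ge0 (ltW k0) (mulr_ge0 D0 e0); have := mulr_ge0 (ltW k0) (mulr_ge0 C0 e0).
lra.
Qed.

(** The intermediate point of the mean value theorem is within scaled distance B of t0, so by
    [eta_shift] the decay can be centred at t0 at the price 2 (1 + B^2) per factor. *)
Lemma mvt_eta (F f : R -> R) (M s B : R) : (forall t, is_derive t 1 F (f t)) ->
  0 <= M -> 0 < s -> (forall t, `|f t| <= M * eta (s * t) ^+ 3) ->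
  forall t0 t1, s * `|t1 - t0| <= B ->
  `|F t1 - F t0| <= M * (2 * (1 + B ^+ 2)) ^+ 3 * `|t1 - t0| * eta (s * t0) ^+ 3.
Proof.
move=> dF M0 s0 fM t0 t1 hB.
have cF := is_derive_continuous dF.
have [c [hc ->]] : exists c, `|c - t0| <= `|t1 - t0| /\ `|F t1 - F t0| = `|f c| * `|t1 - t0|.
  have [le|/ltW le] := leP t0 t1.
    have [c] := MVT_segment le (fun x _ => dF x) (continuous_subspaceT cF).
    rewrite in_itv/= => /andP[h1 h2] ->; exists c; rewrite normrM; split => //.
    by rewrite !ger0_norm ?subr_ge0// lerD2r.
  have [c] := MVT_segment le (fun x _ => dF x) (continuous_subspaceT cF).
  rewrite in_itv/= => /andP[h1 h2] E; exists c; rewrite [`|F t1 - F t0|]distrC E normrM [`|t0 - t1|]distrC; split => //.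
  by rewrite [`|c - t0|]distrC [`|t1 - t0|]distrC !ger0_norm ?subr_ge0// lerB.
have B0 : 0 <= B by apply: le_trans hB; rewrite mulr_ge0// ltW.
have E : eta (s * c) <= 2 * (1 + B ^+ 2) * eta (s * t0).
  have := eta_shift (s * t0) (s * (c - t0)); rewrite -mulrDr addrC subrK.
  move=> /le_trans; apply; rewrite mulrAC ler_wpM2r ?eta_ge0// ler_wpM2l// lerD2l.
  rewrite -[leLHS]real_normK ?num_real// lerXn2r ?nnegrE//.
  by rewrite normrM (gtr0_norm s0) (le_trans _ hB)// ler_wpM2l// ltW.
rewrite mulrAC ler_wpM2r// (le_trans (fM c))// -mulrA ler_wpM2l//.
by rewrite -exprMn lerXn2r ?nnegrE ?mulr_ge0 ?eta_ge0 ?addr_ge0 ?sqr_ge0.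
Qed.

Lemma cmvt_eta F f (M s B : R) : (forall t, cder F t (f t)) ->
  0 <= M -> 0 < s -> (forall t, normc (f t) <= M * eta (s * t) ^+ 3) ->
  forall t0 t1, s * `|t1 - t0| <= B ->
  normc (F t1 - F t0) <= 2 * (M * (2 * (1 + B ^+ 2)) ^+ 3) * `|t1 - t0| * eta (s * t0) ^+ 3.
Proof.
move=> dF M0 s0 fM t0 t1 hB.
have h1 := @mvt_eta _ _ M s B (fun t => (dF t).1) M0 s0 (fun t => le_trans (normc_ge_absRe _) (fM t)) t0 t1 hB.
have h2 := @mvt_eta _ _ M s B (fun t => (dF t).2) M0 s0 (fun t => le_trans (normc_ge_absIm _) (fM t)) t0 t1 hB.
rewrite (le_trans (normc_le_ReIm _))// cReD cImD cReN cImN.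
by have := lerD h1 h2; lra.
Qed.

(** The mean value theorem gives different intermediate points for the real and the imaginary part,
    whence the factor 2. *)
Lemma cder_average F f (D : R) (z1 z2 : R) (w : R[i]) : (forall t, cder F t (f t)) ->
  z1 < z2 -> (forall t, z1 <= t <= z2 -> normc (f t - w) <= D) ->
  normc ((F z2 - F z1) / (z2 - z1)%:C%C - w) <= 2 * D.
Proof.
move=> dF z12 hD.
have z0 : z2 - z1 != 0 by rewrite subr_eq0 gt_eqF.
have [c1 inv_2pi] := cder_cont dF.
have [x] := MVT_segment (ltW z12) (fun x _ => (dF x).1) (continuous_subspaceT c1).
rewrite in_itv/= => hx Ex.
have [y] := MVT_segment (ltW z12) (fun x _ => (dF x).2) (continuous_subspaceT inv_2pi).
rewrite in_itv/= => hy Ey.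
have -> : (F z2 - F z1) / (z2 - z1)%:C%C = Complex (Re (f x)) (Im (f y)).
  have nz : (z2 - z1)%:C%C != 0 by apply/eqP => -[/eqP]; apply/negP.
  apply: (@mulIf _ (z2 - z1)%:C%C) => //.
  rewrite divfK//.
  apply: eqReIm; rewrite ?cReM ?cImM/= ?cReD ?cImD ?cReN ?cImN ?Ex ?Ey; ring.
rewrite (le_trans (normc_le_ReIm _))// cReD cImD cReN cImN/=.
have := le_trans (normc_ge_absRe _) (hD x hx); have := le_trans (normc_ge_absIm _) (hD y hy).
rewrite cReD cImD cReN cImN; lra.
Qed.

(* [c k] vanishes for k > 0, where [psi k] has mean zero and [Psi k], [X k] decay; for k = 0
   the kernel varies on the scale of the cube and [Psi 0 (x - z)] is close to [Psi 0 (x - 1)]. *)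
Lemma kernels (b : R) : 1 <= b -> exists (Psi X : nat -> R -> R[i]) (c : nat -> R -> R[i]) (C : R),
  [/\ 0 <= C, forall k t, cder (Psi k) t (psi k t), forall k t, cder (X k) t (Psi k t) &
   forall k (x : R), [/\
     forall z, 0 <= z <= 1 -> normc (Psi k (x - z) - c k x) <= C * eta (2 ^+ k * (x - z)) ^+ 3,
     normc (X k x - X k (x - 1) - c k x) <=
       C * (2 ^+ k)^-1 * (eta (2 ^+ k * x) ^+ 3 + eta (2 ^+ k * (x - 1)) ^+ 3) &
     forall z1 z2 z, z1 < z2 -> z1 <= z <= z2 -> 2 ^+ k * (z2 - z1) <= b ->
       normc ((X k (x - z1) - X k (x - z2)) / (z2 - z1)%:C%C - Psi k (x - z)) <=
       C * (2 ^+ k * (z2 - z1)) * eta (2 ^+ k * (x - z)) ^+ 3]].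
Proof.
move=> b1.
have [Psi [X [C [C0 dP dX hC]]]] := exist_Psi.
have [M M0 hM] := psi_bound.
pose N := 2 * (M * (2 * (1 + b ^+ 2)) ^+ 3).
have N0 : 0 <= N by rewrite mulr_ge0// mulr_ge0// exprn_ge0// mulr_ge0// addr_ge0 ?sqr_ge0.
have lipP k t0 t1 : 2 ^+ k * `|t1 - t0| <= b ->
   normc (Psi k t1 - Psi k t0) <= N * (2 ^+ k * `|t1 - t0|) * eta (2 ^+ k * t0) ^+ 3.
  move=> h; have := @cmvt_eta (Psi k) (psi k) (M * 2 ^+ k) (2 ^+ k) b (dP k) _ (exprn2_gt0 k) _ t0 t1 h.
  have -> : 2 * (M * 2 ^+ k * (2 * (1 + b ^+ 2)) ^+ 3) * `|t1 - t0| = N * (2 ^+ k * `|t1 - t0|).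
    by rewrite /N; ring.
  apply; first by rewrite mulr_ge0// ltW// exprn2_gt0.
  by move=> t; rewrite -mulrA; exact: hM.
have ge3 t : 0 <= eta t ^+ 3 :> R by rewrite exprn_ge0 ?eta_ge0.
exists Psi, X, (fun k x => if k is 0 then Psi 0 (x - 1) else 0), (C + 2 * N); split => //.
  by rewrite addr_ge0// mulr_ge0.
move=> k x; split.
- move=> z /andP[z0 z1]; apply: (@le_trans _ _ ((C + N) * eta (2 ^+ k * (x - z)) ^+ 3)); last first.
    by rewrite ler_wpM2r// lerD2l ler_peMl// ler1n.
  case: k => [|k].
    have h := lipP 0%N (x - z) (x - 1); rewrite expr0 !mul1r in h *.
    rewrite -normcNE opprB (le_trans (h _))//.
      have -> : x - 1 - (x - z) = - (1 - z) by ring.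
      by rewrite normrN ger0_norm ?subr_ge0// (le_trans _ b1)// gerBl.
    rewrite ler_wpM2r//.
    have -> : x - 1 - (x - z) = - (1 - z) by ring.
    rewrite normrN ger0_norm ?subr_ge0// -[leLHS]add0r lerD// ler_piMr// gerBl//.
  rewrite subr0 (le_trans (hC _ _).1)// ler_wpM2r// lerDl//.
- case: k => [|k].
    rewrite !expr0 invr1 mulr1 !mul1r.
    (* Over an interval of length 1 the increment of [X 0] is a mean of [Psi 0], hence close to the
       value [Psi 0 (x - 1)] chosen as [c 0 x]. *)
    have -> : X 0%N x - X 0%N (x - 1) = (X 0%N x - X 0%N (x - 1)) / (x - (x - 1))%:C%C.
      by rewrite (_ : x - (x - 1) = 1) ?divr1//; ring.
    apply: (@le_trans _ _ (2 * (N * eta (x - 1) ^+ 3))); last first.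
      have := mulr_ge0 C0 (ge3 x); have := mulr_ge0 C0 (ge3 (x - 1)).
      by have := mulr_ge0 N0 (ge3 x); lra.
    apply: (cder_average (dX 0%N)); first by rewrite ltrBlDr ltrDl.
    move=> t /andP[t1 t2]; have h := lipP 0%N (x - 1) t; rewrite expr0 !mul1r in h.
    have tb : `|t - (x - 1)| <= 1 by rewrite ger0_norm ?subr_ge0//; lra.
    rewrite (le_trans (h _))//; first exact: le_trans tb b1.
    by rewrite ler_wpM2r// ler_piMr.
  rewrite subr0 (le_trans (normcB _ _))//.
  have h1 := (hC k x).2; have h2 := (hC k (x - 1)).2.
  have i0 : 0 <= (2 ^+ k.+1)^-1 :> R by rewrite invr_ge0 ltW// exprn2_gt0.
  have := lerD h1 h2; rewrite -mulrDr => /le_trans; apply.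
  by rewrite ler_wpM2r ?addr_ge0// ler_wpM2r// lerDl mulr_ge0.
move=> z1 z2 z z12 /andP[hz1 hz2] hb.
have k0 := exprn2_gt0 k.
have -> : (z2 - z1) = ((x - z1) - (x - z2)) by ring.
apply: (@le_trans _ _ (2 * (N * (2 ^+ k * (z2 - z1)) * eta (2 ^+ k * (x - z)) ^+ 3))); last first.
  have -> : x - z1 - (x - z2) = z2 - z1 by ring.
  have p0 : 0 <= 2 ^+ k * (z2 - z1) * eta (2 ^+ k * (x - z)) ^+ 3.
    by rewrite mulr_ge0// mulr_ge0 ?(ltW k0)// subr_ge0 ltW.
  by have := mulr_ge0 C0 p0; lra.
apply: (cder_average (dX k)); first by rewrite ltrD2l ltrN2.
move=> t /andP[t1 t2].
have tb : `|t - (x - z)| <= z2 - z1 by rewrite ler_norml; apply/andP; split; lra.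
rewrite (le_trans (lipP k (x - z) t _))//.
  by apply: le_trans hb; rewrite ler_wpM2l ?(ltW k0).
by rewrite ler_wpM2r// ler_wpM2l// ler_wpM2l ?(ltW k0).
Qed.

End Kernels.

(** * Dyadic blocks of the discrepancy function *)

Section BlockIdentity.
Context {R : realType}.
Local Notation mu := (@lebesgue_measure R).
Local Notation TR := (measurableTypeR R).
Variable phi0 : R -> R[i].
Hypothesis hphi0 : dyadic_cutoff phi0.

Lemma Re_cint d (T : measurableType d) (m : {measure set T -> \bar R}) (f : T -> R[i]) :
  Re (cint m f) = \int[m]_x Re (f x).
Proof. by []. Qed.
Lemma Im_cint d (T : measurableType d) (m : {measure set T -> \bar R}) (f : T -> R[i]) :
  Im (cint m f) = \int[m]_x Im (f x).
Proof. by []. Qed.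
Lemma Re_realM (x : R) (z : R[i]) : Re (x%:C%C * z) = x * Re z.
Proof. by rewrite cReM/= mul0r subr0. Qed.
Lemma Im_realM (x : R) (z : R[i]) : Im (x%:C%C * z) = x * Im z.
Proof. by rewrite cImM/= mul0r addr0. Qed.

Lemma expiD (a b : R) : expi (a + b) = expi a * expi b.
Proof. by apply: eqReIm; rewrite /expi ?cReM ?cImM/= ?cosD ?sinD//; ring. Qed.

Lemma expi0 : expi (0 : R) = 1.
Proof. by rewrite /expi cos0 sin0. Qed.

Lemma expi_sum (I : Type) (s : seq I) (F : I -> R) :
  expi (\sum_(i <- s) F i) = \prod_(i <- s) expi (F i).
Proof. by elim/big_rec2: _ => [|i x y _ <-]; [exact: expi0|exact: expiD]. Qed.

Lemma normc_expi (a : R) : normc (expi a) = 1.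
Proof. by rewrite normcE2/= cos2Dsin2 sqrtr1. Qed.

Lemma cont_expi_cmeas d (T : measurableType d) (h : T -> R) :
  measurable_fun setT h -> cmeas (fun t => expi (h t)).
Proof.
move=> mh; split; apply: measurableT_comp => //; apply: continuous_measurable_fun.
  exact: continuous_cos.
exact: continuous_sin.
Qed.

(** [upper_step] and [unit_ramp] are one-coordinate factors of the counting and of the volume term.
    The cutoff at 1 in each makes the extension by zero a combination of tensor products. *)
Definition upper_step (a s : R) : R := (a < s < 1)%R%:R.
Definition unit_ramp (s : R) : R := s * (0 <= s < 1)%R%:R.

Lemma measurable_upper_step a : measurable_fun setT (upper_step a).
Proof.
have -> : upper_step a = \1_(`]a, 1[%classic : set R).
  by apply/funext => s; rewrite /upper_step indicE; congr (nat_of_bool _)%:R; apply/idP/idP => h; [apply/mem_set|have := set_mem h]; rewrite /= in_itv.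
exact: measurable_indic.
Qed.

Lemma measurable_unit_ramp : measurable_fun setT unit_ramp.
Proof.
have -> : unit_ramp = (fun s => s * \1_(`[0, 1[%classic : set R) s).
  by apply/funext => s; rewrite /unit_ramp indicE; congr (s * (nat_of_bool _)%:R); apply/idP/idP => h; [apply/mem_set|have := set_mem h]; rewrite /= in_itv.
apply: measurable_funM => //; exact: measurable_indic.
Qed.

Lemma eta_half_le (s : R) : 0 <= s <= 1 -> 1 <= 2 * eta s.
Proof.
move=> /andP[s0 s1]; rewrite /eta ler_pdivlMr ?eta_den_gt0// mul1r.
by rewrite expr2; nra.
Qed.

Lemma upper_step_eta a s : 0 <= a -> `|upper_step a s| <= 2 * eta s.
Proof.
move=> a0; rewrite /upper_step; case: (boolP (a < s < 1)) => [/andP[h1 h2]|_]; last by rewrite normr0 mulr_ge0 ?eta_ge0.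
by rewrite normr1 eta_half_le// !ltW// (le_lt_trans a0).
Qed.

Lemma unit_ramp_eta s : `|unit_ramp s| <= 2 * eta s.
Proof.
rewrite /unit_ramp; case: (boolP (0 <= s < 1)) => [/andP[h1 h2]|_]; last by rewrite mulr0 normr0 mulr_ge0 ?eta_ge0.
by rewrite mulr1 ger0_norm// (le_trans (ltW h2))// eta_half_le// h1 ltW.
Qed.

Lemma cphi_meas k : cmeas (dyadic1 phi0 k : TR -> R[i]).
Proof.
have [[s1 _] [s2 _]] := test_phi0 hphi0; have [[a1 _] [a2 _]] := test_dyadic_bump hphi0.
have c0 : ccont phi0 by split; exact: smooth1_continuous.
have ca : ccont (dyadic_bump phi0) by split; exact: smooth1_continuous.
case: k => [|k]; first exact: ccont_cmeas.
have -> : dyadic1 phi0 k.+1 = (fun x => dyadic_bump phi0 (x * (2 ^+ k)^-1)).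
  by apply/funext => x; rewrite dyadic1_bump.
apply: (cmeas_comp (ccont_cmeas ca)).
by apply: measurable_funM => //; exact: measurable_cst.
Qed.

Lemma cphi_bound k : exists2 C, 0 <= C & forall x, normc (dyadic1 phi0 k x) <= C * eta x.
Proof.
have bd a A : ctest A a -> exists2 C, 0 <= C & forall x : R, normc (a x) <= C * eta x.
  move=> [[s1 a1] [s2 a2]].
  have [C C0 hC] := supp_eta_bound a1 (smooth1_continuous s1).
  have [D D0 hD] := supp_eta_bound a2 (smooth1_continuous s2).
  exists (C + D); first exact: addr_ge0.
  by move=> x; rewrite (le_trans (normc_le_ReIm _))// mulrDl lerD.
case: k => [|k]; first exact: bd (test_phi0 hphi0).
have [C C0 hC] := bd _ _ (test_dyadic_bump hphi0).
exists (C * (2 ^+ k) ^+ 2); first by rewrite mulr_ge0// exprn_ge0// exprn_ge0.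
move=> x; rewrite dyadic1_bump (le_trans (hC _))// -mulrA ler_wpM2l//.
have k0 := @exprn2_gt0 R k.
rewrite /eta ler_pdivlMr ?eta_den_gt0// mulrC ler_pdivrMr ?eta_den_gt0//.
rewrite expr_div_n mulrDr mulr1 mulrCA divff ?mulr1 ?gt_eqF ?exprn_gt0// lerD2r.
by rewrite -exprM exprn_ege1// ler1n.
Qed.

Lemma psi_eta k : exists2 C, 0 <= C & forall x, normc (psi phi0 k x) <= C.
Proof.
have [C C0 hC] := psi_bound hphi0; exists (C * 2 ^+ k); first by rewrite mulr_ge0// ltW// exprn2_gt0.
move=> x; rewrite (le_trans (hC k x))// ler_wpM2l// ler_piMr ?(ltW (exprn2_gt0 _))//.
by rewrite exprn_ile1 ?eta_ge0 ?eta_le1.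
Qed.

Section Dim.
Variables (n : nat) (k : {ffun 'I_n -> nat}).
Implicit Types (f : 'rV[R]_n -> R[i]).

Definition block_kernel (x y : n.-tuple TR) : R[i] := \prod_i psi phi0 (k i) (tnth x i - tnth y i).

Lemma dot_row (s t : n.-tuple TR) : dot (row_of s) (row_of t) = \sum_i tnth s i * tnth t i.
Proof. by apply: eq_bigr => i _; rewrite !row_ofE. Qed.

Lemma dyadic_row (s : n.-tuple TR) : dyadic phi0 k (row_of s) = \prod_i dyadic1 phi0 (k i) (tnth s i).
Proof. by apply: eq_bigr => i _; rewrite row_ofE. Qed.

Lemma fourier_const2 : @fourier_const R n * fourier_const R n = \prod_(i < n) (@inv_2pi R)%:C%C.
Proof.
rewrite /fourier_const -rmorphM/= -rmorph_prod/=; congr (_%:C%C).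
have p0 : 0 < 2 * pi :> R by rewrite mulr_gt0// pi_gt0.
rewrite -powRD; last by rewrite (gt_eqF p0)/= ?implybT.
by rewrite -opprD -splitr powRN powR_mulrn ?(ltW p0)// prodr_const card_ord /inv_2pi exprVn.
Qed.

Lemma measurable_tn d (T : measurableType d) (g : T -> n.-tuple TR) (i : 'I_n) :
  measurable_fun setT g -> measurable_fun setT (fun w => tnth (g w) i : TR).
Proof. by move=> mg; exact: (measurableT_comp (measurable_tnth i) mg). Qed.

(** Frequency part of the double integral in [fourier_block], with the exponentials merged and the
    constants distributed over the coordinates. *)
Definition phiexp (y : n.-tuple TR) (z : n.-tuple TR * n.-tuple TR) : R[i] :=
  \prod_i ((inv_2pi%:C%C * dyadic1 phi0 (k i) (tnth z.1 i)) * expi (tnth z.1 i * (tnth z.2 i - tnth y i))).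

Lemma cmeas_phiexp (y : n.-tuple TR) : cmeas (phiexp y).
Proof.
have m1 i := measurable_tn i (@measurable_fst _ _ (n.-tuple TR) (n.-tuple TR)).
have m2 i := measurable_tn i (@measurable_snd _ _ (n.-tuple TR) (n.-tuple TR)).
apply: (@cmeas_prod _ _ _ _ _ (fun i (z : n.-tuple TR * n.-tuple TR) =>
  (inv_2pi%:C%C * dyadic1 phi0 (k i) (tnth z.1 i)) * expi (tnth z.1 i * (tnth z.2 i - tnth y i)))) => i.
apply: cmeasM.
  apply: cmeasM; first exact: cmeas_cst.
  exact: (cmeas_comp (cphi_meas (k i)) (m1 i)).
apply: cont_expi_cmeas; apply: measurable_funM; first exact: (m1 i).
by apply: measurable_funB; [exact: (m2 i)|exact: measurable_cst].
Qed.

Lemma phi_bounds : exists C : 'I_n -> R, forall i, 0 <= C i /\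
  forall x, normc (inv_2pi%:C%C * dyadic1 phi0 (k i) x) <= C i * eta x.
Proof.
have h (i : 'I_n) : exists C : R, 0 <= C /\
    forall x, normc (inv_2pi%:C%C * dyadic1 phi0 (k i) x) <= C * eta x.
  have [C C0 hC] := cphi_bound (k i); exists (inv_2pi * C).
  have c20 : 0 <= @inv_2pi R by rewrite invr_ge0 mulr_ge0// pi_ge0.
  split; first exact: mulr_ge0.
  by move=> x; rewrite Normc.normcM normc_real ger0_norm// -mulrA ler_wpM2l.
by have [C hC] := choice h; exists C.
Qed.

(** By duality, a dyadic block of a distribution tests it against this function of y. After Fubini
    the frequency integral comes first and factors into one [psi] per coordinate. *)
Lemma fourier_block f (y : n.-tuple TR) : schwartz f ->
  fourier (fun x => dyadic phi0 k x * inv_fourier f x) (row_of y) =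
  cint (lebesgue R n) (fun x => f (row_of x) * block_kernel x y).
Proof.
move=> sf; have [Cf Cf0 hf] := schwartz_bound sf; have mf := schwartz_cmeas sf.
have [C hC] := phi_bounds.
have bE z : normc (phiexp y z) <= \prod_i (C i * eta (tnth z.1 i)).
  rewrite normc_prod; apply: ler_prod => i _; rewrite normc_ge0/=.
  by rewrite Normc.normcM normc_expi mulr1 (hC i).2.
have iA : (lebesgue R n).-integrable setT (EFin \o (fun t : n.-tuple TR => \prod_i (C i * eta (tnth t i)))).
  apply: (tensor_integral (A := fun i x => C i * eta x) _).1 => i.
  by apply: rintegrableZ; exact: integrable_eta.
have iB : (lebesgue R n).-integrable setT (EFin \o (fun t => Cf * teta (row_of t))).
  by apply: rintegrableZ; exact: (@teta_integral R n).1.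
pose G (z : n.-tuple TR * n.-tuple TR) := phiexp y z * f (row_of z.2).
have mG : cmeas G.
  by apply: cmeasM; [exact: cmeas_phiexp|apply: (cmeas_comp mf); exact: measurable_snd].
have dG x z : normc (G (x, z)) <= \prod_i (C i * eta (tnth x i)) * (Cf * teta (row_of z)).
  by rewrite /G Normc.normcM ler_pM ?normc_ge0//; exact: (bE (x, z)).
have idom (g : n.-tuple TR -> R[i]) : cmeas g -> (forall t, normc (g t) <= 1) ->
   cinteg (lebesgue R n) (fun t => g t * f (row_of t)).
  move=> mg g1; apply: (cinteg_dom _ _ iB); first exact: cmeasM.
  move=> t; rewrite Normc.normcM -[leRHS]mul1r; apply: ler_pM; rewrite ?normc_ge0//.
have mexp (s : n.-tuple TR) : cmeas (fun x : n.-tuple TR => expi (dot (row_of s) (row_of x))).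
  apply: cont_expi_cmeas; under eq_fun do rewrite dot_row.
  apply: (@measurable_sum _ _ _ _ _ _ (fun i (x : n.-tuple TR) => tnth s i * tnth x i)) => i.
  by apply: measurable_funM; [exact: measurable_cst|exact: measurable_tnth].
have Gsec s : cinteg (lebesgue R n) (fun x => G (s, x)).
  exact: (cinteg_section iB mG dG).
transitivity (cint (lebesgue R n) (fun s => cint (lebesgue R n) (fun x => G (s, x)))).
  rewrite /fourier.
  have E s : expi (- dot (row_of s) (row_of y)) * (dyadic phi0 k (row_of s) * inv_fourier f (row_of s)) =
     expi (- dot (row_of s) (row_of y)) * (dyadic phi0 k (row_of s)) * fourier_const R n *
     cint (lebesgue R n) (fun x => expi (dot (row_of s) (row_of x)) * f (row_of x)).
    by rewrite /inv_fourier !mulrA.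
  have E2 s : fourier_const R n * (expi (- dot (row_of s) (row_of y)) * (dyadic phi0 k (row_of s)) * fourier_const R n *
     cint (lebesgue R n) (fun x => expi (dot (row_of s) (row_of x)) * f (row_of x))) =
     cint (lebesgue R n) (fun x => G (s, x)).
    rewrite mulrA -cintZ; last by apply: idom => // t; rewrite normc_expi.
    apply: eq_cint => x; rewrite mulrA; congr (_ * _).
    rewrite !dot_row dyadic_row /phiexp big_split/= -sumrN !expi_sum.
    have -> : forall a b c e : R[i], a * (b * c * a) * e = (a * a) * c * (b * e) by move=> a b c e; ring.
    rewrite fourier_const2 -!big_split/=; apply: eq_bigr => i _.
    by rewrite -expiD; congr (_ * expi _); ring.
  have iI : cinteg (lebesgue R n) (fun s => cint (lebesgue R n) (fun x => G (s, x))).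
    exact: (cinteg_cint iA iB mG dG).
  have fc0 : fourier_const R n != 0.
    rewrite /fourier_const; apply/eqP => -[/eqP]; apply/negP.
    by rewrite gt_eqF// powR_gt0// mulr_gt0// pi_gt0.
  have E3 s : expi (- dot (row_of s) (row_of y)) * (dyadic phi0 k (row_of s) * inv_fourier f (row_of s)) =
     (fourier_const R n)^-1 * cint (lebesgue R n) (fun x => G (s, x)).
    by rewrite E -E2 mulKf.
  rewrite /cintegral -[Complex _ _]/(cint (lebesgue R n) (fun s => expi (- dot (row_of s) (row_of y)) * (dyadic phi0 k (row_of s) * inv_fourier f (row_of s)))).
  by under eq_cint do rewrite E3; rewrite cintZ// mulVKf.
rewrite (cfubini iA iB mG dG); apply: eq_cint => x.
rewrite /G/=; under eq_cint do rewrite mulrC.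
rewrite cintZ; last first.
  apply: (cinteg_dom _ (fun s => bE (s, x)) iA).
  exact: (cmeas_comp (cmeas_phiexp y) (pair2_measurable x)).
congr (_ * _); rewrite /phiexp /=.
rewrite (@ctensor_integral _ _ (fun i s => inv_2pi%:C%C * dyadic1 phi0 (k i) s * expi (s * (tnth x i - tnth y i))) (fun i s => C i * eta s)).
- by apply: eq_bigr => i _; apply: eq_cint => s; rewrite mulrC [s * _]mulrC.
- move=> i; apply: cmeasM.
    by apply: cmeasM; [exact: cmeas_cst|exact: cphi_meas].
  by apply: cont_expi_cmeas; apply: measurable_funM => //; exact: measurable_cst.
- by move=> i s; rewrite Normc.normcM normc_expi mulr1 (hC i).2.
- by move=> i; apply: rintegrableZ; exact: integrable_eta.
Qed.

Lemma cmeas_block_kernel : cmeas (fun z : n.-tuple TR * n.-tuple TR => block_kernel z.1 z.2).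
Proof.
apply: (@cmeas_prod _ _ _ _ _ (fun i (z : n.-tuple TR * n.-tuple TR) =>
  psi phi0 (k i) (tnth z.1 i - tnth z.2 i))) => i.
apply: (cmeas_comp (ccont_cmeas (psi_cont hphi0 (k i)))).
apply: measurable_funB; apply: measurable_tn; [exact: measurable_fst|exact: measurable_snd].
Qed.

Lemma block_kernel_bound : exists2 B, 0 <= B & forall x y, normc (block_kernel x y) <= B.
Proof.
have h (i : 'I_n) : exists C : R, 0 <= C /\ forall x, normc (psi phi0 (k i) x) <= C.
  by have [C C0 hC] := psi_eta (k i); exists C.
have [C hC] := choice h; exists (\prod_i C i).
  by apply: prodr_ge0 => i _; exact: (hC i).1.
move=> x y; rewrite normc_prod; apply: ler_prod => i _.
by rewrite normc_ge0 (hC i).2.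
Qed.

Variables (h : n.-tuple TR -> R[i]) (B : R).
Hypotheses (mh : cmeas h) (hB : forall t, normc (h t) <= B * teta (row_of t)).

(** A second use of Fubini moves the kernel from the test function onto h, which exhibits the block
    as a function. *)
Lemma block_fubini f : schwartz f ->
  cinteg (lebesgue R n) (fun x => cint (lebesgue R n) (fun y => h y * block_kernel x y) * f (row_of x)) /\
  cint (lebesgue R n) (fun y => h y * cint (lebesgue R n) (fun x => f (row_of x) * block_kernel x y)) =
  cint (lebesgue R n) (fun x => cint (lebesgue R n) (fun y => h y * block_kernel x y) * f (row_of x)).
Proof.
move=> sf; have [Cf Cf0 hf] := schwartz_bound sf; have mf := schwartz_cmeas sf.
have [D D0 hD] := block_kernel_bound.
have iA : (lebesgue R n).-integrable setT (EFin \o (fun t => D * (Cf * teta (row_of t)))).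
  by do 2 apply: rintegrableZ; exact: (@teta_integral R n).1.
have iB : (lebesgue R n).-integrable setT (EFin \o (fun t => B * teta (row_of t))).
  by apply: rintegrableZ; exact: (@teta_integral R n).1.
pose G (z : n.-tuple TR * n.-tuple TR) := f (row_of z.1) * (h z.2 * block_kernel z.1 z.2).
have mG : cmeas G.
  apply: cmeasM; first by apply: (cmeas_comp mf); exact: measurable_fst.
  apply: cmeasM; last exact: cmeas_block_kernel.
  by apply: (cmeas_comp mh); exact: measurable_snd.
have dG x y : normc (G (x, y)) <= D * (Cf * teta (row_of x)) * (B * teta (row_of y)).
  rewrite /G/= !Normc.normcM.
  have -> : forall a b c : R, a * (b * c) = c * a * b by move=> a b c; ring.
  rewrite ler_pM ?normc_ge0 ?mulr_ge0 ?normc_ge0//.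
  by rewrite ler_pM ?normc_ge0.
have ih x : cinteg (lebesgue R n) (fun y => h y * block_kernel x y).
  apply: (@cinteg_dom _ _ _ _ _ (fun t => D * (B * teta (row_of t)))).
  - apply: cmeasM; first exact: mh.
    exact: (cmeas_comp cmeas_block_kernel (pair1_measurable x)).
  - by move=> y; rewrite Normc.normcM mulrC ler_pM ?normc_ge0.
  - exact: rintegrableZ.
have jf y : cinteg (lebesgue R n) (fun x => f (row_of x) * block_kernel x y).
  apply: (@cinteg_dom _ _ _ _ _ (fun t => D * (Cf * teta (row_of t)))) iA.
  - apply: cmeasM; first exact: mf.
    exact: (cmeas_comp cmeas_block_kernel (pair2_measurable y)).
  - by move=> x; rewrite Normc.normcM mulrC ler_pM ?normc_ge0.
have E x : cint (lebesgue R n) (fun y => G (x, y)) =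
    cint (lebesgue R n) (fun y => h y * block_kernel x y) * f (row_of x).
  by rewrite /G/= cintZ// mulrC.
split.
  have := cinteg_cint iA iB mG dG.
  by under eq_fun do rewrite E.
transitivity (cint (lebesgue R n) (fun y => cint (lebesgue R n) (fun x => G (x, y)))).
  apply: eq_cint => y; rewrite -cintZ//; apply: eq_cint => x; rewrite /G/=; ring.
rewrite -(cfubini iA iB mG dG).
by apply: eq_cint => x; exact: E.
Qed.

End Dim.

Lemma cint_upper_step (Psi : nat -> R -> R[i]) : (forall k t, cder (Psi k) t (psi phi0 k t)) ->
  forall k a x, 0 <= a < 1 ->
  cint mu (fun s => (upper_step a s)%:C%C * psi phi0 k (x - s)) = Psi k (x - a) - Psi k (x - 1).
Proof.
move=> dP k a x /andP[a0 a1].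
have [c1 inv_2pi] := psi_cont hphi0 k.
have cB : continuous (fun s : R => x - s).
  by apply: contD; [exact: cst_continuous|apply: contN => y; exact: cvg_id].
have key (P p : R -> R) : continuous p -> (forall t : R, is_derive t 1 P (p t)) ->
    \int[mu]_s (upper_step a s * p (x - s)) = P (x - a) - P (x - 1).
  move=> cp dp.
  have cpx : continuous (fun s => p (x - s)).
    by move=> y; apply: (@continuous_comp _ _ _ (fun s => x - s) p); [exact: cB|exact: cp].
  have dF (s : R) : is_derive s 1 (fun s => - P (x - s)) (p (x - s)).
    have ds : is_derive s 1 (fun s : R => x - s) (-1).
      by apply: (is_derive_eq (is_deriveB (is_derive_cst x s 1) (is_derive_id s 1))); rewrite sub0r.
    have h := @is_derive1_comp R P (fun s => x - s) s _ _ (dp (x - s)) ds.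
    by apply: (is_derive_eq (is_deriveN h)); rewrite mulrN1 opprK.
  have := @ftc_interval R (fun s => - P (x - s)) _ a 1 (ltW a1) dF cpx.
  rewrite opprK [RHS]addrC => <-.
  rewrite -Rintegral_itv_obnd_cbnd; last first.
    apply: (@integrableS _ _ _ mu `[a, 1]%classic) => //; first exact: subset_itv_oc_cc.
    by apply: continuous_compact_integrable; [exact: segment_compact|exact: continuous_subspaceT].
  rewrite -Rintegral_itv_bndo_bndc; last first.
    apply: (@integrableS _ _ _ mu `[a, 1]%classic) => //; first exact: subset_itv_oo_cc.
    by apply: continuous_compact_integrable; [exact: segment_compact|exact: continuous_subspaceT].
  rewrite [RHS]Rintegral_mkcond; apply: eq_Rintegral => s _.
  rewrite patchE /upper_step; case: ifPn; rewrite ?inE ?notin_setE/= in_itv/=.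
    by move=> ->; rewrite mul1r.
  by move=> /negP/negPf ->; rewrite mul0r.
apply: eqReIm; rewrite ?cReD ?cReN ?cImD ?cImN ?Re_cint ?Im_cint.
  under eq_Rintegral do rewrite Re_realM.
  exact: (key (fun t => Re (Psi k t)) _ c1 (fun t => (dP k t).1)).
under eq_Rintegral do rewrite Im_realM.
exact: (key (fun t => Im (Psi k t)) _ inv_2pi (fun t => (dP k t).2)).
Qed.

(** A primitive of s psi(x - s) is - s Psi(x - s) - X(x - s), evaluated between 0 and 1. *)
Lemma cint_unit_ramp (Psi X : nat -> R -> R[i]) : (forall k t, cder (Psi k) t (psi phi0 k t)) ->
  (forall k t, cder (X k) t (Psi k t)) ->
  forall k x,
  cint mu (fun s => (unit_ramp s)%:C%C * psi phi0 k (x - s)) = X k x - X k (x - 1) - Psi k (x - 1).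
Proof.
move=> dP dX k x.
have [c1 inv_2pi] := psi_cont hphi0 k.
have cB : continuous (fun s : R => x - s).
  by apply: contD; [exact: cst_continuous|apply: contN => y; exact: cvg_id].
have key (P p Q : R -> R) : continuous p -> (forall t : R, is_derive t 1 P (p t)) ->
    (forall t : R, is_derive t 1 Q (P t)) ->
    \int[mu]_s (unit_ramp s * p (x - s)) = Q x - Q (x - 1) - P (x - 1).
  move=> cp dp dQ.
  have cpx : continuous (fun s : R => s * p (x - s)).
    apply: contM; first by move=> y; exact: cvg_id.
    by move=> y; apply: (@continuous_comp _ _ _ (fun s => x - s) p); [exact: cB|exact: cp].
  have dF (s : R) : is_derive s 1 (fun s => - (s * P (x - s)) - Q (x - s)) (s * p (x - s)).
    have ds : is_derive s 1 (fun s : R => x - s) (-1).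
      by apply: (is_derive_eq (is_deriveB (is_derive_cst x s 1) (is_derive_id s 1))); rewrite sub0r.
    have h1 := @is_derive1_comp R P (fun s => x - s) s _ _ (dp (x - s)) ds.
    have h2 := @is_derive1_comp R Q (fun s => x - s) s _ _ (dQ (x - s)) ds.
    apply: (is_derive_eq (is_deriveB (is_deriveN (is_deriveM (is_derive_id s 1) h1)) h2)).
    by rewrite /GRing.scale/=; ring.
  have := @ftc_interval R (fun s => - (s * P (x - s)) - Q (x - s)) _ 0 1 ler01 dF cpx.
  rewrite mul0r mul1r subr0 oppr0 sub0r opprK.
  have -> : Q x - Q (x - 1) - P (x - 1) = - P (x - 1) - Q (x - 1) + Q x by ring.
  move=> <-.
  rewrite -Rintegral_itv_bndo_bndc; last first.
    apply: (@integrableS _ _ _ mu `[0, 1]%classic) => //; first exact: subset_itv_co_cc.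
    by apply: continuous_compact_integrable; [exact: segment_compact|exact: continuous_subspaceT].
  rewrite [RHS]Rintegral_mkcond; apply: eq_Rintegral => s _.
  rewrite patchE /unit_ramp; case: ifPn; rewrite ?inE ?notin_setE/= in_itv/=.
    by move=> ->; rewrite mulr1.
  by move=> /negP/negPf ->; rewrite mulr0 mul0r.
apply: eqReIm; rewrite ?cReD ?cReN ?cImD ?cImN ?Re_cint ?Im_cint.
  under eq_Rintegral do rewrite Re_realM.
  exact: (key (fun t => Re (Psi k t)) _ (fun t => Re (X k t)) c1 (fun t => (dP k t).1) (fun t => (dX k t).1)).
under eq_Rintegral do rewrite Im_realM.
exact: (key (fun t => Im (Psi k t)) _ (fun t => Im (X k t)) inv_2pi (fun t => (dP k t).2) (fun t => (dX k t).2)).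
Qed.

End BlockIdentity.

Section DiscrepancyBlock.
Context {R : realType}.
Local Notation mu := (@lebesgue_measure R).
Local Notation TR := (measurableTypeR R).
Variable phi0 : R -> R[i].
Hypothesis hphi0 : dyadic_cutoff phi0.
Variables (n N : nat) (P : 'I_N -> 'rV[R]_n).
Hypotheses (N0 : (0 < N)%N) (P01 : forall z i, 0 <= P z 0 i < 1).

Definition hrow (x : 'rV[R]_n) : R :=
  N%:R^-1 * (\sum_(z < N) \prod_i upper_step (P z 0 i) (x 0 i)) - \prod_i unit_ramp (x 0 i).

Lemma prod_natr_bool (I : finType) (b : I -> bool) :
  \prod_i (b i)%:R = [forall i, b i]%:R :> R.
Proof.
have [/forallP h|] := boolP [forall i, b i].
  by apply: big1 => i _; rewrite h.
by rewrite negb_forall => /existsP[i /negPf bi]; rewrite (bigD1 i)//= bi mul0r.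
Qed.

Lemma discrepancy_patch : (discrepancy P) \_ (@cube R n) = hrow.
Proof.
apply/funext => x; rewrite patchE; case: ifPn.
  rewrite inE /cube/= => xc; rewrite /discrepancy /hrow; congr (_ * _ - _).
    apply: eq_bigr => z _; rewrite /upper_step prod_natr_bool; congr (nat_of_bool _)%:R.
    by apply: eq_forallb => i; have /andP[-> _] := P01 z i; have /andP[_ ->] := xc i; rewrite andbT.
  by apply: eq_bigr => i _; rewrite /unit_ramp xc mulr1.
rewrite notin_setE /cube/= => xc.
have [i xi] : exists i, ~~ (0 <= x 0 i < 1).
  by apply: contra_notP xc => h i; apply: contra_notT h => hi; exists i.
rewrite /hrow [X in _ - X](bigD1 i)//= /unit_ramp (negPf xi) mulr0 mul0r subr0 big1 ?mulr0// => z _.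
rewrite (bigD1 i)//= /upper_step; have /andP[p0 _] := P01 z i.
case: (boolP (P z 0 i < x 0 i < 1)) => [/andP[h1 h2]|]; last by rewrite mul0r.
by move: xi; rewrite h2 (ltW (le_lt_trans p0 h1)).
Qed.

Lemma cube_distributionE : cube_distribution (discrepancy P) =
  (fun f => cintegral setT (fun x => (hrow x)%:C%C * f x)).
Proof.
apply/funext => f; rewrite /cube_distribution /cintegral.
have pE t : ((discrepancy P) \_ (@cube R n)) (row_of t) =
   ((fun t => discrepancy P (row_of t)) \_ (@row_of R n @^-1` @cube R n)) t.
  by rewrite !patchE; congr (if _ then _ else _); apply/idP/idP; rewrite !inE.
congr Complex; rewrite Rintegral_mkcond; apply: eq_Rintegral => t _.
  rewrite cReM/= mul0r subr0 -discrepancy_patch pE !patchE.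
  by case: ifP => _; rewrite ?cReM/= ?mul0r ?subr0.
rewrite cImM/= mul0r addr0 -discrepancy_patch pE !patchE.
by case: ifP => _; rewrite ?cImM/= ?mul0r ?addr0.
Qed.

Lemma measurable_hrow : measurable_fun setT (fun t : n.-tuple TR => hrow (row_of t)).
Proof.
apply: measurable_funB.
  apply: measurable_funM; first exact: measurable_cst.
  apply: (@measurable_sum _ _ _ _ _ _ (fun z (t : n.-tuple TR) => \prod_i upper_step (P z 0 i) (row_of t 0 i))) => z.
  apply: (@measurable_prodr _ _ _ _ _ (fun i (t : n.-tuple TR) => upper_step (P z 0 i) (row_of t 0 i))) => i.
  under eq_fun do rewrite row_ofE.
  apply: measurable_coord; exact: measurable_upper_step.
apply: (@measurable_prodr _ _ _ _ _ (fun i (t : n.-tuple TR) => unit_ramp (row_of t 0 i))) => i.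
under eq_fun do rewrite row_ofE.
apply: measurable_coord; exact: measurable_unit_ramp.
Qed.

Lemma hrow_bound x : `|hrow x| <= 2 ^+ n.+1 * teta x.
Proof.
have b (F : 'I_n -> R) : (forall i, `|F i| <= 2 * eta (x 0 i)) -> `|\prod_i F i| <= 2 ^+ n * teta x.
  move=> hF; rewrite normr_prod.
  have -> : 2 ^+ n * teta x = \prod_i (2 * eta (x 0 i)).
    by rewrite big_split/= prodr_const card_ord.
  by apply: ler_prod => i _; rewrite normr_ge0 hF.
rewrite exprS -mulrA mulr2n mulrDl !mul1r (le_trans (ler_normB _ _))// lerD//.
  rewrite normrM ger0_norm ?invr_ge0//.
  rewrite ler_pdivrMl ?ltr0n// (le_trans (ler_norm_sum _ _ _))//.
  rewrite mulr_natl -[X in _ *+ X](card_ord N) -sumr_const; apply: ler_sum => z _.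
  apply: b => i; apply: upper_step_eta; by have /andP[] := P01 z i.
by apply: b => i; exact: unit_ramp_eta.
Qed.

Lemma tempered_discrepancy : tempered (cube_distribution (discrepancy P)).
Proof.
rewrite cube_distributionE.
apply: (@tempered_bounded R n (fun x => (hrow x)%:C%C) (2 ^+ n.+1)).
  exact: (cmeas_real measurable_hrow).
move=> x; rewrite normc_real (le_trans (hrow_bound x))//.
by rewrite ler_piMr ?exprn_ge0// teta_le1.
Qed.

Variables Psi X : nat -> R -> R[i].
Hypotheses (dP : forall k t, cder (Psi k) t (psi phi0 k t))
  (dX : forall k t, cder (X k) t (Psi k t)).

Definition block (k : {ffun 'I_n -> nat}) (x : 'rV[R]_n) : R[i] :=
  (N%:R^-1)%:C%C * (\sum_(z < N) \prod_i (Psi (k i) (x 0 i - P z 0 i) - Psi (k i) (x 0 i - 1)))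
  - \prod_i (X (k i) (x 0 i) - X (k i) (x 0 i - 1) - Psi (k i) (x 0 i - 1)).

Section fixk.
Variable k : {ffun 'I_n -> nat}.

Lemma cint_hrow x : cint (lebesgue R n)
  (fun y => (hrow (row_of y))%:C%C * block_kernel phi0 k x y) = block k (row_of x).
Proof.
have hD0 (i : 'I_n) : exists D : R, 0 <= D /\ forall x, normc (psi phi0 (k i) x) <= D.
  by have [C C0 hC] := psi_eta hphi0 (k i); exists C.
have [D hD] := choice hD0.
have mpsi i : cmeas (fun s : TR => psi phi0 (k i) (tnth x i - s)).
  apply: (cmeas_comp (ccont_cmeas (psi_cont hphi0 (k i)))).
  by apply: measurable_funB; [exact: measurable_cst|exact: measurable_id].
have tens (F : 'I_n -> R -> R) : (forall i, measurable_fun setT (F i : TR -> R)) ->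
   (forall i s, `|F i s| <= 2 * eta s) ->
   cinteg (lebesgue R n) (fun y => \prod_i ((F i (tnth y i))%:C%C * psi phi0 (k i) (tnth x i - tnth y i))) /\
   cint (lebesgue R n) (fun y => \prod_i ((F i (tnth y i))%:C%C * psi phi0 (k i) (tnth x i - tnth y i))) =
   \prod_i cint mu (fun s => (F i s)%:C%C * psi phi0 (k i) (tnth x i - s)).
  move=> mF hF.
  have m i : cmeas (fun s : TR => (F i s)%:C%C * psi phi0 (k i) (tnth x i - s)).
    apply: cmeasM; last exact: mpsi.
    exact: (cmeas_real (mF i)).
  have b i s : normc ((F i s)%:C%C * psi phi0 (k i) (tnth x i - s)) <= D i * (2 * eta s).
    by rewrite Normc.normcM normc_real mulrC ler_pM ?normc_ge0//; exact: (hD i).2.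
  have iA i : mu.-integrable setT (EFin \o (fun s => D i * (2 * eta s))).
    by do 2 apply: rintegrableZ; exact: integrable_eta.
  split; last exact: (ctensor_integral m b iA).
  apply: (cinteg_dom _ _ (tensor_integral iA).1).
    exact: (ctensor_meas m).
  exact: (ctensor_dom b).
have HfE z := tens (fun i => upper_step (P z 0 i)) (fun i => @measurable_upper_step R _)
  (fun i s => @upper_step_eta R _ s (andP (P01 z i)).1).
have LfE := tens (fun i => @unit_ramp R) (fun i => @measurable_unit_ramp R) (fun i s => @unit_ramp_eta R s).
have E y : (hrow (row_of y))%:C%C * block_kernel phi0 k x y =
  (N%:R^-1)%:C%C * (\sum_(z < N) \prod_i ((upper_step (P z 0 i) (tnth y i))%:C%C * psi phi0 (k i) (tnth x i - tnth y i)))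
  + (-1) * \prod_i ((unit_ramp (tnth y i))%:C%C * psi phi0 (k i) (tnth x i - tnth y i)).
  rewrite /hrow rmorphB rmorphM rmorph_sum mulrBl -mulrA mulr_suml mulN1r; congr (_ * _ - _).
    apply: eq_bigr => z _; rewrite rmorph_prod -big_split/=.
    by apply: eq_bigr => i _; rewrite row_ofE.
  rewrite rmorph_prod -big_split/=.
  by apply: eq_bigr => i _; rewrite row_ofE.
under eq_cint do rewrite E.
have isum := cinteg_sum (index_enum 'I_N) (fun z => (HfE z).1).
rewrite cintD; last 2 first.
- exact: cintegZ.
- by apply: cintegZ; exact: LfE.1.
rewrite !cintZ//; last exact: LfE.1.
rewrite cint_sum; last by move=> z; exact: (HfE z).1.
rewrite mulN1r /block; congr (_ * _ - _).
  apply: eq_bigr => z _; rewrite (HfE z).2; apply: eq_bigr => i _.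
  by rewrite (cint_upper_step hphi0 dP)// row_ofE.
rewrite LfE.2; apply: eq_bigr => i _.
by rewrite (cint_unit_ramp hphi0 dP dX)// row_ofE.
Qed.

Lemma block_continuous : continuous (fun x => Re (block k x)) /\ continuous (fun x => Im (block k x)).
Proof.
pose cc (f : 'rV[R]_n -> R[i]) := continuous (fun x => Re (f x)) /\ continuous (fun x => Im (f x)).
have ccD f g : cc f -> cc g -> cc (fun x => f x + g x).
  move=> [f1 f2] [g1 g2]; split.
    by under eq_fun do rewrite cReD; move=> x; exact: (continuousD (f1 x) (g1 x)).
  by under eq_fun do rewrite cImD; move=> x; exact: (continuousD (f2 x) (g2 x)).
have ccM f g : cc f -> cc g -> cc (fun x => f x * g x).
  move=> [f1 f2] [g1 g2]; split.
    under eq_fun do rewrite cReM.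
    by move=> x; exact: (continuousB (continuousM (f1 x) (g1 x)) (continuousM (f2 x) (g2 x))).
  under eq_fun do rewrite cImM.
  by move=> x; exact: (continuousD (continuousM (f1 x) (g2 x)) (continuousM (f2 x) (g1 x))).
have ccc (c : R[i]) : cc (fun=> c) by split; exact: cst_continuous.
have ccsum (I : Type) (s : seq I) (F : I -> 'rV[R]_n -> R[i]) :
    (forall i, cc (F i)) -> cc (fun x => \sum_(i <- s) F i x).
  move=> hF; elim: s => [|a s ih]; first by under eq_fun do rewrite big_nil; exact: ccc.
  by under eq_fun do rewrite big_cons; exact: ccD.
have ccprod (I : Type) (s : seq I) (F : I -> 'rV[R]_n -> R[i]) :
    (forall i, cc (F i)) -> cc (fun x => \prod_(i <- s) F i x).
  move=> hF; elim: s => [|a s ih]; first by under eq_fun do rewrite big_nil; exact: ccc.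
  by under eq_fun do rewrite big_cons; exact: ccM.
have cc1 (F f : R -> R[i]) (a : R) i : (forall t, cder F t (f t)) -> cc (fun x => F (x 0 i - a)).
  move=> dF; have [h1 h2] := cder_cont dF.
  have cl : continuous (fun x : 'rV[R]_n => x 0 i - a).
    by move=> x; exact: (continuousB (@coord_continuous R 1 n 0 i x) (@cst_continuous _ _ a x)).
  split=> x.
    by apply: (@continuous_comp _ _ _ (fun x : 'rV[R]_n => x 0 i - a) (fun t => Re (F t))); [exact: cl|exact: h1].
  by apply: (@continuous_comp _ _ _ (fun x : 'rV[R]_n => x 0 i - a) (fun t => Im (F t))); [exact: cl|exact: h2].
have ccN f : cc f -> cc (fun x => - f x).
  by move=> cf; under eq_fun do rewrite -mulN1r; apply: (ccM _ _) => //; exact: ccc.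
apply: (ccD _ _).
  apply: (ccM _ _); first exact: ccc.
  apply: (ccsum _ _) => z; apply: (ccprod _ _) => i; apply: (ccD _ _); first exact: cc1 (dP (k i)).
  by apply: (ccN _); exact: cc1 (dP (k i)).
apply: (ccN _); apply: (ccprod _ _) => i; apply: (ccD _ _); last by apply: (ccN _); exact: cc1 (dP (k i)).
apply: (ccD _ _); last by apply: (ccN _); exact: cc1 (dX (k i)).
have := @cc1 _ _ 0 i (dX (k i)).
by congr cc; apply/funext => x; rewrite subr0.
Qed.

(** The closed form [block] is continuous and represents the distribution, so uniqueness identifies
    it with the density. *)
Lemma dyadic_blockE : dyadic_block phi0 (cube_distribution (discrepancy P)) k = block k.
Proof.
apply: (densityE hphi0); split; first exact: block_continuous.1.
split; first exact: block_continuous.2.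
move=> f sf.
have hB t : normc ((hrow (row_of t))%:C%C) <= 2 ^+ n.+1 * teta (row_of t).
  by rewrite normc_real hrow_bound.
have [i1 E] := block_fubini hphi0 k (cmeas_real measurable_hrow) hB sf.
have Ex : (fun x => cint (lebesgue R n) (fun y => (hrow (row_of y))%:C%C * block_kernel phi0 k x y) * f (row_of x)) =
  (fun x => block k (row_of x) * f (row_of x)) by apply/funext => x; rewrite cint_hrow.
rewrite Ex in i1; rewrite Ex in E.
split; first exact: i1.
rewrite /dinv_fourier /dmul /dfourier cube_distributionE.
transitivity (cint (lebesgue R n) (fun t => (hrow (row_of t))%:C%C * cint (lebesgue R n) (fun x => f (row_of x) * block_kernel phi0 k x t))).
  by apply: eq_cint => t; rewrite (fourier_block hphi0).
exact: E.
Qed.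

End fixk.
End DiscrepancyBlock.

(** * Counting net points in elementary boxes *)

Section Digits.
Variable b : nat.
Hypothesis b1 : (1 < b)%N.
Implicit Types (dg : nat -> nat).

(** The integer m written by the first j digits: the point with these digits lies in [m / b^j, (m +
    1) / b^j). *)
Fixpoint cell dg j : nat := if j is j'.+1 then (cell dg j' * b + dg j')%N else 0%N.

Lemma eq_cell dg dg' j : (forall l, (l < j)%N -> dg l = dg' l) -> cell dg j = cell dg' j.
Proof.
elim: j => //= j ih h; rewrite ih => [|l lj]; last by apply: h; rewrite ltnW.
by rewrite h.
Qed.

Lemma cell_inj dg dg' j : (forall l, dg l < b)%N -> (forall l, dg' l < b)%N ->
  cell dg j = cell dg' j -> forall l, (l < j)%N -> dg l = dg' l.
Proof.
move=> h h'; elim: j => //= j ih E l.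
have b0 : (0 < b)%N by exact: ltnW.
have E1 : cell dg j = cell dg' j.
  by have := congr1 (divn^~ b) E; rewrite !divnMDl// !divn_small// !addn0.
have E2 : dg j = dg' j by move: E; rewrite E1 => /addnI.
by rewrite ltnS leq_eqVlt => /predU1P[->//|lj]; exact: ih.
Qed.

Lemma cell_lt dg j : (forall l, dg l < b)%N -> (cell dg j < b ^ j)%N.
Proof.
move=> h; elim: j => //= j ih; rewrite expnSr.
apply: (@leq_trans ((cell dg j).+1 * b)%N); last by rewrite leq_mul2r ih orbT.
by rewrite mulSn addnC ltn_add2r.
Qed.

Lemma cell_surj j m : (m < b ^ j)%N -> exists dg, (forall l, dg l < b)%N /\ cell dg j = m.
Proof.
have b0 : (0 < b)%N by exact: ltnW.
elim: j m => [|j ih] m.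
  by rewrite expn0 ltnS leqn0 => /eqP ->; exists (fun=> 0%N).
move=> hm; have [|dg [h E]] := ih (m %/ b)%N.
  by rewrite ltn_divLR// -expnSr.
exists (fun l => if (l < j)%N then dg l else m %% b)%N; split.
  by move=> l; case: ifP => // _; rewrite ltn_mod.
rewrite /= ltnn (@eq_cell _ dg) ?E -?divn_eq// => l ->//.
Qed.

Lemma cell_floor (R : realType) dg j s : (forall l, dg l < b)%N -> (j <= s)%N ->
  let x : R := \sum_(l < s) (dg l)%:R / b%:R ^+ l.+1 in
  (cell dg j)%:R / b%:R ^+ j <= x /\ x < (cell dg j).+1%:R / b%:R ^+ j.
Proof.
move=> h js x.
have b0 : 0 < (b%:R : R) by rewrite ltr0n ltnW.
have E k : \sum_(l < k) (dg l)%:R / b%:R ^+ l.+1 = (cell dg k)%:R / b%:R ^+ k :> R.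
  elim: k => [|k ih]; first by rewrite big_ord0 mul0r.
  rewrite big_ord_recr/= ih natrD natrM mulrDl exprSr; congr (_ + _).
  by rewrite -mulf_div divff ?mulr1 ?gt_eqF.
have nE k : (cell dg j * b ^ k <= cell dg (k + j) < (cell dg j).+1 * b ^ k)%N.
  elim: k => [|k /andP[ih1 ih2]]; first by rewrite add0n expn0 !muln1 leqnn ltnSn.
  rewrite addSn /= expnSr !mulnA; apply/andP; split.
    by rewrite (leq_trans _ (leq_addr _ _))// leq_mul2r ih1 orbT.
  apply: (@leq_trans ((cell dg (k + j)).+1 * b)%N); last by rewrite leq_mul2r ih2 orbT.
  by rewrite mulSn addnC ltn_add2r.
rewrite /x E -{2 4}(subnK js) exprD; have /andP[h1 h2] := nE (s - j)%N; rewrite (subnK js) in h1 h2.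
have p1 : 0 < (b%:R : R) ^+ (s - j) by rewrite exprn_gt0.
have p2 : 0 < (b%:R : R) ^+ j by rewrite exprn_gt0.
rewrite invfM mulrA; split.
  by rewrite ler_pM2r ?invr_gt0// ler_pdivlMr// -natrX -natrM ler_nat.
by rewrite ltr_pM2r ?invr_gt0// ltr_pdivrMr// -natrX -natrM ltr_nat.
Qed.

End Digits.

Section Fp.
Local Close Scope classical_set_scope.
Variables (b n : nat).
Hypothesis pb : prime b.
Local Notation F := 'F_b.

Lemma Fp_lt (x : F) : (x < b)%N.
Proof. by apply: leq_trans (ltn_ord x) _; rewrite (Fp_cast pb). Qed.

Lemma eq_base (x y : nat) m : (x < b ^ m)%N -> (y < b ^ m)%N ->
  (forall k, (k < m)%N -> (x %/ b ^ k) %% b = (y %/ b ^ k) %% b)%N -> x = y.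
Proof.
have b0 := prime_gt0 pb.
elim: m x y => [|m ih] x y.
  by rewrite expn0 !ltnS !leqn0 => /eqP -> /eqP ->.
move=> hx hy h; rewrite (divn_eq x b) (divn_eq y b).
have := h 0%N isT; rewrite expn0 !divn1 => ->; congr (_ * b + _)%N.
apply: ih; rewrite ?ltn_divLR// -?expnSr// => k km.
by rewrite -!divnMA -!expnS; exact: h.
Qed.

Lemma digits_inj : injective (fun nu : 'I_(b ^ n) => digits b n nu).
Proof.
move=> x y /matrixP E; apply: val_inj; apply: (@eq_base _ _ n); [exact: ltn_ord|exact: ltn_ord|move=> k kn].
have := E (Ordinal kn) 0; rewrite !mxE/= => /(congr1 (fun z : 'F_b => (z : nat))).
by rewrite !val_Fp_nat// !modn_mod.
Qed.

Lemma digits_bij : bijective (fun nu : 'I_(b ^ n) => digits b n nu).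
Proof.
apply: inj_card_bij; first exact: digits_inj.
by rewrite card_mx card_Fp// muln1 card_ord.
Qed.

(** With B a right inverse of A, the fibre over w is the kernel translated by B w, so all fibres
    have the same size. *)
Lemma fiber_card k (A : 'M[F]_(k, n)) : row_free A -> exists c : nat,
  (c * b ^ k = b ^ n)%N /\ forall w : 'cV[F]_k, #|[set u : 'cV[F]_n | A *m u == w]| = c.
Proof.
move=> /row_freeP[B AB]; exists #|[set u : 'cV[F]_n | A *m u == 0]|.
have h (w : 'cV[F]_k) : #|[set u : 'cV[F]_n | A *m u == w]| = #|[set u : 'cV[F]_n | A *m u == 0]|.
  have inj : injective (fun u : 'cV[F]_n => u + B *m w) by move=> u v /addIr.
  rewrite -[RHS](card_imset _ inj); apply: eq_card => u.
  rewrite inE; apply/eqP/imsetP => [E|[v]]; last first.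
    by rewrite inE => /eqP E ->; rewrite mulmxDr E add0r mulmxA AB mul1mx.
  exists (u - B *m w); last by rewrite subrK.
  by rewrite inE mulmxBr E mulmxA AB mul1mx subrr.
split=> //.
transitivity (\sum_(w : 'cV[F]_k) #|[set u : 'cV[F]_n | A *m u == w]|)%N.
  under eq_bigr do rewrite h.
  by rewrite sum_nat_const card_mx card_Fp// muln1 mulnC.
transitivity #|{: 'cV[F]_n}|; last by rewrite card_mx card_Fp// muln1.
rewrite -sum1_card (partition_big (fun u : 'cV[F]_n => A *m u) predT)//=.
apply: eq_bigr => w _; rewrite -sum1_card; apply: eq_bigl => u.
by rewrite inE.
Qed.

End Fp.

Section Net.
Local Close Scope classical_set_scope.
Variables (d b s n v : nat) (M : 'I_d -> 'M['F_b]_(s, n)).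
Hypotheses (pb : prime b) (hM : order_net 1 v M).

(** The sum form extends the digits by 0 beyond s, so that [cell] can be applied to a function on
    all of nat. *)
Definition dig (nu : 'I_(b ^ n)) (i : 'I_d) (l : nat) : nat :=
  \sum_(l' < s | l' == l :> nat) (((M i *m digits b n nu) l' 0)%R : nat).

Lemma digE nu i (l : 'I_s) : dig nu i l = ((M i *m digits b n nu) l 0)%R :> nat.
Proof. by rewrite /dig (big_pred1 l). Qed.

Lemma dig_lt nu i l : (dig nu i l < b)%N.
Proof.
have [ls|ls] := ltnP l s; first by rewrite (digE nu i (Ordinal ls)) Fp_lt.
rewrite /dig big1 ?prime_gt0// => l' /eqP E.
by move: (ltn_ord l'); rewrite E ltnNge ls.
Qed.

Variable j : 'I_d -> nat.
Hypothesis hj : (\sum_i j i <= n - v)%N.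

(** The first [j i] rows of each matrix in decreasing order. For order 1 only the largest index
    counts, so the total cost is at most the sum of the [j i]. *)
Let lam (i : 'I_d) : seq 'I_s := [seq l : 'I_s <- rev (enum 'I_s) | (l < j i)%N].
Let S : seq ('I_d * 'I_s) := flatten [seq [seq (i, l) | l <- lam i] | i <- enum 'I_d].

Let js i : (j i <= s)%N.
Proof.
case: hM => h _ _; rewrite (leq_trans _ h)// mul1n.
by rewrite (leq_trans _ (leq_subr v n))// (leq_trans _ hj)// (bigD1 i)//= leq_addr.
Qed.

Let sizeS : size S = \sum_i j i.
Proof.
rewrite /S size_flatten /shape -map_comp sumnE big_map big_enum/=.
apply: eq_bigr => i _; rewrite /= size_map size_filter count_rev -sum1_count big_enum_cond/=.
by rewrite (big_ord_narrow (js i)) sum1_card card_ord.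
Qed.

Let memS i l : ((i, l) \in S) = (l < j i)%N.
Proof.
apply/flattenP/idP => [[x /mapP[i' _ ->] /mapP[l']]|lj].
  by rewrite mem_filter => /andP[h _] [-> ->].
exists [seq (i, l) | l <- lam i]; first by apply/mapP; exists i => //; rewrite mem_enum.
by apply/mapP; exists l => //; rewrite mem_filter lj mem_rev mem_enum.
Qed.

Let freeS : free [seq row il.2 (M il.1) | il <- S].
Proof.
case: hM => _ _ /(_ lam).
have -> : flatten [seq [seq row l (M i) | l <- lam i] | i <- enum 'I_d] = [seq row il.2 (M il.1) | il <- S].
  rewrite /S map_flatten -map_comp; congr flatten; apply: eq_map => i /=.
  by rewrite -map_comp; apply: eq_map.
apply.
- move=> i; apply: sorted_filter; first by move=> x y z /= h1 h2; exact: ltn_trans h2 h1.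
  rewrite rev_sorted; have := iota_ltn_sorted 0 s; rewrite -val_enum_ord sorted_map.
  by [].
- rewrite mul1n (leq_trans _ hj)//; apply: leq_sum => i _.
  have : all (fun l : 'I_s => l < j i)%N (lam i) by exact: filter_all.
  case: (lam i) => [|l t] /=; first by rewrite big_nil.
  by rewrite take0 big_seq1 => /andP[].
Qed.

Let A : 'M['F_b]_(size S, n) := \matrix_(a < size S) row (tnth (in_tuple S) a).2 (M (tnth (in_tuple S) a).1).

Let freeA : row_free A.
Proof.
apply: inj_row_free => w wA.
pose X := map_tuple (fun il : 'I_d * 'I_s => row il.2 (M il.1)) (in_tuple S).
have /freeP := (freeS : free X) => /(_ (fun a => w 0 a)) h.
apply/matrixP => a0 a; rewrite (ord1 a0) mxE; apply: h.
rewrite -[RHS]wA mulmx_sum_row; apply: eq_bigr => a' _; congr (_ *: _).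
by rewrite -(tnth_nth 0 X) tnth_map rowK.
Qed.

Let AE (u : 'cV['F_b]_n) a : (A *m u) a 0 =
  (M (tnth (in_tuple S) a).1 *m u) (tnth (in_tuple S) a).2 0.
Proof. by rewrite !mxE; apply: eq_bigr => k _; rewrite !mxE. Qed.

(** Lying in an elementary box prescribes the leading digits, a linear system for [digits] whose
    rows are independent by the net property; hence every box is a fibre of the same size. *)
Lemma box_count : exists c : nat, (c * b ^ (\sum_i j i) = b ^ n)%N /\
  forall m : 'I_d -> nat, (forall i, m i < b ^ j i)%N ->
  #|[set nu : 'I_(b ^ n) | [forall i, cell b (dig nu i) (j i) == m i]]| = c.
Proof.
have [c [cE hc]] := fiber_card pb freeA; exists c; rewrite -sizeS; split => // m hm.
have ht0 (i : 'I_d) : exists t : nat -> nat, (forall l, t l < b)%N /\ cell b t (j i) = m i.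
  exact: (cell_surj (prime_gt1 pb) (hm i)).
have [t ht] := choice ht0.
pose w : 'cV['F_b]_(size S) := \col_a (t (tnth (in_tuple S) a).1 (tnth (in_tuple S) a).2)%:R.
rewrite -(hc w) -[LHS](card_imset _ (@digits_inj b n pb)).
have b1 := prime_gt1 pb.
have Sin a : ((tnth (in_tuple S) a).2 < j (tnth (in_tuple S) a).1)%N.
  by rewrite -memS -surjective_pairing; exact: mem_tnth.
apply: eq_card => u; rewrite [RHS]inE; apply/imsetP/eqP => [[nu]|E].
  rewrite inE => /forallP h ->; apply/matrixP => a a0; rewrite (ord1 a0) AE [RHS]mxE.
  have := Sin a; case: (tnth _ a) => i l /= lj.
  apply: ord_inj; rewrite [RHS](val_Fp_nat pb) modn_small; last exact: (ht i).1.
  rewrite -[LHS]digE; apply: (cell_inj b1 (dig_lt nu i) (ht i).1 _ lj).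
  by rewrite (ht i).2; exact/eqP/h.
have [g gK Kg] := digits_bij n pb; exists (g u); rewrite ?Kg// inE.
apply/forallP => i; apply/eqP; rewrite -(ht i).2; apply: eq_cell => l lj.
have ls := leq_trans lj (js i).
have : (i, Ordinal ls) \in in_tuple S by rewrite /= memS.
move=> /tnthP[a Ea]; have : (A *m u) a 0 = w a 0 by rewrite E.
rewrite AE [RHS]mxE -Ea /= => /(congr1 (fun z : 'F_b => (z : nat))); rewrite [RHS](val_Fp_nat pb) modn_small; last exact: (ht i).1.
by rewrite (digE _ _ (Ordinal ls)) Kg.
Qed.

Lemma net_sum (K : comPzRingType) (sigma : 'I_d -> nat -> K) : exists c : nat,
  (c * b ^ (\sum_i j i) = b ^ n)%N /\
  \sum_(nu < b ^ n) \prod_i sigma i (cell b (dig nu i) (j i)) =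
  c%:R * \prod_i \sum_(m < b ^ j i) sigma i m.
Proof.
have [c [cE hc]] := box_count; exists c; split => //.
have jn i : (b ^ j i <= b ^ n)%N.
  rewrite leq_exp2l ?prime_gt1//.
  by rewrite (leq_trans _ (leq_subr v n))// (leq_trans _ hj)// (bigD1 i)//= leq_addr.
have cellb nu i : (cell b (dig nu i) (j i) < b ^ j i)%N by exact: cell_lt (dig_lt nu i).
pose f (nu : 'I_(b ^ n)) : {ffun 'I_d -> 'I_(b ^ n)} :=
  [ffun i => Ordinal (leq_trans (cellb nu i) (jn i))].
(* The ranges b^(j i) depend on i; extending each factor by 0 to the common range b^n allows
   distributing the product of sums over finite functions. *)
pose tau i (m : 'I_(b ^ n)) : K := if (m < b ^ j i)%N then sigma i m else 0.
transitivity (c%:R * \prod_i \sum_(m < b ^ n) tau i m); last first.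
  congr (_ * _); apply: eq_bigr => i _; rewrite /tau -big_mkcond/=.
  by rewrite (big_ord_narrow (jn i)).
rewrite bigA_distr_bigA/= mulr_sumr (partition_big f predT)//=; apply: eq_bigr => m _.
have [/forallP hm|] := boolP [forall i, (m i < b ^ j i)%N].
  rewrite -(hc (fun i => m i) hm) -sum1_card natr_sum mulr_suml.
  have E nu : [forall i, cell b (dig nu i) (j i) == m i] = (f nu == m).
    apply/forallP/eqP => [h|<- i]; last by rewrite ffunE.
    by apply/ffunP => i; apply: val_inj; rewrite ffunE; exact/eqP/h.
  apply: eq_big => [nu|nu /eqP <-]; first by rewrite inE E.
  by rewrite mul1r; apply: eq_bigr => i _; rewrite /tau ffunE /= cellb.
rewrite negb_forall => /existsP[i hi].
rewrite [X in _ = _ * X](bigD1 i)//= /tau (negPf hi) mul0r mulr0 big1// => nu /eqP E.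
by move: hi; rewrite -E ffunE /= cellb.
Qed.

End Net.

(** * Quadrature over the net *)

Section Core.
Context {R : realType}.
Variables (d b s n v : nat) (M : 'I_d -> 'M['F_b]_(s, n)).
Hypotheses (pb : prime b) (hM : order_net 1 v M).
Local Notation bR := (b%:R : R).
Local Notation zeta nu i := (digital_net R M nu 0 i).

Let b1 : (1 < b)%N. Proof. exact: prime_gt1. Qed.
Let b0 : 0 < bR. Proof. by rewrite ltr0n ltnW. Qed.
Let b2 : 2 <= bR. Proof. by rewrite ler_nat. Qed.

Lemma zetaE nu i : zeta nu i = \sum_(l < s) (dig M nu i l)%:R / bR ^+ l.+1.
Proof. by rewrite mxE; apply: eq_bigr => l _; rewrite digE. Qed.

Lemma zeta_cell nu i j : (j <= s)%N ->
  (cell b (dig M nu i) j)%:R / bR ^+ j <= zeta nu i /\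
  zeta nu i < (cell b (dig M nu i) j).+1%:R / bR ^+ j.
Proof. by move=> js; rewrite zetaE; exact: (@cell_floor b b1 R (dig M nu i) j s (@dig_lt d b s n M pb nu i) js). Qed.

Lemma zeta01 nu i : 0 <= zeta nu i < 1.
Proof.
have [] := @zeta_cell nu i 0%N (leq0n s); rewrite /= expr0 invr1 !mulr1 => h1 h2.
by rewrite h1.
Qed.

Variables (u V : 'I_d -> R -> R[i]) (th : 'I_d -> R -> R) (k : 'I_d -> nat)
  (kap : 'I_d -> nat) (C : R).
Hypotheses (C0 : 0 <= C)
  (th0 : forall i z, 0 <= th i z)
  (kap1 : forall i, bR ^+ kap i <= 2 ^+ k i)
  (kap2 : forall i, 2 ^+ k i <= bR ^+ (kap i).+1)
  (hu : forall i z, 0 <= z <= 1 -> normc (u i z) <= C * th i z)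
  (hV : forall i z1 z2 z, z1 < z2 -> z1 <= z <= z2 -> 2 ^+ k i * (z2 - z1) <= bR ->
     normc ((V i z2 - V i z1) / (z2 - z1)%:C%C - u i z) <= C * (2 ^+ k i * (z2 - z1)) * th i z).

(* [V i] is a primitive of [u i] up to an error, so [avg i j m] approximates
   [u i] on the b-adic interval [m / b^j, (m + 1) / b^j). *)
Definition avg i j m : R[i] :=
  (V i (m.+1%:R / bR ^+ j) - V i (m%:R / bR ^+ j)) * (bR ^+ j)%:C%C.

(** The cell has length b^-(kap i + e), and 2^(k i) <= b^(kap i + 1), so its length relative to the
    scale 2^-(k i) is at most b b^-e. *)
Lemma avg_close nu i e : (kap i + e <= s)%N ->
  normc (avg i (kap i + e) (cell b (dig M nu i) (kap i + e)) - u i (zeta nu i)) <=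
  C * bR * (bR ^+ e)^-1 * th i (zeta nu i).
Proof.
move=> js; have [h1 h2] := zeta_cell nu i js.
set m := cell _ _ _ in h1 h2 *; set j := (kap i + e)%N in js h1 h2 *.
have p0 : 0 < bR ^+ j by rewrite exprn_gt0.
have E : m.+1%:R / bR ^+ j - m%:R / bR ^+ j = (bR ^+ j)^-1.
  by rewrite -mulrBl -natrB// subSnn mul1r.
have le : 2 ^+ k i * (bR ^+ j)^-1 <= bR * (bR ^+ e)^-1.
  rewrite ler_pdivrMr// mulrAC ler_pdivlMr ?exprn_gt0//.
  rewrite (le_trans (ler_wpM2r _ (kap2 i))) ?exprn_ge0//.
  by rewrite /j exprD exprS -!mulrA.
have := @hV i _ _ (zeta nu i) _ _ _.
move=> /(_ (m%:R / bR ^+ j) (m.+1%:R / bR ^+ j)); rewrite E => h.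
have {}h : normc ((V i (m.+1%:R / bR ^+ j) - V i (m%:R / bR ^+ j)) / ((bR ^+ j)^-1)%:C%C - u i (zeta nu i)) <=
   C * (2 ^+ k i * (bR ^+ j)^-1) * th i (zeta nu i).
  apply: h.
  - by rewrite -subr_gt0 E invr_gt0.
  - by rewrite h1 ltW.
  - by rewrite (le_trans le)// ler_piMr// invf_le1 ?exprn_gt0// exprn_ege1// ler1n ltnW.
rewrite /avg -/j -/m.
have -> : (bR ^+ j)%:C%C = ((bR ^+ j)^-1)%:C%C^-1 :> R[i] by rewrite -fmorphV invrK.
by rewrite (le_trans h)// ler_wpM2r// -mulrA ler_wpM2l.
Qed.

Lemma sum_avg i j : \sum_(m < b ^ j) avg i j m = (V i 1 - V i 0) * (bR ^+ j)%:C%C.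
Proof.
rewrite -mulr_suml; congr (_ * _).
rewrite -(big_mkord predT (fun m => V i (m.+1%:R / bR ^+ j) - V i (m%:R / bR ^+ j))).
rewrite telescope_sumr// mul0r natrX divff// gt_eqF// exprn_gt0//.
Qed.

Lemma sum_div (K : zmodType) (f : nat -> K) q : \sum_(m < q * b) f (m %/ b)%N = (\sum_(m < q) f m) *+ b.
Proof.
elim: q => [|q ih]; first by rewrite mul0n !big_ord0 mul0rn.
rewrite big_ord_recr/= mulrnDl -ih -!(big_mkord predT (fun m => f (m %/ b)%N)).
rewrite mulSn addnC (@big_cat_nat _ _ _ (q * b))//= ?leq_addr//; congr (_ + _).
rewrite (eq_big_nat _ _ (F2 := fun=> f q)); last first.
  move=> m /andP[h1 h2]; rewrite -(subnKC h1) divnMDl ?(ltnW b1)// divn_small ?addn0//.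
  by rewrite ltn_subLR.
by rewrite big_const_nat addKn iter_addr_0.
Qed.

Variable L : nat.
Hypothesis hL : (\sum_i kap i + L <= n - v)%N.

(** Level increment as a function of the cell alone; [m %/ b] is the parent cell. *)
Definition stp i (e : nat) (m : nat) : R[i] :=
  if e is e'.+1 then avg i (kap i + e) m - avg i (kap i + e') (m %/ b)%N else avg i (kap i) m.

Lemma sum_stp i e : \sum_(m < b ^ (kap i + e)) stp i e m =
  if e == 0%N then (V i 1 - V i 0) * (bR ^+ kap i)%:C%C else 0.
Proof.
case: e => [|e]; first by rewrite addn0 sum_avg.
rewrite /= big_split/= sum_avg sumrN.
have E q : q = (b ^ (kap i + e) * b)%N ->
    \sum_(m < q) avg i (kap i + e) (m %/ b)%N = ((V i 1 - V i 0) * (bR ^+ (kap i + e))%:C%C) *+ b.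
  by move=> ->; rewrite (sum_div (avg i (kap i + e))) sum_avg.
rewrite E; last by rewrite addnS expnSr.
by rewrite addnS exprSr !rmorphM/= rmorph_nat mulrA mulr_natr subrr.
Qed.

Let ks i e : (e <= L)%N -> (kap i + e <= s)%N.
Proof.
move=> eL; have h : (n <= s)%N by case: hM => + _ _; rewrite mul1n.
apply: (leq_trans _ h); apply: (leq_trans _ (leq_subr v n)).
apply: (leq_trans _ hL); apply: leq_add => //.
by rewrite (bigD1 i)//= leq_addr.
Qed.

(** The last stage e = L + 1 is the exact value, so the telescoped sum over L + 2 terms leaves no
    remainder. *)
Definition stage nu i e : R[i] :=
  if (e <= L)%N then avg i (kap i + e) (cell b (dig M nu i) (kap i + e)) else u i (zeta nu i).

Definition diffst nu i e : R[i] := stage nu i e - (if e is e'.+1 then stage nu i e' else 0).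

Lemma sum_diffst nu i : \sum_(e < L.+2) diffst nu i e = u i (zeta nu i).
Proof.
have -> : forall m, \sum_(e < m.+1) diffst nu i e = stage nu i m.
  elim=> [|m ih]; first by rewrite big_ord_recl big_ord0 addr0 /diffst subr0.
  by rewrite big_ord_recr/= ih /diffst addrC subrK.
by rewrite /stage ltnn.
Qed.

Lemma diffst_stp nu i e : (e <= L)%N ->
  diffst nu i e = stp i e (cell b (dig M nu i) (kap i + e)).
Proof.
case: e => [|e] eL; first by rewrite /diffst /stage /= addn0 subr0.
rewrite /diffst /stage eL (ltnW eL) /stp; congr (_ - avg _ _ _).
rewrite addnS /= divnMDl ?(ltnW b1)// divn_small ?addn0//; exact: (@dig_lt d b s n M pb).
Qed.

(** Stages e and e - 1 miss the exact value by C b b^-e and C b b^-(e-1), together C b (1 + b)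
    b^-e. *)
Definition Cd : R := C * bR * (1 + bR).

Lemma stage_close nu i e : (e <= L.+1)%N ->
  normc (stage nu i e - u i (zeta nu i)) <= C * bR * (bR ^+ e)^-1 * th i (zeta nu i).
Proof.
move=> eL; rewrite /stage; case: ifPn => [eL'|_]; first exact: avg_close (ks i eL').
rewrite subrr Normc.normc0 mulr_ge0// mulr_ge0 ?invr_ge0 ?exprn_ge0// ?(ltW b0)//.
by rewrite mulr_ge0// ltW.
Qed.

Lemma diffst_bound nu i e : (e <= L.+1)%N ->
  normc (diffst nu i e) <= Cd * (bR ^+ e)^-1 * th i (zeta nu i).
Proof.
move=> eL; have /andP[z0 z1] := zeta01 nu i.
have t0 := th0 i (zeta nu i).
case: e eL => [|e] eL.
  rewrite /diffst subr0 expr0 invr1 mulr1.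
  have -> : stage nu i 0 = (stage nu i 0 - u i (zeta nu i)) + u i (zeta nu i) by rewrite subrK.
  rewrite (le_trans (normcD _ _))//.
  have h1 := stage_close nu i (leq0n L.+1); rewrite expr0 invr1 mulr1 in h1.
  have h2 := @hu i (zeta nu i); rewrite z0 (ltW z1) in h2; have {}h2 := h2 isT.
  have Ct := mulr_ge0 C0 t0; rewrite /Cd.
  have -> : C * bR * (1 + bR) * th i (zeta nu i) = C * th i (zeta nu i) * (bR * (1 + bR)) by ring.
  have : C * th i (zeta nu i) * (1 + bR) <= C * th i (zeta nu i) * (bR * (1 + bR)).
    have b1R : 1 <= bR by apply: le_trans b2; rewrite ler1n.
    have b1R0 : 0 <= 1 + bR by rewrite addr_ge0// ltW.
    by rewrite ler_wpM2l// ler_peMl.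
  by lra.
rewrite /diffst.
have -> : stage nu i e.+1 - stage nu i e =
  (stage nu i e.+1 - u i (zeta nu i)) - (stage nu i e - u i (zeta nu i)) by ring.
have h1 := stage_close nu i eL; have h2 := stage_close nu i (ltnW eL).
have E : (bR ^+ e)^-1 = bR * (bR ^+ e.+1)^-1.
  by rewrite exprS invfM mulrA divff ?mul1r// gt_eqF.
rewrite E in h2; rewrite (le_trans (normcB _ _))//.
have := lerD h1 h2; rewrite /Cd; set x := (bR ^+ e.+1)^-1; set y := th _ _; move=> /le_trans; apply.
by rewrite le_eqVlt; apply/orP; left; apply/eqP; ring.
Qed.

(* Each [u i (zeta nu i)] is telescoped over the levels [kap i + e i].  The net integrates exactly
   the products of total level at most n - v, whose increments have mean zero unless all the
   [e i] are 0; every other product is of size b^-(sum of the [e i]) <= b^-(L+1). *)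
Lemma core_estimate :
  normc (((b ^ n)%:R^-1)%:C%C * (\sum_(nu < b ^ n) \prod_i u i (zeta nu i))
    - \prod_i (V i 1 - V i 0)) <=
  (L.+2%:R * Cd) ^+ d * (bR ^+ L.+1)^-1 *
    ((b ^ n)%:R^-1 * \sum_(nu < b ^ n) \prod_i th i (zeta nu i)).
Proof.
set N := (b ^ n)%N; set W := N%:R^-1 * _.
have N0 : 0 < (N%:R : R) by rewrite ltr0n expn_gt0 ltnW.
pose T (e : {ffun 'I_d -> 'I_L.+2}) : R[i] := (N%:R^-1)%:C%C * \sum_(nu < N) \prod_i diffst nu i (e i).
have Cd0 : 0 <= Cd by rewrite mulr_ge0 ?addr_ge0 ?mulr_ge0 ?(ltW b0).
have W0 : 0 <= W.
  rewrite mulr_ge0 ?invr_ge0 ?(ltW N0)//; apply: sumr_ge0 => nu _.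
  by apply: prodr_ge0 => i _.
have sumT : ((N%:R^-1)%:C%C * (\sum_(nu < N) \prod_i u i (zeta nu i))) = \sum_e T e.
  rewrite /T -mulr_sumr exchange_big/=; congr (_ * _); apply: eq_bigr => nu _.
  by rewrite -(bigA_distr_bigA (fun i (e : 'I_L.+2) => diffst nu i e)); apply: eq_bigr => i _; rewrite sum_diffst.
pose sm (e : {ffun 'I_d -> 'I_L.+2}) := (\sum_i e i <= L)%N.
have smallT e : sm e -> T e = if e == [ffun=> ord0] then \prod_i (V i 1 - V i 0) else 0.
  move=> eL.
  have ei i : (e i <= L)%N by apply: leq_trans eL; rewrite (bigD1 i)//= leq_addr.
  have hj : (\sum_i (kap i + e i) <= n - v)%N.
    by rewrite big_split/= (leq_trans _ hL)// leq_add2l.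
  have [c [cE hc]] := net_sum pb hM hj (fun i m => stp i (e i) m).
  rewrite /T.
  have -> : \sum_(nu < N) \prod_i diffst nu i (e i) =
      \sum_(nu < N) \prod_i stp i (e i) (cell b (dig M nu i) (kap i + e i)).
    by apply: eq_bigr => nu _; apply: eq_bigr => i _; rewrite diffst_stp.
  rewrite hc.
  have [e0|ne] := eqVneq e [ffun=> ord0].
    have -> : \prod_i \sum_(m < b ^ (kap i + e i)) stp i (e i) m =
        \prod_i (V i 1 - V i 0) * b%:R ^+ (\sum_i kap i).
      rewrite -prodrXr -big_split/=; apply: eq_bigr => i _.
      by rewrite sum_stp e0 ffunE/= rmorphXn rmorph_nat.
    have NE : (N%:R : R[i]) = c%:R * b%:R ^+ (\sum_i kap i).
      rewrite /N -cE natrM natrX; congr (_ * _ ^+ _).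
      by apply: eq_bigr => i _; rewrite e0 ffunE addn0.
    rewrite [_ * b%:R ^+ _]mulrC [c%:R * _]mulrA -NE fmorphV rmorph_nat mulKf//.
    by rewrite pnatr_eq0 -lt0n expn_gt0 ltnW.
  have [i ei0] : exists i, e i != ord0.
    apply/existsP; move: ne; apply: contraNT; rewrite negb_exists => /forallP h.
    by apply/eqP/ffunP => i; rewrite ffunE; apply/eqP; have := h i; rewrite negbK.
  rewrite (bigD1 i)//= sum_stp; have -> : (e i == 0%N :> nat) = false by apply/negbTE.
  by rewrite mul0r !mulr0.
have largeT e : ~~ sm e -> normc (T e) <= Cd ^+ d * (bR ^+ L.+1)^-1 * W.
  rewrite /sm -ltnNge => eL; rewrite /T Normc.normcM normc_real ger0_norm ?invr_ge0 ?(ltW N0)//.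
  rewrite /W mulrCA ler_wpM2l ?invr_ge0 ?(ltW N0)// (le_trans (normc_sum _ _ _))// mulr_sumr.
  apply: ler_sum => nu _; rewrite normc_prod.
  apply: (@le_trans _ _ (\prod_i (Cd * (bR ^+ e i)^-1 * th i (zeta nu i)))).
    by apply: ler_prod => i _; rewrite normc_ge0/= diffst_bound// -ltnS.
  rewrite big_split/= [X in X * _ <= _]big_split/= prodr_const card_ord ler_wpM2r//; first by apply: prodr_ge0.
  rewrite ler_wpM2l ?exprn_ge0// prodfV prodrXr lef_pV2 ?posrE ?exprn_gt0//.
  by rewrite ler_eXn2l// (lt_le_trans _ b2)// ltr1n.
rewrite sumT (bigID sm)/=.
have -> : \sum_(e | sm e) T e = \prod_i (V i 1 - V i 0).
  rewrite (bigD1 [ffun=> ord0])/=; last by rewrite /sm big1// => i _; rewrite ffunE.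
  rewrite smallT ?eqxx; last by rewrite /sm big1// => i _; rewrite ffunE.
  rewrite [X in _ + X]big1 ?addr0// => e /andP[es ne]; rewrite smallT// (negPf ne)//.
rewrite addrAC subrr add0r (le_trans (normc_sum _ _ _))//.
(* The uniform bound is summed over all (L + 2)^d multi-indices, not only the large ones. *)
apply: (@le_trans _ _ (\sum_(e : {ffun 'I_d -> 'I_L.+2}) (Cd ^+ d * (bR ^+ L.+1)^-1 * W))).
  rewrite [leRHS](bigID sm)/= -[leLHS]add0r; apply: lerD.
    by apply: sumr_ge0 => e _; rewrite mulr_ge0// mulr_ge0 ?invr_ge0 ?exprn_ge0// (ltW b0).
  by apply: ler_sum => e; exact: largeT.
rewrite sumr_const card_ffun !card_ord -[X in X <= _]mulr_natl natrX [in leRHS]exprMn.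
by rewrite !mulrA.
Qed.

End Core.

Section AtanSum.
Context {R : realType}.
Implicit Types X y : R.

Lemma eta_near X y : `|y| <= 1 -> eta (X + y) <= 4 * eta X.
Proof.
move=> y1; rewrite (le_trans (eta_shift X y))// -mulrA mulrCA [4 * _]mulrC ler_wpM2l ?eta_ge0//.
have : y ^+ 2 <= 1 by rewrite -real_normK ?num_real// exprn_ile1.
lra.
Qed.

Lemma eta_atan X : eta X <= 4 * (atan (X + 1) - atan X).
Proof.
have d (x : R) : is_derive x 1 (@atan R) (eta x) by apply: is_derive1_atan.

have x1 : X <= X + 1 by rewrite lerDl.
have [c] := MVT_segment x1 (fun x _ => d x) (continuous_subspaceT (is_derive_continuous d)).
rewrite in_itv/= => /andP[c1 c2] ->; rewrite addrAC subrr add0r mulr1.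
have -> : X = c + (X - c) by rewrite addrC subrK.
apply: eta_near; rewrite ler_norml; apply/andP; split; lra.
Qed.

(** [eta] at a point is at most 4 times its integral over the next unit interval; the [atan]
    differences telescope to at most pi. *)
Lemma sum_eta X B : \sum_(m < B) eta (X - m%:R) <= 4 * pi.
Proof.
apply: (@le_trans _ _ (4 * \sum_(m < B) (atan (m.+1%:R - X) - atan (m%:R - X)))).
  rewrite mulr_sumr; apply: ler_sum => m _; rewrite -etaN opprB (le_trans (eta_atan _))//.
  by rewrite ler_wpM2l// lerD2r -natr1 addrAC.
rewrite ler_wpM2l// -(big_mkord predT (fun m => atan (m.+1%:R - X) - atan (m%:R - X))) telescope_sumr//.
have := atan_ltpi2 (B%:R - X); have := atan_gtNpi2 (0%:R - X); lra.
Qed.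

End AtanSum.

(** * Pointwise bound of a dyadic block *)

Section NetSup.
Context {R : realType}.
Variables (d b s n v : nat) (M : 'I_d -> 'M['F_b]_(s, n)).
Hypotheses (pb : prime b) (hM : order_net 1 v M).
Local Notation bR := (b%:R : R).
Local Notation zeta nu i := (digital_net R M nu 0 i).

Lemma choose_levels (kap : 'I_d -> nat) t : (t <= \sum_i kap i)%N ->
  exists kap' : 'I_d -> nat, (forall i, kap' i <= kap i)%N /\ (\sum_i kap' i = t)%N.
Proof.
elim: t => [|t ih] ht.
  by exists (fun=> 0%N); split => //; rewrite big1.
have [kap' [h1 h2]] := ih (ltnW ht).
have [i hi] : exists i, (kap' i < kap i)%N.
  apply/existsP; apply: contraTT ht; rewrite negb_exists -leqNgt -h2 => /forallP h.
  by apply: leq_sum => i _; rewrite leqNgt.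
exists (fun j => if j == i then (kap' i).+1 else kap' j); split.
  by move=> j; case: eqVneq => [->|_].
rewrite (bigD1 i)//= eqxx addSn; congr _.+1; rewrite -h2 [RHS](bigD1 i)//=; congr addn.
by apply: eq_bigr => j /negPf ->.
Qed.

(* The point x may be close to few points of the net only: lowering the levels [kap] to a
   total of at most n - v, the net has equally many points in all the boxes. *)
Lemma theta_sup (g : 'I_d -> R -> R) (kap : 'I_d -> nat) (B : R) :
  (forall i z, 0 <= g i z) ->
  (forall i j, (j <= kap i)%N -> exists G : nat -> R, [/\ forall m, 0 <= G m,
     forall m z, m%:R / bR ^+ j <= z -> z < m.+1%:R / bR ^+ j -> g i z <= G m &
     \sum_(m < b ^ j) G m <= B]) ->
  (b ^ n)%:R^-1 * \sum_(nu < b ^ n) \prod_i g i (zeta nu i) <=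
  B ^+ d * (bR ^+ minn (\sum_i kap i) (n - v))^-1.
Proof.
move=> g0 hg; have b0 : 0 < bR by rewrite ltr0n prime_gt0.
have [kap' [h1 h2]] := choose_levels (geq_minl (\sum_i kap i) (n - v)).
have [G hG] := choice (fun i => hg i (kap' i) (h1 i)).
have hj : (\sum_i kap' i <= n - v)%N by rewrite h2 geq_minr.
have js i : (kap' i <= s)%N.
  have h : (n <= s)%N by case: hM => + _ _; rewrite mul1n.
  apply: (leq_trans _ h); apply: (leq_trans _ (leq_subr v n)); apply: (leq_trans _ hj).
  by rewrite (bigD1 i)//= leq_addr.
have [c [cE hc]] := net_sum pb hM hj (fun i m => G i m).
have N0 : 0 < ((b ^ n)%:R : R) by rewrite ltr0n expn_gt0 prime_gt0.
rewrite ler_pdivrMl//.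
apply: (@le_trans _ _ (\sum_(nu < b ^ n) \prod_i G i (cell b (dig M nu i) (kap' i)))).
  apply: ler_sum => nu _; apply: ler_prod => i _; rewrite g0/=.
  by have [z1 z2] := @zeta_cell R d b s n M pb nu i _ (js i); have [_ h _] := hG i; exact: h.
rewrite hc -h2 -cE natrM natrX -mulrA [b%:R ^+ _ * _]mulrC divfK; last first.
  by rewrite gt_eqF// exprn_gt0.
rewrite ler_wpM2l//.
have -> : B ^+ d = \prod_(i < d) B by rewrite prodr_const card_ord.
apply: ler_prod => i _; have [G0 _ ->] := hG i; rewrite andbT.
by apply: sumr_ge0 => m _.
Qed.

(** Replacing 2^k by the smaller b^j only increases [eta], and a cell then has scaled length 1, so
    its left end represents it up to a factor 4. Summation gives 4 * 4 pi. *)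
Lemma eta_levels (k : nat) (x : R) j : bR ^+ j <= 2 ^+ k ->
  exists G : nat -> R, [/\ forall m, 0 <= G m,
     forall m z, m%:R / bR ^+ j <= z -> z < m.+1%:R / bR ^+ j -> eta (2 ^+ k * (x - z)) <= G m &
     \sum_(m < b ^ j) G m <= 16 * pi].
Proof.
have b0 : 0 < bR by rewrite ltr0n prime_gt0.
move=> hj; have p0 : 0 < bR ^+ j by rewrite exprn_gt0.
exists (fun m => 4 * eta (bR ^+ j * x - m%:R)); split.
- by move=> m; rewrite mulr_ge0// eta_ge0.
- move=> m z; rewrite ler_pdivrMr// ltr_pdivlMr// -natr1 => h1 h2.
  apply: (@le_trans _ _ (eta (bR ^+ j * (x - z)))).
    rewrite -eta_norm -[leRHS]eta_norm ler_eta// !normrM ler_wpM2r//.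
    by rewrite !ger0_norm ?exprn_ge0 ?(ltW b0).
  have -> : bR ^+ j * (x - z) = (bR ^+ j * x - m%:R) + (m%:R - z * bR ^+ j) by ring.
  by apply: eta_near; rewrite ler_norml; apply/andP; split; lra.
- by rewrite -mulr_sumr; have := sum_eta (bR ^+ j * x) (b ^ j); lra.
Qed.

End NetSup.

Section BlockBound.
Context {R : realType}.
Local Notation mu := (@lebesgue_measure R).
Local Notation TR := (measurableTypeR R).
Variables (d b s n v : nat) (M : 'I_d -> 'M['F_b]_(s, n)).
Hypotheses (pb : prime b) (hM : order_net 1 v M).
Local Notation bR := (b%:R : R).
Local Notation zeta nu i := (digital_net R M nu 0 i).
Local Notation N := (b ^ n)%N.
Variables (Psi X c : nat -> R -> R[i]) (C : R).
Hypotheses (C0 : 0 <= C)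
  (K1 : forall k x z, 0 <= z <= 1 -> normc (Psi k (x - z) - c k x) <= C * eta (2 ^+ k * (x - z)) ^+ 3)
  (K2 : forall k x, normc (X k x - X k (x - 1) - c k x) <=
       C * (2 ^+ k)^-1 * (eta (2 ^+ k * x) ^+ 3 + eta (2 ^+ k * (x - 1)) ^+ 3))
  (K3 : forall k x z1 z2 z, z1 < z2 -> z1 <= z <= z2 -> 2 ^+ k * (z2 - z1) <= bR ->
       normc ((X k (x - z1) - X k (x - z2)) / (z2 - z1)%:C%C - Psi k (x - z)) <=
       C * (2 ^+ k * (z2 - z1)) * eta (2 ^+ k * (x - z)) ^+ 3).
Variable k : {ffun 'I_d -> nat}.

(** The integer part of a log_b 2: the level whose cells have length 2^-a up to a factor b. *)
Definition lev (a : nat) : nat := trunc_log b (2 ^ a).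

Lemma lev1 a : bR ^+ lev a <= 2 ^+ a.
Proof. by rewrite -!natrX ler_nat trunc_logP ?expn_gt0// prime_gt1. Qed.

Lemma lev2 a : 2 ^+ a <= bR ^+ (lev a).+1.
Proof. by rewrite -!natrX ler_nat ltnW// trunc_log_ltn// prime_gt1. Qed.

Definition KJ (J : {set 'I_d}) : nat := (\sum_(i in J) lev (k i))%N.

Variable x : 'rV[R]_d.

(* In each coordinate [Psi (x - z) - Psi (x - 1)] is split as [(Psi (x - z) - c) - (Psi (x - 1) - c)];
   expanding the products, [J] is the set of coordinates where the first term, the one
   that depends on the point z of the net, is taken. *)
Definition uJ (J : {set 'I_d}) i z : R[i] :=
  if i \in J then Psi (k i) (x 0 i - z) - c (k i) (x 0 i) else 1.
(** A primitive of [uJ J i] in z, normalised to vanish at z = 0. *)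
Definition VJ (J : {set 'I_d}) i (z : R) : R[i] :=
  if i \in J then X (k i) (x 0 i) - X (k i) (x 0 i - z) - z%:C%C * c (k i) (x 0 i) else z%:C%C.
Definition eJ (J : {set 'I_d}) : R[i] :=
  \prod_i (if i \in J then 1 else - (Psi (k i) (x 0 i - 1) - c (k i) (x 0 i))).
Definition EJ (J : {set 'I_d}) : R[i] :=
  (N%:R^-1)%:C%C * (\sum_(nu < N) \prod_i uJ J i (zeta nu i))
    - \prod_i (VJ J i 1 - VJ J i 0).

Lemma VJ01 J i : VJ J i 1 - VJ J i 0 =
  if i \in J then X (k i) (x 0 i) - X (k i) (x 0 i - 1) - c (k i) (x 0 i) else 1.
Proof.
rewrite /VJ; case: ifP => _; last by rewrite subr0.
by rewrite subr0 subrr mul0r subr0 subr0 mul1r.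
Qed.

Lemma block_sum : block (digital_net R M) Psi X k x = \sum_(J : {set 'I_d}) eJ J * EJ J.
Proof.
have step (F : 'I_d -> R[i]) : \prod_i (F i - (Psi (k i) (x 0 i - 1) - c (k i) (x 0 i))) =
    \sum_(J : {set 'I_d}) eJ J * \prod_i (if i \in J then F i else 1).
  rewrite bigA_distr; apply: eq_bigr => J _; rewrite /eJ -big_split/=.
  by apply: eq_bigr => i _; case: ifP => _; rewrite ?mul1r ?mulr1.
rewrite /block.
have -> : \prod_i (X (k i) (x 0 i) - X (k i) (x 0 i - 1) - Psi (k i) (x 0 i - 1)) =
   \sum_(J : {set 'I_d}) eJ J * \prod_i (VJ J i 1 - VJ J i 0).
  transitivity (\prod_i ((X (k i) (x 0 i) - X (k i) (x 0 i - 1) - c (k i) (x 0 i)) - (Psi (k i) (x 0 i - 1) - c (k i) (x 0 i)))).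
    by apply: eq_bigr => i _; ring.
  by rewrite step; apply: eq_bigr => J _; congr (_ * _); apply: eq_bigr => i _; rewrite VJ01.
have -> : \sum_(z < N) \prod_i (Psi (k i) (x 0 i - zeta z i) - Psi (k i) (x 0 i - 1)) =
   \sum_(J : {set 'I_d}) eJ J * \sum_(nu < N) \prod_i uJ J i (zeta nu i).
  under [RHS]eq_bigr do rewrite mulr_sumr.
  rewrite exchange_big/=; apply: eq_bigr => z _.
  transitivity (\prod_i ((Psi (k i) (x 0 i - zeta z i) - c (k i) (x 0 i)) - (Psi (k i) (x 0 i - 1) - c (k i) (x 0 i)))).
    by apply: eq_bigr => i _; ring.
  by rewrite step.
rewrite mulr_sumr -sumrB; apply: eq_bigr => J _.
by rewrite mulrBr mulrCA.
Qed.

(** With no coordinate depending on the net, the average over the net and the volume term are both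
    1. This removes the one subset for which the distance to level n could not be summed. *)
Lemma EJ0 : EJ finset.set0 = 0.
Proof.
rewrite /EJ [X in _ - X]big1 => [|i _]; last by rewrite VJ01 inE.
rewrite (eq_bigr (fun=> 1)) => [|nu _]; last by rewrite big1// => i _; rewrite /uJ inE.
rewrite sumr_const card_ord fmorphV rmorph_nat mulVf ?subrr//.
by rewrite pnatr_eq0 -lt0n expn_gt0 prime_gt0.
Qed.

Definition wgt : R := \prod_i (1 + x 0 i ^+ 2).
(** What is left of the cubic decay after the weight is absorbed: concentration at the net point for
    i in J, at the face z = 1 otherwise. *)
Definition gJ (J : {set 'I_d}) i z : R :=
  eta (2 ^+ k i * (x 0 i - (if i \in J then z else 1))).
Definition YJ (J : {set 'I_d}) : R := N%:R^-1 * \sum_(nu < N) \prod_i gJ J i (zeta nu i).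
(** Majorant of the volume term: for i in J the kernel integrates to 2^-(k i) times concentration at
    the faces 0 and 1. *)
Definition ZJ (J : {set 'I_d}) : R :=
  \prod_i (if i \in J then (2 ^+ k i)^-1 * (eta (2 ^+ k i * x 0 i) + eta (2 ^+ k i * (x 0 i - 1)))
           else eta (2 ^+ k i * (x 0 i - 1))).

(** One of the three factors absorbs the weight: since 2^a >= 1 and z lies in [0, 1], it is at most
    [4 * eta y]. *)
Lemma weight_eta (a : nat) (y z : R) : 0 <= z <= 1 ->
  (1 + y ^+ 2) * eta (2 ^+ a * (y - z)) ^+ 3 <= 4 * eta (2 ^+ a * (y - z)).
Proof.
move=> /andP[z0 z1]; set e := eta (2 ^+ a * (y - z)).
have e0 : 0 <= e by exact: eta_ge0. have e1 : e <= 1 by exact: eta_le1.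
have h : eta (y - z) <= 4 * eta y.
  by apply: eta_near; rewrite normrN ger0_norm.
have h2 : e <= eta (y - z).
  rewrite /e -eta_norm -[leRHS]eta_norm ler_eta// normrM ler_peMl//.
  by rewrite ger0_norm ?exprn_ge0// exprn_ege1// ler1n.
have h3 : (1 + y ^+ 2) * e <= 4.
  have := ler_wpM2l (ltW (eta_den_gt0 y)) (le_trans h2 h).
  by rewrite mulrCA [eta y]/eta divff ?mulr1// gt_eqF// eta_den_gt0.
have -> : e ^+ 3 = e * (e * e) by ring.
rewrite mulrA; apply: ler_pM => //.
- by rewrite mulr_ge0// ltW// eta_den_gt0.
- by rewrite mulr_ge0.
- by rewrite ler_piMl.
Qed.

(** [4 * (1 + C)] is the price of the weight in one coordinate; the last factor is large enough for
    both cases of [blockJ_bound]. *)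
Definition A0 : R := 4 * (1 + C) * (2 + Cd b (1 + C)).

Let N0 : 0 < (N%:R : R). Proof. by rewrite ltr0n expn_gt0 prime_gt0. Qed.
Let C10 : 0 <= 1 + C. Proof. by rewrite addr_ge0. Qed.
Let bR1 : 1 <= bR. Proof. by rewrite ler1n prime_gt0. Qed.

Lemma gJ_ge0 J i z : 0 <= gJ J i z. Proof. exact: eta_ge0. Qed.

Lemma YJ_ge0 J : 0 <= YJ J.
Proof.
rewrite mulr_ge0 ?invr_ge0 ?(ltW N0)//; apply: sumr_ge0 => nu _.
by apply: prodr_ge0 => i _; exact: gJ_ge0.
Qed.

Lemma ZJ_ge0 J : 0 <= ZJ J.
Proof.
apply: prodr_ge0 => i _; case: ifP => _; last exact: eta_ge0.
by apply: mulr_ge0; [rewrite invr_ge0 exprn_ge0|apply: addr_ge0; exact: eta_ge0].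
Qed.

Definition thJ J i z : R := if i \in (J : {set 'I_d}) then eta (2 ^+ k i * (x 0 i - z)) ^+ 3 else 1.

Lemma thJ_ge0 J i z : 0 <= thJ J i z.
Proof. by rewrite /thJ; case: ifP => _ //; rewrite exprn_ge0 ?eta_ge0. Qed.

Lemma uJ_bound J i z : 0 <= z <= 1 -> normc (uJ J i z) <= (1 + C) * thJ J i z.
Proof.
move=> z01; rewrite /uJ /thJ; case: ifP => _; last by rewrite Normc.normc1 mulr1 lerDl.
rewrite (le_trans (K1 _ _ z01))// ler_wpM2r ?exprn_ge0 ?eta_ge0// lerDr//.
Qed.

Lemma weight_th J : normc (eJ J) * wgt * (N%:R^-1 * \sum_(nu < N) \prod_i thJ J i (zeta nu i)) <=
  (4 * (1 + C)) ^+ d * YJ J.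
Proof.
rewrite mulrCA [leRHS]mulrCA ler_wpM2l ?invr_ge0 ?(ltW N0)// !mulr_sumr.
apply: ler_sum => nu _; rewrite /eJ normc_prod /wgt -!big_split/=.
have -> : (4 * (1 + C)) ^+ d = \prod_(i < d) (4 * (1 + C)) by rewrite prodr_const card_ord.
rewrite -big_split/=; apply: ler_prod => i _.
have w0 : 0 <= 1 + x 0 i ^+ 2 by rewrite ltW// eta_den_gt0.
rewrite mulr_ge0 ?mulr_ge0 ?normc_ge0 ?thJ_ge0//= /thJ /gJ; case: ifP => _.
  rewrite Normc.normc1 mul1r (le_trans (weight_eta _ _ _))//.
    by have /andP[h1 /ltW h2] := @zeta01 R d b s n M pb nu i; rewrite h1.
  by rewrite ler_wpM2r ?eta_ge0// ler_peMr// lerDl.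
rewrite normcNE mulr1 mulrC.
have h11 : 0 <= (1 : R) <= 1 by rewrite ler01 lexx.
apply: (@le_trans _ _ ((1 + x 0 i ^+ 2) * (C * eta (2 ^+ k i * (x 0 i - 1)) ^+ 3))).
  by rewrite ler_wpM2l// K1.
have := ler_wpM2l C0 (weight_eta (k i) (x 0 i) h11).
have := eta_ge0 (2 ^+ k i * (x 0 i - 1)); lra.
Qed.

Lemma weight_V J : normc (eJ J) * wgt * normc (\prod_i (VJ J i 1 - VJ J i 0)) <=
  (4 * (1 + C)) ^+ d * ZJ J.
Proof.
rewrite /eJ !normc_prod /wgt -!big_split/=.
have -> : (4 * (1 + C)) ^+ d = \prod_(i < d) (4 * (1 + C)) by rewrite prodr_const card_ord.
rewrite -big_split/=; apply: ler_prod => i _.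
have w0 : 0 <= 1 + x 0 i ^+ 2 by rewrite ltW// eta_den_gt0.
rewrite mulr_ge0 ?mulr_ge0 ?normc_ge0//= VJ01.
have h11 : 0 <= (1 : R) <= 1 by rewrite ler01 lexx.
have h00 : 0 <= (0 : R) <= 1 by rewrite lexx ler01.
have W1 := weight_eta (k i) (x 0 i) h11.
have W0 := weight_eta (k i) (x 0 i) h00; rewrite subr0 in W0.
have e1 := eta_ge0 (2 ^+ k i * (x 0 i - 1)); have e0 := eta_ge0 (2 ^+ k i * x 0 i).
case: ifP => _.
  rewrite Normc.normc1 mul1r.
  have p0 : 0 <= (2 ^+ k i)^-1 :> R by rewrite invr_ge0 exprn_ge0.
  apply: (le_trans (ler_wpM2l w0 (K2 _ _))).
  have h := ler_wpM2l (mulr_ge0 C0 p0) (lerD W0 W1).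
  rewrite [leLHS](_ : _ = C * (2 ^+ k i)^-1 * ((1 + x 0 i ^+ 2) * eta (2 ^+ k i * x 0 i) ^+ 3 +
     (1 + x 0 i ^+ 2) * eta (2 ^+ k i * (x 0 i - 1)) ^+ 3)); last by ring.
  apply: (le_trans h).
  by have := mulr_ge0 p0 (addr_ge0 e0 e1); lra.
rewrite normcNE Normc.normc1 mulr1 mulrC.
apply: (@le_trans _ _ ((1 + x 0 i ^+ 2) * (C * eta (2 ^+ k i * (x 0 i - 1)) ^+ 3))).
  by rewrite ler_wpM2l// K1.
have := ler_wpM2l C0 W1; lra.
Qed.

Lemma CdE : 0 <= Cd b (1 + C).
Proof. by rewrite /Cd mulr_ge0 ?mulr_ge0 ?addr_ge0. Qed.

Lemma blockJ_bound J : normc (eJ J * EJ J) * wgt <=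
  (A0 * ((n - v) - KJ J).+2%:R) ^+ d * (bR ^+ ((n - v) - KJ J))^-1 * (YJ J + ZJ J).
Proof.
set L := ((n - v) - KJ J)%N.
have w0 : 0 <= wgt by apply: prodr_ge0 => i _; rewrite ltW// eta_den_gt0.
have ew0 : 0 <= normc (eJ J) * wgt by rewrite mulr_ge0 ?normc_ge0.
have Cd0 := CdE.
have L0 : 0 <= L.+2%:R :> R by rewrite ler0n.
have D0 : 0 <= 4 * (1 + C) by rewrite mulr_ge0.
rewrite Normc.normcM mulrAC.
have [hK|hK] := leqP (KJ J) (n - v).
  (* Outside J the factor is the constant 1 with exact primitive z, so frequency 0 and level 0 are
     assigned there and only J uses up levels. *)
  have core := @core_estimate R d b s n v M pb hM (uJ J) (VJ J) (thJ J)
    (fun i => if i \in J then k i else 0%N) (fun i => if i \in J then lev (k i) else 0%N) (1 + C) C10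
    (thJ_ge0 J) _ (uJ_bound J) _ L _.
  apply: (@le_trans _ _ (normc (eJ J) * wgt * ((L.+2%:R * Cd b (1 + C)) ^+ d * (bR ^+ L.+1)^-1 *
      (N%:R^-1 * \sum_(nu < N) \prod_i thJ J i (zeta nu i))))).
    rewrite ler_wpM2l//; apply: core.
    - by move=> i; case: ifP => _; [exact: lev2|rewrite expr0 expr1].
    - move=> i z1 z2 z z12 hz; rewrite /VJ /uJ /thJ; case: ifP => _ hb; last first.
        rewrite -rmorphB divff ?subrr ?Normc.normc0 ?mulr1.
          by rewrite mulr_ge0// mulr_ge0 ?exprn_ge0// subr_ge0 ltW.
        by apply/eqP => -[/eqP]; rewrite subr_eq0 gt_eqF.
      have nz : (z2 - z1)%:C%C != 0 :> R[i].
        by apply/eqP => -[/eqP]; rewrite subr_eq0 gt_eqF.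
      rewrite [X in normc X](_ : _ = (X (k i) (x 0 i - z1) - X (k i) (x 0 i - z2)) / (z2 - z1)%:C%C - Psi (k i) (x 0 i - z)).
        rewrite (le_trans (K3 _ z12 hz hb))// ler_wpM2r ?exprn_ge0 ?eta_ge0// ler_wpM2r ?lerDr//.
        by rewrite mulr_ge0 ?exprn_ge0// subr_ge0 ltW.
      by rewrite rmorphB/= in nz *; field.
    - by rewrite -big_mkcond/= -/(KJ J) subnKC.
  rewrite mulrCA; have h := weight_th J.
  have q0 : 0 <= (L.+2%:R * Cd b (1 + C)) ^+ d * (bR ^+ L.+1)^-1.
    by rewrite mulr_ge0 ?invr_ge0 ?exprn_ge0 ?mulr_ge0 ?(le_trans ler01 bR1).
  apply: (le_trans (ler_wpM2l q0 h)).
  rewrite mulrA; apply: ler_pM; rewrite ?YJ_ge0 ?lerDl ?ZJ_ge0//.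
    by rewrite mulr_ge0// exprn_ge0.
  rewrite mulrAC -exprMn; apply: ler_pM; rewrite ?invr_ge0 ?exprn_ge0 ?mulr_ge0 ?(le_trans ler01 bR1)//.
    have le1 : L.+2%:R * Cd b (1 + C) * (4 * (1 + C)) <= A0 * L.+2%:R.
      rewrite /A0 mulrC [L.+2%:R * _]mulrC mulrA.
      by apply: (ler_wpM2r L0); apply: (ler_wpM2l D0); rewrite lerDr.
    apply: lerXn2r le1; rewrite nnegrE; first by apply: mulr_ge0 => //; apply: mulr_ge0.
    by apply: mulr_ge0 => //; apply: mulr_ge0 => //; apply: addr_ge0.
  rewrite lef_pV2 ?posrE ?exprn_gt0 ?(lt_le_trans ltr01 bR1)//.
  by rewrite exprS ler_peMl ?exprn_ge0 ?(le_trans ler01 bR1).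
(* Beyond level n - v no cancellation is available: the average over the net and the volume term are
   bounded separately. *)
have -> : L = 0%N by apply/eqP; rewrite subn_eq0 ltnW.
rewrite expr0 invr1 mulr1.
have hE : normc (EJ J) <= (1 + C) ^+ d * (N%:R^-1 * \sum_(nu < N) \prod_i thJ J i (zeta nu i)) +
    normc (\prod_i (VJ J i 1 - VJ J i 0)).
  rewrite (le_trans (normcB _ _))// lerD2r Normc.normcM normc_real ger0_norm ?invr_ge0 ?(ltW N0)//.
  rewrite mulrCA ler_wpM2l ?invr_ge0 ?(ltW N0)// (le_trans (normc_sum _ _ _))// mulr_sumr.
  apply: ler_sum => nu _; rewrite normc_prod.
  have -> : (1 + C) ^+ d = \prod_(i < d) (1 + C) by rewrite prodr_const card_ord.
  rewrite -big_split/=; apply: ler_prod => i _; rewrite normc_ge0 uJ_bound//.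
  by have /andP[h1 /ltW h2] := @zeta01 R d b s n M pb nu i; rewrite h1.
apply: (le_trans (ler_wpM2l ew0 hE)); rewrite mulrDr mulrDr; apply: lerD.
  rewrite mulrCA; apply: (le_trans (ler_wpM2l (exprn_ge0 _ C10) (weight_th J))).
  rewrite mulrA -exprMn ler_wpM2r ?YJ_ge0// lerXn2r ?nnegrE ?mulr_ge0 ?addr_ge0//.
  rewrite /A0 mulrC.
  have -> : 4 * (1 + C) * (2 + Cd b (1 + C)) * 2 = 4 * (1 + C) * (4 + 2 * Cd b (1 + C)) by ring.
  rewrite ler_wpM2l//.
  have : 1 + C <= Cd b (1 + C).
    rewrite /Cd -mulrA ler_peMr// mulr_ege1// lerDl (le_trans ler01 bR1)//.
  by have := CdE; lra.
apply: (le_trans (weight_V J)); rewrite ler_wpM2r ?ZJ_ge0// lerXn2r ?nnegrE ?mulr_ge0 ?addr_ge0//.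
have -> : A0 * 2 = 4 * (1 + C) * (4 + 2 * Cd b (1 + C)) by rewrite /A0; ring.
by apply: (ler_peMr D0); have := CdE; lra.
Qed.

Lemma YJ_sup J : YJ J <= (16 * pi) ^+ d * (bR ^+ minn (KJ J) (n - v))^-1.
Proof.
pose g i z : R := if i \in J then eta (2 ^+ k i * (x 0 i - z)) else 1.
apply: (@le_trans _ _ (N%:R^-1 * \sum_(nu < N) \prod_i g i (zeta nu i))).
  rewrite ler_wpM2l ?invr_ge0 ?(ltW N0)//; apply: ler_sum => nu _; apply: ler_prod => i _.
  apply/andP; split; first exact: gJ_ge0.
  by rewrite /gJ /g; case: ifP => _; [exact: lexx|exact: eta_le1].
have -> : KJ J = (\sum_i (if i \in J then lev (k i) else 0))%N by rewrite /KJ big_mkcond.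
apply: (theta_sup pb hM).
  by move=> i z; rewrite /g; case: ifP => _ //; exact: eta_ge0.
move=> i j; rewrite /g; case: ifP => _ hj.
  apply: (eta_levels pb); apply: le_trans (lev1 (k i)).
  by rewrite ler_weXn2l.
move: hj; rewrite leqn0 => /eqP ->.
exists (fun=> 1); split => //.
rewrite expn0 big_ord1; have := @pi_ge2 R; lra.
Qed.

Lemma ZJ_sup J : ZJ J <= 2 ^+ d * (bR ^+ minn (KJ J) (n - v))^-1.
Proof.
have b0 : 0 < bR := lt_le_trans ltr01 bR1.
apply: (@le_trans _ _ (2 ^+ d * (bR ^+ KJ J)^-1)); last first.
  rewrite ler_wpM2l ?exprn_ge0// lef_pV2 ?posrE ?exprn_gt0//.
  by rewrite ler_weXn2l// geq_minl.
have -> : 2 ^+ d * (bR ^+ KJ J)^-1 = \prod_i (2 * (if i \in J then (bR ^+ lev (k i))^-1 else 1)).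
  rewrite big_split/= prodr_const card_ord; congr (_ * _).
  by rewrite /KJ -big_mkcond/= prodfV prodrXr.
apply: ler_prod => i _; case: ifP => _; last first.
  by rewrite eta_ge0 mulr1 (le_trans (eta_le1 _))// ler1n.
have p0 : 0 < (2 ^+ k i)^-1 :> R by rewrite invr_gt0 exprn_gt0.
have e1 := eta_le1 (2 ^+ k i * (x 0 i - 1)); have e0 := eta_le1 (2 ^+ k i * x 0 i).
have f1 := eta_ge0 (2 ^+ k i * (x 0 i - 1)); have f0 := eta_ge0 (2 ^+ k i * x 0 i).
apply/andP; split; first by apply: mulr_ge0; [exact: ltW|exact: addr_ge0].
rewrite mulrC; apply: ler_pM; [exact: addr_ge0|exact: ltW|lra|].
by rewrite lef_pV2 ?posrE ?exprn_gt0//; exact: lev1.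
Qed.

End BlockBound.

(** * Counting frequencies *)

Section Counting.
Context {R : realType}.

Lemma ler_sum_uniq_sub (T : eqType) (s1 s2 : seq T) (f : T -> R) :
  (forall x, 0 <= f x) -> uniq s1 -> {subset s1 <= s2} ->
  \sum_(x <- s1) f x <= \sum_(x <- s2) f x.
Proof.
move=> f0; elim: s1 s2 => [|x s1 ih] s2.
  by move=> _ _; rewrite big_nil; apply: sumr_ge0 => i _; exact: f0.
move=> /= /andP[xs us] sub; have x2 : x \in s2 by apply: sub; rewrite mem_head.
rewrite big_cons (perm_big _ (perm_to_rem x2)) big_cons lerD2l; apply: ih => // y ys.
have : y \in s2 by apply: sub; rewrite in_cons ys orbT.
rewrite (perm_mem (perm_to_rem x2)) in_cons => /orP[/eqP yx|//].
by rewrite -yx ys in xs.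
Qed.

Lemma sum_iota (f : nat -> R) m : \sum_(x <- iota 0 m) f x = \sum_(x < m) f x.
Proof. by rewrite -(big_mkord xpredT) /index_iota subn0. Qed.

Section Levels.
Variables (b : nat) (h : nat -> nat).
Hypotheses (b0 : (0 < b)%N) (h_step : forall a, (h a < h (a + b))%N).

Let h_inj p i j : (i < j)%N -> (h (b * i + p) < h (b * j + p))%N.
Proof.
elim: j => // j ih; have e : (b * j.+1 + p = b * j + p + b)%N by rewrite mulnS; lia.
rewrite e ltnS leq_eqVlt => /orP[/eqP ->|/ih lt].
  exact: h_step.
exact: (ltn_trans lt).
Qed.

(* [h] takes each value at most [b] times: split by residues mod [b]. *)
Lemma level_sum (f : nat -> R) B K : (forall x, 0 <= f x) ->
  (forall s, uniq s -> \sum_(x <- s) f x <= B) ->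
  \sum_(a < K) f (h a) <= b%:R * B.
Proof.
move=> f0 fB; pose s p := [seq h (b * i + p) | i <- iota 0 K].
have us p : uniq (s p).
  rewrite map_inj_uniq ?iota_uniq// => i j; case: (ltngtP i j) => // /(h_inj p) + e.
    by rewrite e ltnn.
  by rewrite e ltnn.
apply: (@le_trans _ _ (\sum_(p < b) \sum_(x <- s p) f x)); last first.
  apply: (@le_trans _ _ (\sum_(p < b) B)); first by apply: ler_sum => p _; exact: fB.
  by rewrite sumr_const card_ord mulr_natl.
have -> : \sum_(p < b) \sum_(x <- s p) f x =
    \sum_(a <- flatten [seq [seq (b * i + p)%N | i <- iota 0 K] | p : 'I_b]) f (h a).
  rewrite big_flatten/= big_map big_enum/=.
  by apply: eq_bigr => p _; rewrite /s !big_map.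
rewrite -(sum_iota (fun a => f (h a))).
apply: ler_sum_uniq_sub; [by move=> x; exact: f0|exact: iota_uniq|].
move=> a; rewrite mem_iota/= add0n => aK; apply/flattenP.
exists [seq (b * i + a %% b)%N | i <- iota 0 K].
  by apply/mapP; exists (Ordinal (ltn_pmod a b0)); rewrite ?mem_enum.
apply/mapP; exists (a %/ b)%N; last by rewrite mulnC -divn_eq.
by rewrite mem_iota/= add0n (leq_ltn_trans (leq_div _ _)).
Qed.

End Levels.

Variable (g : R).
Hypothesis g01 : 0 < g < 1.
Local Notation G := ((1 - g)^-1).

Let g0 : 0 <= g. Proof. by case/andP: g01 => /ltW. Qed.
Let gG : g * G = G - 1.
Proof.
case/andP: g01 => _ g1; have h : 1 - g != 0 by rewrite subr_eq0 gt_eqF.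
by field.
Qed.
Let G1 : 1 <= G.
Proof.
case/andP: g01 => g0' g1; rewrite -[leLHS]invr1 lef_pV2 ?posrE ?subr_gt0//; lra.
Qed.

Lemma geo_sum_le m : \sum_(x < m) g ^+ x <= G.
Proof.
elim: m => [|m ih]; first by rewrite big_ord0 (le_trans ler01).
rewrite big_ord_recl expr0 (eq_bigr (fun i : 'I_m => g * g ^+ i)) => [|i _]; last by rewrite lift0 exprS.
rewrite -mulr_sumr; have := ler_wpM2l g0 ih; rewrite gG; lra.
Qed.

Lemma geo_rev_sum_le m : \sum_(x < m) g ^+ (m - x) <= G.
Proof.
elim: m => [|m ih]; first by rewrite big_ord0 (le_trans ler01).
rewrite big_ord_recr/= subSnn expr1.
have -> : \sum_(i < m) g ^+ (m.+1 - i) = g * \sum_(i < m) g ^+ (m - i).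
  by rewrite mulr_sumr; apply: eq_bigr => i _; rewrite subSn ?exprS// ltnW.
have := ler_wpM2l g0 ih; rewrite gG; case/andP: g01; lra.
Qed.

Let sub_iota (s : seq nat) n : {subset s <= iota 0 (n + (\max_(x <- s) x).+1)}.
Proof.
move=> x xs; rewrite mem_iota/= add0n addnS ltnS (leq_trans _ (leq_addl _ _))//.
by rewrite (big_rem x)//= leq_maxl.
Qed.

(** Indices below n contribute 1 each; this is the source of every factor n in the frequency
    count. *)
Lemma geo_trunc_sum (s : seq nat) n : uniq s -> \sum_(x <- s) g ^+ (x - n) <= n%:R + G.
Proof.
move=> us; have h x : 0 <= g ^+ (x - n) by exact: exprn_ge0.
apply: (le_trans (ler_sum_uniq_sub h us (@sub_iota s n))).
rewrite sum_iota big_split_ord/=; apply: lerD.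
  rewrite (eq_bigr (fun=> 1)) ?sumr_const ?card_ord// => i _.
  by move: (ltnW (ltn_ord i)); rewrite -subn_eq0 => /eqP ->; rewrite expr0.
by under eq_bigr do rewrite addKn; exact: geo_sum_le.
Qed.

Lemma geo_dist_sum (s : seq nat) n : uniq s ->
  \sum_(x <- s) g ^+ ((x - n) + (n - x)) <= 2 * G.
Proof.
move=> us; have h x : 0 <= g ^+ ((x - n) + (n - x)) by exact: exprn_ge0.
apply: (le_trans (ler_sum_uniq_sub h us (@sub_iota s n))).
rewrite sum_iota big_split_ord/= mulr_natl mulr2n; apply: lerD.
  rewrite (eq_bigr (fun i : 'I_n => g ^+ (n - i))) ?geo_rev_sum_le// => i _.
  by move: (ltnW (ltn_ord i)); rewrite -subn_eq0 => /eqP ->; rewrite add0n.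
under eq_bigr do rewrite addKn subnDA subnn sub0n addn0.
exact: geo_sum_le.
Qed.

End Counting.

Section BoxCount.
Context {R : realType}.
Variables (d b : nat) (h : nat -> nat).
Hypotheses (b0 : (0 < b)%N) (h_step : forall a, (h a < h (a + b))%N).

(* Decay exponent of the block [k]: the frequencies outside [J], plus the distance of the b-adic
   level of those in [J] from the level n of the net. *)
Definition gap n (J : {set 'I_d}) (k : 'I_d -> nat) : nat :=
  let T := (\sum_(i in J) h (k i))%N in (\sum_(i in ~: J) k i + ((T - n) + (n - T)))%N.

(** Writing tau = g^d provides one copy of the decay for each coordinate. *)
Lemma root_lt1 (tau : R) : 0 < tau < 1 -> (0 < d)%N ->
  exists g : R, 0 < g < 1 /\ tau = g ^+ d.
Proof.
move=> /andP[t0 t1] d0; exists (tau `^ (d%:R^-1)); split.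
  have h1 : tau `^ (d%:R^-1) < 1 `^ (d%:R^-1).
    apply: gt0_ltr_powR => //; rewrite ?nnegrE ?(ltW t0)//.
    by rewrite invr_gt0 ltr0n.
  by rewrite powR1 in h1; rewrite powR_gt0.
by rewrite -powR_mulrn ?powR_ge0// -powRrM mulVf ?pnatr_eq0 -?lt0n// powRr1// ltW.
Qed.

Section Fixed.
Variables (g : R) (n K : nat) (J : {set 'I_d}) (i0 : 'I_d).
Hypotheses (g01 : 0 < g < 1) (iJ : i0 \in J).
Local Notation G := ((1 - g)^-1).

Let g0 : 0 <= g. Proof. by case/andP: g01 => /ltW. Qed.

(** The part of the gap visible from one coordinate: its excess over level n for i in J, the
    frequency itself otherwise. *)
Definition side i a : nat := if i \in J then (h a - n)%N else a.

(** Of the d copies of the gap, the one of [i0] keeps the distance to level n, and each other copy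
    pays for its own coordinate. *)
Lemma gap_split (k : 'I_d -> nat) : (\sum_(i | i != i0) side i (k i) +
  (let T := (\sum_(i in J) h (k i)) in (T - n) + (n - T)) <= d * gap n J k)%N.
Proof.
rewrite /gap/=; set T := (\sum_(i in J) h (k i))%N; set S := (\sum_(i in ~: J) k i)%N.
set D := ((T - n) + (n - T))%N.
have -> : (d * (S + D) = \sum_(i < d) (S + D))%N by rewrite sum_nat_const card_ord.
rewrite [X in (_ <= X)%N](bigD1 i0)//= addnC leq_add//; first exact: leq_addl.
apply: leq_sum => i _; rewrite /side; case: ifP => iJ'.
  apply: leq_trans (leq_addl _ _); apply: leq_trans (leq_addr _ _).
  by apply: leq_sub2r; rewrite /T (bigD1 i)//= leq_addr.
apply: leq_trans (leq_addr _ _).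
by rewrite /S (bigD1 i) ?leq_addr//= inE iJ'.
Qed.

(** With the other coordinates fixed, the sum over the coordinate [i0] of J is geometric around
    level n, hence bounded; each remaining coordinate contributes O(n). This gives the exponent d -
    1. *)
Lemma box_sum_J : \sum_(k : {ffun 'I_d -> 'I_K}) (g ^+ d) ^+ gap n J (fun i => k i) <=
  (b%:R * (n%:R + G)) ^+ d.-1 * (b%:R * (2 * G)).
Proof.
(* A base frequency 0 is needed below; for K = 0 the sum is empty, which is settled at the end. *)
case: K => [|K']; last first.
pose T (k : {ffun 'I_d -> 'I_K'.+1}) := (\sum_(i in J) h (k i))%N.
have [p0 p1] : 0 <= G /\ G <= b%:R * (n%:R + G).
  have G0 : 0 <= G by case/andP: g01 => ? /ltW; rewrite invr_ge0 subr_ge0.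
  split => //; apply: (@le_trans _ _ (n%:R + G)); first by rewrite lerDr.
  by rewrite ler_peMl ?addr_ge0// ler1n.
apply: (@le_trans _ _ (\sum_(k : {ffun 'I_d -> 'I_K'.+1})
    (\prod_(i | i != i0) g ^+ side i (k i)) * g ^+ ((T k - n) + (n - T k)))).
  apply: ler_sum => k _; rewrite -exprM prodrXr -exprD.
  by apply: ler_wiXn2l => //; [case/andP: g01 => _ /ltW|exact: gap_split].
have b01 : (0 : R) < b%:R by rewrite ltr0n.
(* Frequencies are grouped by the representative with coordinate [i0] reset to 0; [u k] runs through
   the class of k. *)
pose u (k : {ffun 'I_d -> 'I_K'.+1}) a := [ffun i => if i == i0 then a else k i].
rewrite (partition_big (fun k => u k ord0) (fun k => k i0 == ord0))/=; last first.
  by move=> k _; rewrite ffunE eqxx.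
apply: (@le_trans _ _ (\sum_(k : {ffun 'I_d -> 'I_K'.+1} | k i0 == ord0)
   (\prod_(i | i != i0) g ^+ side i (k i)) * (b%:R * (2 * G)))).
  apply: ler_sum => k /eqP k0.
  rewrite (reindex_onto (u k) (fun k' => k' i0)); last first.
    move=> k' /eqP <-; apply/ffunP => i; rewrite !ffunE; case: eqP => // ->//.
  apply: (@le_trans _ _ (\sum_(a < K'.+1) (\prod_(i | i != i0) g ^+ side i (k i)) *
      g ^+ ((T (u k a) - n) + (n - T (u k a))))).
    rewrite big_mkcond/=; apply: ler_sum => a _; case: ifP => _.
      rewrite (eq_bigr (fun i => g ^+ side i (k i)))// => i /negPf h'.
      by rewrite ffunE h'.
    by rewrite mulr_ge0 ?exprn_ge0//; apply: prodr_ge0 => i _; exact: exprn_ge0.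
  rewrite -mulr_sumr; apply: ler_wpM2l; first by apply: prodr_ge0 => i _; exact: exprn_ge0.
  pose T' := (\sum_(i in J | i != i0) h (k i))%N.
  have TE a : T (u k a) = (h a + T')%N.
    rewrite /T (bigD1 i0)//= ffunE eqxx; congr addn.
    by apply: eq_bigr => i /andP[_ /negPf h']; rewrite ffunE h'.
  under eq_bigr do rewrite TE.
  have st a : (h a + T' < h (a + b) + T')%N by rewrite ltn_add2r.
  apply: (@level_sum R b (fun a => h a + T')%N b0 st (fun x => g ^+ ((x - n) + (n - x))) (2 * G) K'.+1).
  - by move=> x; exact: exprn_ge0.
  - by move=> s us; exact: geo_dist_sum.
rewrite -mulr_suml; apply: ler_wpM2r.
  by rewrite mulr_ge0 ?(ltW b01)// mulr_ge0.
(* The constraint k i0 = 0 becomes a factor of the product, so the sum over k splits into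
   one-dimensional sums. *)
pose f i (a : 'I_K'.+1) : R := if i == i0 then (a == ord0)%:R else g ^+ side i a.
have f0 i a : 0 <= f i a by rewrite /f; case: ifP => _; [exact: ler0n|exact: exprn_ge0].
apply: (@le_trans _ _ (\sum_(k : {ffun 'I_d -> 'I_K'.+1}) \prod_i f i (k i))).
  rewrite [leLHS]big_mkcond/=; apply: ler_sum => k _; case: ifP => [/eqP k0|_].
    rewrite [leRHS](bigD1 i0)//= /f eqxx k0 eqxx mul1r.
    by rewrite le_eqVlt; apply/orP; left; apply/eqP; apply: eq_bigr => i /negPf ->.
  by apply: prodr_ge0 => i _; exact: f0.
rewrite -bigA_distr_bigA (bigD1 i0)//= {1}/f eqxx.
have -> : \sum_(a < K'.+1) (a == ord0)%:R = 1 :> R.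
  by rewrite (bigD1 ord0)//= big1 ?addr0// => a /negPf ->.
rewrite mul1r.
have -> : (b%:R * (n%:R + G)) ^+ d.-1 = \prod_(i < d | i != i0) (b%:R * (n%:R + G)).
  by rewrite prodr_const cardC1 card_ord.
apply: ler_prod => i /negPf ii0; rewrite sumr_ge0//= /f ii0 /side; case: (i \in J).
  apply: (@level_sum R b h b0 h_step (fun x => g ^+ (x - n)) (n%:R + G) K'.+1).
    by move=> x; exact: exprn_ge0.
  by move=> s us; exact: geo_trunc_sum.
exact: (le_trans (geo_sum_le g01 _)).
rewrite big1; last first.
  move=> k; by have := ltn_ord (k i0); rewrite ltn0.
have G0 : 0 <= G by case/andP: g01 => ? /ltW; rewrite invr_ge0 subr_ge0.
by rewrite mulr_ge0 ?exprn_ge0 ?mulr_ge0 ?addr_ge0.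
Qed.

End Fixed.

Lemma gap_count (tau : R) : 0 < tau < 1 -> (0 < d)%N -> exists C : R, 0 < C /\
  forall n K, \sum_(k : {ffun 'I_d -> 'I_K}) \sum_(J : {set 'I_d} | J != finset.set0)
    tau ^+ gap n J (fun i => k i) <= C * n.+1%:R ^+ d.-1.
Proof.
move=> t01 d0; have [g [g01 ->]] := root_lt1 t01 d0.
set G := (1 - g)^-1; have G0 : 0 <= G by case/andP: g01 => ? /ltW; rewrite invr_ge0 subr_ge0.
pose B : R := (b%:R * (1 + G)) ^+ d.-1 * (b%:R * (2 * G)).
have B0 : 0 <= B by rewrite mulr_ge0 ?exprn_ge0 ?mulr_ge0 ?addr_ge0.
exists (1 + #|{set 'I_d}|%:R * B); split; first by rewrite ltr_wpDr// mulr_ge0.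
move=> n K; rewrite exchange_big/=.
apply: (@le_trans _ _ (\sum_(J : {set 'I_d}) B * n.+1%:R ^+ d.-1)); last first.
  have P0 : 0 <= n.+1%:R ^+ d.-1 :> R by exact: exprn_ge0.
  by rewrite sumr_const -[leLHS]mulr_natl mulrA (ler_wpM2r P0)// lerDr.
rewrite big_mkcond/=; apply: ler_sum => J _; case: ifPn => [/set0Pn[i0 iJ]|_]; last first.
  by rewrite mulr_ge0 ?exprn_ge0.
apply: (le_trans (box_sum_J n K g01 iJ)); rewrite -/G /B mulrAC -exprMn.
apply: ler_wpM2r; first by rewrite !mulr_ge0.
apply: lerXn2r; rewrite ?nnegrE ?mulr_ge0 ?addr_ge0//.
rewrite -mulrA; apply: ler_wpM2l => //; rewrite -natr1 mulrDl mul1r mulrDr mulr1 .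
have := mulr_ge0 G0 (ler0n R n); lra.
Qed.

End BoxCount.

(** * Power means *)

Section PowerMeans.
Context {R : realType}.
Implicit Types (x y s : R).

(** Young's inequality for x and 1, with exponent s and its conjugate. *)
Lemma bernoulli_powR x s : 0 <= x -> 1 <= s -> 1 + s * (x - 1) <= x `^ s.
Proof.
move=> x0; rewrite le_eqVlt => /predU1P[<-|s1].
  by rewrite powRr1// mul1r; lra.
have s0 : 0 < s by lra.
have t0 : 0 < 1 - s^-1 by rewrite subr_gt0 invf_lt1.
have := @conjugate_powR R x 1 s (1 - s^-1)^-1 x0 ler01 s0.
rewrite invr_gt0 => /(_ t0); rewrite invrK addrC subrK => /(_ erefl).
rewrite mulr1 powR1 mul1r -(ler_pM2r s0) mulrDl divfK ?gt_eqF// mulrBl mulVf ?gt_eqF//.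
by lra.
Qed.

Lemma weighted_jensen (T : Type) (r : seq T) (c a : T -> R) (Q s : R) :
  1 <= s -> 0 < Q -> (forall k, 0 < c k) -> (forall k, 0 <= a k) ->
  \sum_(k <- r) c k <= Q ->
  (\sum_(k <- r) a k) `^ s <= Q `^ (s - 1) * \sum_(k <- r) c k `^ (1 - s) * a k `^ s.
Proof.
move=> s1 Q0 c0 a0 cQ; set A := \sum_(k <- r) a k.
have A0 : 0 <= A by apply: sumr_ge0 => k _; exact: a0.
have s0 : s != 0 by rewrite gt_eqF//; lra.
have [->|An] := eqVneq A 0.
  rewrite powR0//; apply: mulr_ge0; first exact: powR_ge0.
  by apply: sumr_ge0 => k _; rewrite mulr_ge0// powR_ge0.
have Ap : 0 < A by rewrite lt_neqAle eq_sym An.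
have AQ0 : 0 <= A / Q by rewrite divr_ge0// ltW.
have -> : A `^ s = Q `^ (s - 1) * ((A / Q) `^ s * Q).
  rewrite powRM ?invr_ge0 ?(ltW Q0)//.
  rewrite [_ * _ * Q]mulrC mulrA.
  have -> : Q `^ (s - 1) * Q = Q `^ s.
    by rewrite mulrC mulr_powRB1 ?(ltW Q0)//; lra.
  by rewrite mulrCA -powRM ?invr_ge0 ?(ltW Q0)// divff ?gt_eqF// powR1 mulr1.
apply: ler_wpM2l; first exact: powR_ge0.
(* Bernoulli at u = a Q / (c A). Summed over k the bracket is (1 - s) times the sum of c, plus s Q;
   as 1 - s <= 0, the hypothesis that c sums to at most Q makes this at least Q. *)
have hk k : (A / Q) `^ s * (c k * (1 - s) + s * (a k * Q / A)) <= c k `^ (1 - s) * a k `^ s.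
  pose u := a k * Q / (c k * A).
  have u0 : 0 <= u by rewrite /u divr_ge0 ?mulr_ge0 ?(ltW Q0) ?(ltW (c0 k)) ?a0.
  have -> : c k * (1 - s) + s * (a k * Q / A) = c k * (1 + s * (u - 1)).
    rewrite /u; field; by rewrite An gt_eqF ?c0.
  have -> : c k `^ (1 - s) * a k `^ s = (A / Q) `^ s * (c k * u `^ s).
    have -> : a k = (A / Q) * u * c k.
      rewrite /u; field; by rewrite An !gt_eqF ?c0.
    have ck := ltW (c0 k).
    rewrite (powRM s (mulr_ge0 AQ0 u0) ck) (powRM s AQ0 u0).
    have cs : c k `^ (1 - s) * c k `^ s = c k.
      rewrite -powRD; last by rewrite (gt_eqF (c0 k)) implybT.
      by rewrite subrK powRr1.
    by rewrite mulrCA cs; ring.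
  apply: ler_wpM2l; first exact: powR_ge0.
  by apply: ler_wpM2l; [exact: ltW|exact: bernoulli_powR].
apply: le_trans (ler_sum _ (fun k _ => hk k)).
rewrite -mulr_sumr; apply: ler_wpM2l; first exact: powR_ge0.
rewrite big_split/= -mulr_suml -mulr_sumr.
under [X in _ + _ * X]eq_bigr do rewrite -mulrA.
rewrite -mulr_suml -/A [A * _]mulrC divfK ?gt_eqF//.
have := ler_wnM2r (_ : 1 - s <= 0) cQ; rewrite subr_le0 => /(_ s1); lra.
Qed.

Lemma card_jensen (I : finType) (a : I -> R) (s : R) :
  1 <= s -> (forall k, 0 <= a k) ->
  (\sum_k a k) `^ s <= (1 + #|I|%:R) `^ (s - 1) * \sum_k a k `^ s.
Proof.
move=> s1 a0; apply: (le_trans (@weighted_jensen I (index_enum I) (fun=> 1) a (1 + #|I|%:R) s _ _ _ _ _)) => //.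
  by rewrite sumr_const lerDr.
by under [X in _ * X <= _]eq_bigr do rewrite powR1 mul1r.
Qed.

(** Linearises the concave power at the expected size B of y, where both terms equal B^t; afterwards
    only the integral of y is needed. *)
Lemma powR_le_affine (y B t : R) : 0 <= y -> 0 < B -> 0 < t -> t <= 1 ->
  y `^ t <= B `^ (t - 1) * y + B `^ t.
Proof.
move=> y0 B0 t0 t1; have [yB|By] := leP y B.
  rewrite ler_wpDl ?mulr_ge0 ?powR_ge0// ge0_ler_powR ?nnegrE ?(ltW t0)//.
  exact: ltW.
rewrite ler_wpDr ?powR_ge0//.
have yp : 0 < y := lt_trans B0 By.
have -> : y `^ t = y `^ (t - 1) * y.
  by rewrite mulrC mulr_powRB1.
apply: ler_wpM2r => //; rewrite -(opprB 1 t) !powRN lef_pV2 ?posrE ?powR_gt0//.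
by rewrite ge0_ler_powR ?nnegrE ?subr_ge0 ?(ltW B0) ?(ltW By)// ltW.
Qed.

(** From 1 + y <= exp y with y = e x / D; it absorbs the factors L + 2 of the telescoping. *)
Lemma poly_le_expR (D e : R) : 0 < D -> 0 < e ->
  exists C : R, 0 < C /\ forall x, 0 <= x -> (x + 2) `^ D <= C * expR (e * x).
Proof.
move=> D0 e0; exists ((2 + D / e) `^ D).
have h0 : 0 < 2 + D / e by rewrite addr_gt0// divr_gt0.
split; first exact: powR_gt0.
move=> x x0; have -> : expR (e * x) = expR (e / D * x) `^ D.
  rewrite /powR gt_eqF ?expR_gt0// expRK; congr expR; field; exact: lt0r_neq0.
rewrite -powRM ?expR_ge0 ?(ltW h0)// ge0_ler_powR ?nnegrE ?(ltW D0)//.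
- by rewrite addr_ge0.
- by rewrite mulr_ge0 ?expR_ge0 ?(ltW h0).
have h := expR_ge1Dx (e / D * x).
apply: le_trans (ler_wpM2l (ltW h0) h).
have -> : (2 + D / e) * (1 + e / D * x) = 2 + D / e + 2 * (e / D * x) + x.
  field; by rewrite !gt_eqF.
have := divr_gt0 D0 e0; have := mulr_ge0 (ltW (divr_gt0 e0 D0)) x0; lra.
Qed.

End PowerMeans.

Section UnmeasuredIntegral.
Context d (T : measurableType d) (R : realType) (mu : {measure set T -> \bar R}).

(** The integral of a nonnegative function is a supremum over the simple functions below it, so no
    measurability is asked for. It is applied to the integrand of the quasi-norm. *)
Lemma ge0_integral_monotone (f g : T -> \bar R) :
  (forall x, (0 <= f x)%E) -> (forall x, (f x <= g x)%E) ->
  (\int[mu]_x f x <= \int[mu]_x g x)%E.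
Proof.
move=> f0 fg; rewrite !ge0_integralTE//; last by move=> x; exact: le_trans (fg x).
apply: ereal_sup_le => _ [h hf <-]; exists h => // x.
exact: le_trans (hf x) (fg x).
Qed.

End UnmeasuredIntegral.

(** * Balance of the exponents of 2 and b *)

Section Exponents.
Context {R : realType}.
Variables (d b v : nat) (A m r : R).
Hypotheses (d0 : (0 < d)%N) (b2 : (1 < b)%N) (A_ge0 : 0 <= A) (m1 : 1 <= m) (r0 : 0 < r) (rm : r * m < 1).
Local Notation bR := (b%:R : R).
Local Notation t := (ln 2 : R).
Local Notation B := (ln bR : R).

Let t0 : 0 < t. Proof. by rewrite ln_gt0// ltr1n. Qed.
Let tB : t <= B. Proof. by rewrite ler_ln ?posrE ?ltr0n ?ler_nat// ltnW. Qed.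
Let bE j : bR ^+ j = expR (j%:R * B).
Proof. by rewrite expRM_natl lnK// posrE ltr0n ltnW. Qed.
Let twoE j : 2 ^+ j = expR (j%:R * t) :> R.
Proof. by rewrite expRM_natl lnK// posrE. Qed.
Let expRpow (x y : R) : expR x `^ y = expR (y * x).
Proof. by rewrite /powR gt_eqF ?expR_gt0// expRK. Qed.

(** Logarithmic form, with nn = n - v and vv = v. The two alternatives are T <= n - v, where D = L
    and the margin is r m, and T >= n - v, where D is the excess and the margin is 1 - r m; [de] is
    below both. *)
Lemma exponent_ineq (de : R) (kJ kc T L ka D nn vv : R) : 0 <= de -> de <= r * m -> de <= 1 - r * m ->
  T * B <= kJ * t -> 0 <= kc -> 0 <= L -> 0 <= D -> 0 <= vv ->
  (T = ka /\ nn = ka + L /\ D = L) \/ (L = 0 /\ nn = ka /\ T = ka + D) ->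
  r * m * (kJ + kc) * t - m * (L * B) - (m - 1) * (ka * B) - (kJ + kc) * t + de * t / 2 * L <=
  (r - 1) * (nn + vv) * m * B + m * vv * B - de * t / 2 * (kc + D).
Proof.
move=> de0 de1 de2 hT kc0 L0 D0 v0 hc.
have rm0 : 0 <= r * m by apply: le_trans de1.
have t_ge0 : 0 <= t := ltW t0; have B0 : 0 <= B := le_trans t_ge0 tB.
have h1 : 0 <= (1 - r * m) * (kJ * t - T * B) by apply: mulr_ge0; lra.
have ht : de * t <= r * m * B by apply: ler_pM => //; exact: ltW.
have ht2 : de * t <= (1 - r * m) * B by apply: ler_pM => //; exact: ltW.
have h2 : 0 <= L * (r * m * B - de * t) by apply: mulr_ge0; lra.
have h3 : 0 <= kc * t * (1 - r * m - de) by apply: mulr_ge0; [exact: mulr_ge0|lra].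
have h4 : 0 <= kc * t * de by rewrite !mulr_ge0.
have h5 : 0 <= D * ((1 - r * m) * B - de * t) by apply: mulr_ge0; lra.
have h5' : 0 <= D * (de * t) by rewrite !mulr_ge0.
have h6 : 0 <= r * m * vv * B by rewrite (mulr_ge0 (mulr_ge0 rm0 v0)).
by case: hc => [[e1 [e2 e3]]|[e1 [e2 e3]]]; subst; lra.
Qed.

(** Here kJ and kc stand for the total frequency inside and outside J, and T for the level [KJ]. The
    left side multiplies the smoothness weight, the m-th power of the block factor, the supremum
    factor and the L_1 gain. *)
Lemma exponent_bound : exists C0 tau : R, [/\ 0 < C0, 0 < tau < 1 & forall n kJ kc T : nat,
  (v <= n)%N -> bR ^+ T <= 2 ^+ kJ ->
  2 `^ (r * m * (kJ + kc)%:R) *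
    (((A * (n - v - T).+2%:R) ^+ d * (bR ^+ (n - v - T))^-1) `^ m *
     (2 * (16 * pi) ^+ d * (bR ^+ minn T (n - v))^-1) `^ (m - 1)) * (2 ^+ (kJ + kc))^-1 <=
  C0 * bR `^ ((r - 1) * n%:R * m) * tau ^+ (kc + ((T - (n - v)) + (n - v - T)))].
Proof.
pose de := Num.min (r * m) (1 - r * m).
have m0 : 0 < m := lt_le_trans ltr01 m1.
have rm0 : 0 < r * m by exact: mulr_gt0.
have de0 : 0 < de by rewrite lt_min rm0 subr_gt0.
have de1 : de <= r * m by rewrite ge_min lexx.
have de2 : de <= 1 - r * m by rewrite ge_min lexx orbT.
have dm0 : 0 < d%:R * m by rewrite mulr_gt0 ?ltr0n.
have e0 : 0 < de * t / 2 by rewrite divr_gt0// mulr_gt0.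
(* Half of the rate [de] absorbs the polynomial (L + 2)^(d m); the other half remains as tau. *)
have [C1 [C10 hC1]] := poly_le_expR dm0 e0.
pose c1 := (A ^+ d) `^ m; pose c2 := (2 * (16 * pi) ^+ d : R) `^ (m - 1).
have c10 : 0 <= c1 by exact: powR_ge0.
have c20 : 0 <= c2 by exact: powR_ge0.
have p0 : 0 <= (16 * pi) ^+ d :> R by rewrite exprn_ge0 ?mulr_ge0 ?pi_ge0.
exists ((c1 * c2 + 1) * C1 * expR (m * v%:R * B)), (expR (- (de * t / 2))); split.
- by rewrite !mulr_gt0 ?expR_gt0// ltr_wpDl ?mulr_ge0.
- by rewrite expR_gt0/= -[ltRHS](@expR0 R) ltr_expR oppr_lt0.
move=> n kJ kc T vn hT; set L := (n - v - T)%N; set ka := minn T (n - v); set D := (_ + L)%N.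
have hT' : T%:R * B <= kJ%:R * t by rewrite -ler_expR -bE -twoE.
have -> : ((A * L.+2%:R) ^+ d * (bR ^+ L)^-1) `^ m = c1 * (L%:R + 2) `^ (d%:R * m) * expR (- (m * (L%:R * B))).
  have -> : L.+2%:R = L%:R + 2 :> R by rewrite -addn2 natrD.
  have L2 : 0 <= L%:R + 2 :> R by rewrite addr_ge0.
  have l1 : 0 <= A ^+ d by exact: exprn_ge0.
  have l2 : 0 <= (L%:R + 2) ^+ d :> R by exact: exprn_ge0.
  have l3 : 0 <= (bR ^+ L)^-1 by rewrite invr_ge0 exprn_ge0.
  rewrite exprMn (powRM m (mulr_ge0 l1 l2) l3) (powRM m l1 l2) -/c1; congr (_ * _ * _).
    by rewrite powRrM powR_mulrn.
  by rewrite bE -expRN expRpow mulrN.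
have -> : (2 * (16 * pi) ^+ d * (bR ^+ ka)^-1) `^ (m - 1) = c2 * expR (- ((m - 1) * (ka%:R * B))).
  have l3 : 0 <= (bR ^+ ka)^-1 by rewrite invr_ge0 exprn_ge0.
  have l4 : 0 <= 2 * (16 * pi) ^+ d :> R by rewrite mulr_ge0.
  by rewrite (powRM (m - 1) l4 l3) bE -expRN expRpow mulrN.
have -> : 2 `^ (r * m * (kJ + kc)%:R) = expR (r * m * (kJ%:R + kc%:R) * t) :> R.
  by rewrite /powR pnatr_eq0/= natrD.
have -> : (2 ^+ (kJ + kc))^-1 = expR (- ((kJ%:R + kc%:R) * t)) :> R by rewrite twoE natrD expRN.
have -> : bR `^ ((r - 1) * n%:R * m) = expR ((r - 1) * n%:R * m * B).
  by rewrite /powR gt_eqF// ltr0n ltnW.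
have -> : expR (- (de * t / 2)) ^+ (kc + D) = expR (- (de * t / 2 * (kc%:R + D%:R))).
  by rewrite -expRM_natl natrD; congr expR; ring.
have L0 : 0 <= L%:R :> R by [].
have hL := hC1 _ L0.
have key : c1 * c2 * (L%:R + 2) `^ (d%:R * m) <= (c1 * c2 + 1) * C1 * expR (de * t / 2 * L%:R).
  rewrite -[leRHS]mulrA; apply: ler_pM => //; [exact: mulr_ge0|by rewrite lerDl].
set E1 := expR (r * m * (kJ%:R + kc%:R) * t); set E2 := expR (- (m * (L%:R * B))).
set E3 := expR (- ((m - 1) * (ka%:R * B))); set E4 := expR (- ((kJ%:R + kc%:R) * t)).
rewrite [leLHS](_ : _ = c1 * c2 * (L%:R + 2) `^ (d%:R * m) * (E1 * E2 * E3 * E4)); last by ring.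
have E0 : 0 <= E1 * E2 * E3 * E4 by rewrite !mulr_ge0 ?expR_ge0.
apply: (le_trans (ler_wpM2r E0 key)).
have K0 : 0 <= (c1 * c2 + 1) * C1 by rewrite mulr_ge0 ?addr_ge0 ?mulr_ge0// ltW.
rewrite -[leLHS]mulrA -!(mulrA ((c1 * c2 + 1) * C1)); apply: (ler_wpM2l K0).
rewrite /E1 /E2 /E3 /E4 -!expRD ler_expR.
have nE : n%:R = (n - v)%:R + v%:R :> R by rewrite -natrD subnK.
have := @exponent_ineq de kJ%:R kc%:R T%:R L%:R ka%:R D%:R (n - v)%:R v%:R (ltW de0) de1 de2 hT'
  (ler0n _ _) (ler0n _ _) (ler0n _ _) (ler0n _ _); rewrite -nE => H.
rewrite [leRHS](_ : _ = (r - 1) * n%:R * m * B + m * v%:R * B - de * t / 2 * (kc%:R + D%:R)); last by ring.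
apply: le_trans (H _); first by rewrite le_eqVlt; apply/orP; left; apply/eqP; ring.
rewrite /L /ka /D; have [h|h] := leqP T (n - v).
  left; split; [by []|split; first by rewrite -natrD subnKC].
  by move: h; rewrite -subn_eq0 => /eqP ->; rewrite add0n.
have e : (n - v - T = 0)%N by apply/eqP; rewrite subn_eq0 ltnW.
by right; rewrite /L e; split=> //; split=> //; rewrite addn0 -natrD subnKC// ltnW.
Qed.

End Exponents.

Section IntegralBound.
Context dT (T : measurableType dT) (R : realType) (mu : {measure set T -> \bar R}).
Implicit Types (f g : T -> R).

(** Integrability travels with the bound, because a real-valued integral is 0 when the extended one
    is infinite. *)
Definition rbound f (c : R) : Prop :=
  mu.-integrable setT (EFin \o f) /\ \int[mu]_x f x <= c.

Lemma rboundD f g c e : rbound f c -> rbound g e -> rbound (fun x => f x + g x) (c + e).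
Proof.
move=> [if_ hf] [ig hg]; split; first exact: rintegrableD.
by rewrite RintegralD// lerD.
Qed.

Lemma rboundZ a f c : 0 <= a -> rbound f c -> rbound (fun x => a * f x) (a * c).
Proof.
move=> a0 [if_ hf]; split; first exact: rintegrableZ.
by rewrite RintegralZl// ler_wpM2l.
Qed.

Lemma rbound_le f c e : c <= e -> rbound f c -> rbound f e.
Proof. by move=> ce [if_ hf]; split=> //; exact: le_trans hf ce. Qed.

Lemma rbound_sum (I : Type) (s : seq I) (P : pred I) (F : I -> T -> R) (c : I -> R) :
  (forall i, P i -> rbound (F i) (c i)) ->
  rbound (fun x => \sum_(i <- s | P i) F i x) (\sum_(i <- s | P i) c i).
Proof.
move=> h; elim: s => [|i s ih].
  rewrite big_nil; under eq_fun do rewrite big_nil; split; first exact: integrable0.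
  by rewrite Rintegral_cst// mul0r.
rewrite big_cons; under eq_fun do rewrite big_cons; case: ifPn => // Pi.
by apply: rboundD => //; exact: h.
Qed.

Lemma rbound_ereal f c : (forall x, 0 <= f x) -> rbound f c ->
  (\int[mu]_x (f x)%:E <= c%:E)%E.
Proof.
move=> f0 [if_ hf]; have fin := integrable_fin_num measurableT if_.
by rewrite -(fineK fin) lee_fin.
Qed.

End IntegralBound.

(** * Weighted m-th powers of the blocks *)

Section BlockPower.
Context {R : realType}.
Local Notation mu := (@lebesgue_measure R).
Variables (d b s n v : nat) (M : 'I_d -> 'M['F_b]_(s, n)).
Hypotheses (pb : prime b) (hM : order_net 1 v M).
Local Notation bR := (b%:R : R).
Local Notation N := (b ^ n)%N.
Variables (Psi X c : nat -> R -> R[i]) (C : R).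
Hypotheses (C0 : 0 <= C)
  (K1 : forall k x z, 0 <= z <= 1 -> normc (Psi k (x - z) - c k x) <= C * eta (2 ^+ k * (x - z)) ^+ 3)
  (K2 : forall k x, normc (X k x - X k (x - 1) - c k x) <=
       C * (2 ^+ k)^-1 * (eta (2 ^+ k * x) ^+ 3 + eta (2 ^+ k * (x - 1)) ^+ 3))
  (K3 : forall k x z1 z2 z, z1 < z2 -> z1 <= z <= z2 -> 2 ^+ k * (z2 - z1) <= bR ->
       normc ((X k (x - z1) - X k (x - z2)) / (z2 - z1)%:C%C - Psi k (x - z)) <=
       C * (2 ^+ k * (z2 - z1)) * eta (2 ^+ k * (x - z)) ^+ 3).

Lemma eta_scale_rbound (a : nat) (z : R) :
  rbound mu (fun y => eta (2 ^+ a * (y - z))) (pi * (2 ^+ a)^-1).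
Proof.
have p0 : 0 < 2 ^+ a :> R by exact: exprn_gt0.
have E : (fun y : R => eta (2 ^+ a * (y - z))) = (fun y => eta (2 ^+ a * y + (- (2 ^+ a * z)))).
  by apply/funext => y; congr eta; ring.
rewrite E; split; first exact: integrable_eta_scale.
by rewrite Rintegral_eta_scale.
Qed.

Lemma tensor_rbound (A : 'I_d -> R -> R) (e : 'I_d -> R) :
  (forall i x, 0 <= A i x) -> (forall i, rbound mu (A i) (e i)) ->
  rbound (lebesgue R d) (fun t => \prod_i A i (row_of t 0 i)) (\prod_i e i).
Proof.
move=> A0 h; have [h1 h2] := @tensor_integral R d A (fun i => (h i).1).
have E : (fun t => \prod_i A i (row_of t 0 i)) = (fun t : d.-tuple (measurableTypeR R) => \prod_i A i (tnth t i)).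
  by apply/funext => t; apply: eq_bigr => i _; rewrite row_ofE.
rewrite E; split => //; rewrite h2; apply: ler_prod => i _; rewrite (h i).2 andbT.
by apply: Rintegral_ge0 => x _; exact: A0.
Qed.

(** Every factor, inside or outside J, is concentrated on a scale 2^-(k i) in its own variable, so
    the integral gains 2^-|k|. *)
Lemma YZ_rbound k J : rbound (lebesgue R d) (fun t => YJ M k (row_of t) J + ZJ k (row_of t) J)
  (2 * (2 * pi) ^+ d * (2 ^+ (\sum_i k i))^-1).
Proof.
have pi0 : 0 <= (pi : R) by exact: pi_ge0.
have PE (a : R) : a ^+ d * (2 ^+ (\sum_i k i))^-1 = \prod_i (a * (2 ^+ k i)^-1).
  by rewrite big_split/= prodr_const card_ord prodfV prodrXr.
have N0 : 0 < (N%:R : R) by rewrite ltr0n expn_gt0 prime_gt0.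
rewrite -mulrA mulr_natl mulr2n; apply: rboundD.
  apply: (@rbound_le _ _ _ _ _ (N%:R^-1 * \sum_(nu < N) (pi ^+ d * (2 ^+ (\sum_i k i))^-1))).
    rewrite sumr_const card_ord -[X in _ * X]mulr_natl mulKf ?gt_eqF//.
    apply: ler_wpM2r; first by rewrite invr_ge0 exprn_ge0.
    by apply: lerXn2r; rewrite ?nnegrE ?mulr_ge0//; lra.
  apply: rboundZ; first by rewrite invr_ge0 ltW.
  apply: rbound_sum => nu _; rewrite PE.
  apply: (@tensor_rbound (fun i y => eta (2 ^+ k i * (y - (if i \in J then digital_net R M nu 0 i else 1))))).
    by move=> i y; exact: eta_ge0.
  by move=> i; exact: eta_scale_rbound.
rewrite PE; apply: (@tensor_rbound (fun i y => if i \in J then (2 ^+ k i)^-1 * (eta (2 ^+ k i * y) + eta (2 ^+ k i * (y - 1)))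
           else eta (2 ^+ k i * (y - 1)))).
  move=> i y; case: ifP => _; last exact: eta_ge0.
  by apply: mulr_ge0; [rewrite invr_ge0 exprn_ge0|apply: addr_ge0; exact: eta_ge0].
move=> i; have q0 : 0 <= (2 ^+ k i)^-1 :> R by rewrite invr_ge0 exprn_ge0.
have q1 : (2 ^+ k i)^-1 <= 1 :> R by rewrite invf_le1 ?exprn_gt0// exprn_ege1// ler1n.
have pq : 0 <= pi * (2 ^+ k i)^-1 :> R by exact: mulr_ge0.
case: (i \in J); last by apply: (rbound_le _ (eta_scale_rbound _ _)); lra.
apply: (@rbound_le _ _ _ _ _ ((2 ^+ k i)^-1 * (pi * (2 ^+ k i)^-1 + pi * (2 ^+ k i)^-1))).
  have := ler_wpM2r pq q1; lra.
apply: rboundZ => //; apply: rboundD; last exact: eta_scale_rbound.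
by have := eta_scale_rbound (k i) 0; under [X in rbound _ X _]eq_fun do rewrite subr0.
Qed.

Definition block_factor (k : {ffun 'I_d -> nat}) (J : {set 'I_d}) : R := (A0 b C * ((n - v) - KJ b k J).+2%:R) ^+ d * (bR ^+ ((n - v) - KJ b k J))^-1.
Definition sup_factor (k : {ffun 'I_d -> nat}) (J : {set 'I_d}) : R := 2 * (16 * pi) ^+ d * (bR ^+ minn (KJ b k J) (n - v))^-1.

Definition wblock (k : {ffun 'I_d -> nat}) (x : 'rV[R]_d) : R := normc (block (digital_net R M) Psi X k x) * wgt x.

Lemma wgt_ge0 (x : 'rV[R]_d) : 0 <= wgt x.
Proof. by apply: prodr_ge0 => i _; rewrite ltW// eta_den_gt0. Qed.

Lemma A0_ge0 : 0 <= A0 b C.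
Proof. by rewrite /A0 !mulr_ge0 ?addr_ge0// CdE. Qed.

Lemma block_factor_ge0 k J : 0 <= block_factor k J.
Proof. by rewrite mulr_ge0 ?invr_ge0 ?exprn_ge0// mulr_ge0// A0_ge0. Qed.

(** U^m <= sup^(m-1) U keeps one power of U = Y + Z, whose integral is explicit, and uses the
    supremum for the rest. Jensen handles the sum over J, where the empty set drops out. *)
Lemma wblock_powR (m : R) k x : 1 <= m -> wblock k x `^ m <=
  \sum_(J : {set 'I_d} | J != finset.set0)
    (1 + #|{set 'I_d}|%:R) `^ (m - 1) * (block_factor k J `^ m * sup_factor k J `^ (m - 1)) *
    (YJ M k x J + ZJ k x J).
Proof.
move=> m1; have m0 : 0 < m by lra.
pose a J := normc (eJ Psi c k x J * EJ M Psi X c k x J) * wgt x.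
have a0 J : 0 <= a J by rewrite mulr_ge0 ?normc_ge0 ?wgt_ge0.
have aE : a finset.set0 = 0 by rewrite /a (EJ0 _ pb) mulr0 Normc.normc0 mul0r.
have le_a : wblock k x <= \sum_J a J.
  rewrite /wblock (block_sum M Psi X c) -mulr_suml; apply: ler_wpM2r; first exact: wgt_ge0.
  exact: normc_sum.
have w0 : 0 <= wblock k x by rewrite mulr_ge0 ?normc_ge0 ?wgt_ge0.
have s0 : 0 <= \sum_J a J by apply: sumr_ge0 => J _.
apply: (@le_trans _ _ ((\sum_J a J) `^ m)).
  by apply: ge0_ler_powR => //; exact: ltW.
apply: (le_trans (card_jensen m1 a0)).
rewrite (bigD1 finset.set0)//= aE powR0 ?gt_eqF// add0r mulr_sumr.
apply: ler_sum => J _; rewrite -mulrA; apply: ler_wpM2l; first exact: powR_ge0.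
set U := YJ _ _ _ _ + _.
have U0 : 0 <= U by rewrite addr_ge0 ?YJ_ge0 ?ZJ_ge0.
have US : U <= sup_factor k J.
  rewrite /sup_factor -mulrA mulr_natl mulr2n; apply: lerD; first exact: YJ_sup hM _ _ _.
  apply: (le_trans (ZJ_sup n v pb k x J)); apply: ler_wpM2r.
    by rewrite invr_ge0 exprn_ge0.
  have := @pi_ge2 R => pi2; apply: lerXn2r; rewrite ?nnegrE ?mulr_ge0 ?pi_ge0//; lra.
have aU : a J <= block_factor k J * U by exact: (blockJ_bound pb hM C0 K1 K2 K3 k x J).
apply: (@le_trans _ _ ((block_factor k J * U) `^ m)).
  apply: ge0_ler_powR => //; [exact: ltW|exact: (a0 J)|].
  by rewrite nnegrE mulr_ge0 ?block_factor_ge0.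
rewrite (powRM m (block_factor_ge0 k J) U0) -mulrA; apply: ler_wpM2l; first exact: powR_ge0.
rewrite -(mulr_powRB1 U0 m0) [leLHS]mulrC; apply: ler_wpM2r => //.
apply: ge0_ler_powR => //; first by lra.
by rewrite nnegrE (le_trans U0 US).
Qed.

Hypothesis d0 : (0 < d)%N.

Definition dominator (m r : R) (k : {ffun 'I_d -> nat}) (x : 'rV[R]_d) : R :=
  2 `^ (r * m * (\sum_i k i)%:R) * \sum_(J : {set 'I_d} | J != finset.set0)
    (1 + #|{set 'I_d}|%:R) `^ (m - 1) * (block_factor k J `^ m * sup_factor k J `^ (m - 1)) *
    (YJ M k x J + ZJ k x J).

Lemma dominator_rbound m r (B tau : R) k : 0 <= B -> 0 <= tau ->
  (forall kJ kc T : nat, bR ^+ T <= 2 ^+ kJ ->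
  2 `^ (r * m * (kJ + kc)%:R) *
    (((A0 b C * (n - v - T).+2%:R) ^+ d * (bR ^+ (n - v - T))^-1) `^ m *
     (2 * (16 * pi) ^+ d * (bR ^+ minn T (n - v))^-1) `^ (m - 1)) * (2 ^+ (kJ + kc))^-1 <=
  B * tau ^+ (kc + ((T - (n - v)) + (n - v - T)))) ->
  rbound (lebesgue R d) (fun t => dominator m r k (row_of t))
    ((1 + #|{set 'I_d}|%:R) `^ (m - 1) * (2 * (2 * pi) ^+ d) * B *
     \sum_(J : {set 'I_d} | J != finset.set0) tau ^+ gap (lev b) (n - v) J k).
Proof.
move=> B0 t0 hB; set Q := _ `^ (m - 1); set P := 2 * _ ^+ d.
have Q0 : 0 <= Q by exact: powR_ge0.
have P0 : 0 <= P by rewrite mulr_ge0 ?exprn_ge0 ?mulr_ge0 ?pi_ge0.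
pose e J := 2 `^ (r * m * (\sum_i k i)%:R) * (Q * (block_factor k J `^ m * sup_factor k J `^ (m - 1)) *
  (P * (2 ^+ (\sum_i k i))^-1)).
apply: (@rbound_le _ _ _ _ _ (\sum_(J : {set 'I_d} | J != finset.set0) e J)).
  rewrite mulr_sumr; apply: ler_sum => J _.
  have kE : (\sum_i k i = \sum_(i in J) k i + \sum_(i in ~: J) k i)%N.
    rewrite (bigID (mem J))/=; congr addn; apply: eq_bigl => i; by rewrite inE.
  have hJ : bR ^+ KJ b k J <= 2 ^+ (\sum_(i in J) k i).
    rewrite /KJ -!prodrXr; apply: ler_prod => i _; rewrite exprn_ge0//=; exact: lev1.
  have := hB _ (\sum_(i in ~: J) k i)%N _ hJ; rewrite -kE -/(block_factor k J) -/(sup_factor k J) => h.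
  rewrite /e [leLHS](_ : _ = Q * P * (2 `^ (r * m * (\sum_i k i)%:R) *
    (block_factor k J `^ m * sup_factor k J `^ (m - 1)) * (2 ^+ (\sum_i k i))^-1)); last by ring.
  by rewrite -[leRHS]mulrA; apply: ler_wpM2l => //; exact: mulr_ge0.
rewrite -mulr_sumr; apply: rboundZ; first exact: powR_ge0.
apply: rbound_sum => J _; apply: rboundZ; last exact: YZ_rbound.
by rewrite !mulr_ge0 ?powR_ge0.
Qed.

End BlockPower.

(** * Summation over the dyadic blocks *)

Section Boxes.
Variable d : nat.

(** Increasing boxes of frequencies; every finite set of frequencies lies in one, so the infinite
    sum is the supremum over boxes. *)
Definition box_seq K : seq {ffun 'I_d -> nat} :=
  map (fun k : {ffun 'I_d -> 'I_K} => [ffun i => val (k i)]) (index_enum _).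

Lemma mem_box_seq K k : (k \in box_seq K) = [forall i, (k i < K)%N].
Proof.
apply/mapP/forallP => [[k' _ ->] i|h]; first by rewrite ffunE ltn_ord.
exists [ffun i => Ordinal (h i)]; first exact: mem_index_enum.
by apply/ffunP => i; rewrite !ffunE.
Qed.

Lemma box_seq_uniq K : uniq (box_seq K).
Proof.
rewrite map_inj_uniq ?index_enum_uniq// => k1 k2 /ffunP e.
by apply/ffunP => i; apply/val_inj; have := e i; rewrite !ffunE.
Qed.

Lemma box_seq_sub K L : (K <= L)%N -> {subset box_seq K <= box_seq L}.
Proof.
move=> KL k; rewrite !mem_box_seq => /forallP h; apply/forallP => i.
exact: leq_trans (h i) KL.
Qed.

Lemma box_seq_cover (s : seq {ffun 'I_d -> nat}) : exists K, {subset s <= box_seq K}.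
Proof.
elim: s => [|k s [K hK]]; first by exists 0%N.
exists (maxn K (\max_i (k i)).+1) => k'; rewrite in_cons => /predU1P[->|/hK].
  rewrite mem_box_seq; apply/forallP => i; rewrite leq_max; apply/orP; right.
  by rewrite ltnS leq_bigmax.
by apply: box_seq_sub; exact: leq_maxl.
Qed.

End Boxes.

Section NormBound.
Context {R : realType} (d : nat).
Local Notation TR := (measurableTypeR R).
Local Notation ld := (lebesgue R d).
Local Notation K := {ffun 'I_d -> nat}.
Variables (p q m bm Q e : R) (cc : K -> R) (D a : K -> 'rV[R]_d -> R).
Hypotheses (p1 : 1 <= p) (q1 : 1 <= q) (pm : p <= m) (qm : q <= m)
  (bm0 : 0 < bm) (Q0 : 0 < Q) (e0 : 0 <= e) (cc0 : forall k, 0 < cc k)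
  (ccQ : forall L, \sum_(k <- box_seq d L) cc k <= Q)
  (a0 : forall k x, 0 <= a k x)
  (aD : forall k x, (a k x * wgt x `^ q) `^ (m / q) <= D k x)
  (DE : forall k, rbound ld (fun t => D k (row_of t)) (e * bm * cc k `^ (m / q))).

Let p0 : 0 < p := lt_le_trans ltr01 p1.
Let q0 : 0 < q := lt_le_trans ltr01 q1.
Let m0 : 0 < m := lt_le_trans p0 pm.
Let s1 : 1 <= m / q. Proof. by rewrite ler_pdivlMr ?mul1r. Qed.
Let D0 k x : 0 <= D k x. Proof. exact: le_trans (powR_ge0 _ _) (aD k x). Qed.

Definition major L x : R := Q `^ (m / q - 1) * \sum_(k <- box_seq d L) cc k `^ (1 - m / q) * D k x.
(** Up to the factor e, the bound on the integral of [major]; it is the point B at which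
    [powR_le_affine] is applied. *)
Definition envelope_scale : R := bm * Q `^ (m / q).
(* Bounds the L_p integrand through the L_m norm of the weighted one, m = max p q: Young's
   inequality turns the exponent p / m into 1 at the cost of the integrable term [teta]. *)
Definition envelope L x : R := envelope_scale `^ (p / m - 1) * major L x + envelope_scale `^ (p / m) * teta x.

Let B0 : 0 < envelope_scale. Proof. by rewrite mulr_gt0 ?powR_gt0. Qed.

Lemma major_ge0 L x : 0 <= major L x.
Proof.
rewrite mulr_ge0 ?powR_ge0//; apply: sumr_ge0 => k _.
by rewrite mulr_ge0 ?powR_ge0.
Qed.

Lemma envelope_ge0 L x : 0 <= envelope L x.
Proof.
apply: addr_ge0; apply: mulr_ge0; rewrite ?powR_ge0//; [exact: major_ge0|exact: teta_ge0].
Qed.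

Lemma envelope_homo x : {homo envelope^~ x : L1 L2 / (L1 <= L2)%N >-> L1 <= L2}.
Proof.
move=> L1 L2 L12; rewrite lerD2r; apply: ler_wpM2l; first exact: powR_ge0.
apply: ler_wpM2l; first exact: powR_ge0.
apply: ler_sum_uniq_sub; [|exact: box_seq_uniq|exact: box_seq_sub].
by move=> k; rewrite mulr_ge0 ?powR_ge0.
Qed.

Lemma envelope_rbound L : rbound ld (fun t => envelope L (row_of t)) ((e + pi ^+ d) * envelope_scale `^ (p / m)).
Proof.
rewrite mulrDl; apply: rboundD; last first.
  by rewrite [pi ^+ d * _]mulrC; apply: rboundZ; [exact: powR_ge0|have [h1 h2] := @teta_integral R d; split => //; rewrite h2].
have -> : e * envelope_scale `^ (p / m) = envelope_scale `^ (p / m - 1) * (e * envelope_scale).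
  by rewrite mulrCA; congr (_ * _); rewrite [RHS]mulrC mulr_powRB1 ?(ltW B0)// divr_gt0.
apply: rboundZ; first exact: powR_ge0.
apply: (@rbound_le _ _ _ _ _ (Q `^ (m / q - 1) * \sum_(k <- box_seq d L) cc k `^ (1 - m / q) * (e * bm * cc k `^ (m / q)))).
  (* The Jensen weights match the decay of the dominators: the powers cancel to [cc k], whose sum is
     at most Q. *)
  have ek k : cc k `^ (1 - m / q) * (e * bm * cc k `^ (m / q)) = e * bm * cc k.
    rewrite mulrCA -powRD; last by rewrite (gt_eqF (cc0 k)) implybT.
    by rewrite subrK powRr1// ltW.
  under eq_bigr do rewrite ek.
  rewrite -mulr_sumr mulrCA /envelope_scale [leRHS]mulrA; apply: ler_wpM2l; first by rewrite mulr_ge0// ltW.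
  have m_gt0 : 0 < m / q by rewrite divr_gt0.
  rewrite -(mulr_powRB1 (ltW Q0) m_gt0) [leLHS]mulrC; apply: ler_wpM2r; [exact: powR_ge0|exact: ccQ].
apply: rboundZ; first exact: powR_ge0.
by apply: rbound_sum => k _; apply: rboundZ; first exact: powR_ge0.
Qed.

Lemma wgt_teta (x : 'rV[R]_d) : wgt x * teta x = 1.
Proof.
rewrite /wgt /teta -big_split/= big1// => i _.
by rewrite /eta divff// gt_eqF// eta_den_gt0.
Qed.

Lemma box_pointwise L x : (\sum_(k <- box_seq d L) a k x) `^ (p / q) <= envelope L x.
Proof.
have w0 : 0 <= wgt x by apply: prodr_ge0 => i _; rewrite ltW// eta_den_gt0.
have t0 := teta_ge0 x.
set A := \sum_(k <- _) _.
have A0 : 0 <= A by apply: sumr_ge0 => k _; exact: a0.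
pose a' k := a k x * wgt x `^ q.
have a'0 k : 0 <= a' k by rewrite mulr_ge0 ?powR_ge0.
have J := @weighted_jensen R _ (box_seq d L) cc a' Q (m / q) s1 Q0 cc0 a'0 (ccQ L).
have maj : (\sum_(k <- box_seq d L) a' k) `^ (m / q) <= major L x.
  apply: (le_trans J); apply: ler_wpM2l; first exact: powR_ge0.
  by apply: ler_sum => k _; apply: ler_wpM2l; [exact: powR_ge0|exact: aD].
have a'E : \sum_(k <- box_seq d L) a' k = A * wgt x `^ q by rewrite mulr_suml.
rewrite a'E in maj; set y := (A * wgt x `^ q) `^ (m / q).
have y0 : 0 <= y by exact: powR_ge0.
have th0 : 0 < p / m by rewrite divr_gt0.
have th1 : p / m <= 1 by rewrite ler_pdivrMr ?mul1r.
have Y := @powR_le_affine R y envelope_scale (p / m) y0 B0 th0 th1.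
(* As [wgt x * teta x = 1], the factor [teta x] to the power p removes the weight exactly. *)
have yE : y `^ (p / m) * teta x `^ p = A `^ (p / q).
  rewrite /y -powRrM; have -> : m / q * (p / m) = p / q.
    by field; rewrite !gt_eqF.
  rewrite (powRM (p / q) A0 (powR_ge0 _ _)) -powRrM.
  have -> : q * (p / q) = p by field; rewrite gt_eqF.
  by rewrite -mulrA -powRM// wgt_teta powR1 mulr1.
rewrite -yE; have tp0 : 0 <= teta x `^ p := powR_ge0 _ _.
apply: (le_trans (ler_wpM2r tp0 Y)); rewrite mulrDl; apply: lerD.
  rewrite -mulrA; apply: ler_wpM2l; first exact: powR_ge0.
  rewrite -[leRHS]mulr1; apply: ler_pM => //.
  have := @ge0_ler_powR R p (ltW p0) (teta x) 1; rewrite !nnegrE powR1; apply => //.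
  exact: teta_le1.
apply: ler_wpM2l; first exact: powR_ge0.
rewrite -[leRHS](powRr1 t0).
have tp : 0 < teta x by rewrite lt_neqAle eq_sym t0 andbT; apply/eqP => h; have := wgt_teta x; rewrite h mulr0 => /eqP; rewrite eq_sym oner_eq0.
by apply: ger_powR => //; rewrite tp teta_le1.
Qed.

Lemma Lnorm_bound : (Lnorm ld p%:E (fun t =>
    poweR (\esum_(k in [set: K]) (a k (row_of t))%:E) q^-1) <=
  (((e + pi ^+ d) * envelope_scale `^ (p / m)) `^ p^-1)%:E)%E.
Proof.
pose F t := poweR (\esum_(k in [set: K]) (a k (row_of t))%:E) q^-1.
(* The monotone limit of the envelopes is a majorant of the L_p integrand, and its integral is
   bounded by monotone convergence. *)
pose U t := limn (fun L => (envelope L (row_of t))%:E).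
have mE L : measurable_fun setT (fun t => (envelope L (row_of t))%:E).
  exact: measurable_int (envelope_rbound L).1.
have ndE t : {homo (fun L => (envelope L (row_of t))%:E) : L1 L2 / (L1 <= L2)%N >-> (L1 <= L2)%E}.
  by move=> L1 L2 h; rewrite lee_fin; exact: envelope_homo.
have cvE t := ereal_nondecreasing_cvgn (ndE t).
have leU L t : ((envelope L (row_of t))%:E <= U t)%E.
  by rewrite /U (cvg_lim _ (cvE t))//; apply: ereal_sup_ubound; exists L.
have U0 t : (0 <= U t)%E by apply: le_trans (leU 0%N t); rewrite lee_fin envelope_ge0.
have es0 t : (0 <= \esum_(k in [set: K]) (a k (row_of t))%:E)%E.
  by apply: esum_ge0 => k _; rewrite lee_fin.
have pq0 : 0 < q / p by rewrite divr_gt0.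
have in0 (u : \bar R) : (0 <= u)%E -> u \in `[0%E, +oo%E].
  by move=> u0; rewrite in_itv/= u0 leey.
have esU t : (\esum_(k in [set: K]) (a k (row_of t))%:E <= poweR (U t) (q / p))%E.
  apply: ge_ereal_sup => _ [A [fA _] <-]; rewrite fsbig_finite//=.
  have [L hL] := @box_seq_cover d (finmap.enum_fset (fset_set A)).
  rewrite sumEFin; apply: (@le_trans _ _ (\sum_(k <- box_seq d L) a k (row_of t))%:E).
    by rewrite lee_fin; apply: ler_sum_uniq_sub => //; exact: finmap.fset_uniq.
  set S := \sum_(k <- _) _; have S0 : 0 <= S by apply: sumr_ge0.
  have -> : S%:E = poweR (S `^ (p / q))%:E (q / p).
    rewrite poweR_EFin -powRrM; congr EFin.
    have -> : p / q * (q / p) = 1 by field; rewrite !gt_eqF.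
    by rewrite powRr1.
  apply: gt0_ler_poweR; [exact: ltW|by apply: in0; rewrite lee_fin powR_ge0|exact: in0|].
  by apply: le_trans (leU L t); rewrite lee_fin; exact: box_pointwise.
have FU t : (poweR `|F t| p <= U t)%E.
  have F0 : (0 <= F t)%E by exact: poweR_ge0.
  rewrite gee0_abs//; have qi : 0 <= q^-1 by rewrite invr_ge0 ltW.
  have h : (F t <= poweR (poweR (U t) (q / p)) q^-1)%E.
    apply: gt0_ler_poweR => //; apply: in0 => //; exact: poweR_ge0.
  apply: (@le_trans _ _ (poweR (poweR (poweR (U t) (q / p)) q^-1) p)).
    apply: gt0_ler_poweR => //; [exact: ltW|exact: in0|apply: in0; exact: poweR_ge0].
  rewrite -!poweRrM; have -> : q / p * (q^-1 * p) = 1 by field; rewrite !gt_eqF.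
  by rewrite poweRe1.
have iU : (\int[ld]_t U t <= ((e + pi ^+ d) * envelope_scale `^ (p / m))%:E)%E.
  have cv := @cvg_monotone_convergence _ _ _ ld setT measurableT
    (fun L t => (envelope L (row_of t))%:E) mE
    (fun L t _ => envelope_ge0 L (row_of t)) (fun t _ => ndE t).
  rewrite -(cvg_lim _ cv)//; apply: lime_le; first by apply/cvg_ex; eexists; exact: cv.
  apply: nearW => L; apply: rbound_ereal (envelope_rbound L) => t; exact: envelope_ge0.
rewrite unlock -/F -poweR_EFin; apply: gt0_ler_poweR.
- by rewrite invr_ge0 ltW.
- by apply: in0; apply: integral_ge0 => t _; exact: poweR_ge0.
- apply: in0; rewrite lee_fin mulr_ge0 ?powR_ge0// addr_ge0 ?exprn_ge0 ?pi_ge0//.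
- apply: le_trans iU; apply: ge0_integral_monotone => t; [exact: poweR_ge0|exact: FU].
Qed.

End NormBound.

(** Since b <= 2^b, raising the frequency by b raises the level by at least one. *)
Lemma lev_step (b a : nat) : prime b -> (lev b a < lev b (a + b))%N.
Proof.
move=> pb; have b1 := prime_gt1 pb.
apply: trunc_log_max => //; rewrite expnS expnD mulnC; apply: leq_mul.
  by rewrite trunc_logP// expn_gt0.
exact: ltnW (ltn_expl b _).
Qed.

Theorem corollary1p4 (R : realType) (phi0 : R -> R[i]) (d b v : nat)
    (p q r : R)
    (hphi0 : dyadic_cutoff phi0)
    (hd : (1 <= d)%N) (hb : prime b)
    (hp : 1 <= p) (hq : 1 <= q)
    (hr0 : 0 < r) (hr : r < 1 / Num.max p q) :
  exists C : R, 0 < C /\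
    forall (n s : nat) (M : 'I_d -> 'M['F_b]_(s, n)),
      (0 < n)%N -> order_net 1 v M ->
      (SF_cube_quasinorm phi0 p q r
         (cube_distribution (discrepancy (digital_net R M)))
       <= (C * b%:R `^ (n%:R * (r - 1)) * n%:R `^ ((d%:R - 1) / q))%:E)%E.
Proof.
set m := Num.max p q in hr *.
have pm : p <= m by rewrite le_max lexx.
have qm : q <= m by rewrite le_max lexx orbT.
have p0 : 0 < p := lt_le_trans ltr01 hp.
have q0 : 0 < q := lt_le_trans ltr01 hq.
have m1 : 1 <= m := le_trans hp pm.
have m0 : 0 < m := lt_le_trans ltr01 m1.
have rm : r * m < 1 by rewrite -ltr_pdivlMr.
have b1 : (1 : R) <= b%:R by rewrite ler1n prime_gt0.
have b0 : (0 : R) < b%:R := lt_le_trans ltr01 b1.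
have [Psi [X [c [C [C0 dP dX hK]]]]] := kernels hphi0 b1.
have K1 k x z (hz : 0 <= z <= 1) : normc (Psi k (x - z) - c k x) <= C * eta (2 ^+ k * (x - z)) ^+ 3.
  by have [h _ _] := hK k x; exact: h.
have K2 k x : normc (X k x - X k (x - 1) - c k x) <=
    C * (2 ^+ k)^-1 * (eta (2 ^+ k * x) ^+ 3 + eta (2 ^+ k * (x - 1)) ^+ 3).
  by have [_ h _] := hK k x.
have K3 k x z1 z2 z (h1 : z1 < z2) (h2 : z1 <= z <= z2) (h3 : 2 ^+ k * (z2 - z1) <= b%:R) :
    normc ((X k (x - z1) - X k (x - z2)) / (z2 - z1)%:C%C - Psi k (x - z)) <=
    C * (2 ^+ k * (z2 - z1)) * eta (2 ^+ k * (x - z)) ^+ 3.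
  by have [_ _ h] := hK k x; exact: h.
have [C1 [tau [C10 t01 hexp]]] := @exponent_bound R d b v (A0 b C) m r hd (prime_gt1 hb) (A0_ge0 b C0) m1 hr0 rm.
have t0 : 0 <= tau by case/andP: t01 => /ltW.
have s0 : 0 < m / q by rewrite divr_gt0.
(* The weights [cc] enter the bounds to the power m / q, so their rate must satisfy ta^(m/q) =
   tau. *)
pose ta := tau `^ (m / q)^-1.
have ta01 : 0 < ta < 1.
  case/andP: t01 => t0' t1; rewrite powR_gt0//=.
  have : ta < 1 `^ (m / q)^-1.
    by apply: gt0_ltr_powR; rewrite ?nnegrE ?invr_gt0.
  by rewrite powR1.
have ta0 : 0 < ta by case/andP: ta01.
have tE : ta `^ (m / q) = tau by rewrite /ta -powRrM mulVf ?powRr1// gt_eqF.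
have taE j : tau ^+ j = (ta ^+ j) `^ (m / q).
  by rewrite -tE -(powR_mulrn j (powR_ge0 _ _)) -(powR_mulrn j (ltW ta0)) -!powRrM [_ * j%:R]mulrC.
have [C2 [C20 hcount]] := gap_count (prime_gt0 hb) (fun a => lev_step a hb) ta01 hd.
pose cc n (k : {ffun 'I_d -> nat}) := \sum_(J : {set 'I_d} | J != finset.set0) ta ^+ gap (lev b) (n - v) J k.
have cc0 n k : 0 < cc n k.
  have T0 : [set: 'I_d]%SET != finset.set0.
    by rewrite -card_gt0 cardsT card_ord.
  rewrite /cc (bigD1 [set: 'I_d]%SET)//= ltr_wpDr ?exprn_gt0//.
  by apply: sumr_ge0 => J _; rewrite exprn_ge0// ltW.
(* The last factor counts the subsets J: each tau^gap is at most cc^(m/q), as one summand of [cc]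
   already shows. *)
pose e := (1 + #|{set 'I_d}|%:R) `^ (m - 1) * (2 * (2 * pi) ^+ d) * C1 * #|{set 'I_d}|%:R.
have e0 : 0 <= e by rewrite !mulr_ge0 ?powR_ge0 ?exprn_ge0 ?mulr_ge0 ?pi_ge0// ltW.
(* From n - v + 1 <= 2 n, valid because n > 0. *)
pose C3 := C2 * 2 ^+ d.-1.
have C30 : 0 < C3 by rewrite mulr_gt0 ?exprn_gt0.
have ep0 : 0 < e + pi ^+ d by rewrite ltr_wpDl// exprn_gt0// pi_gt0.
exists ((e + pi ^+ d) `^ p^-1 * C3 `^ q^-1); split.
  by rewrite mulr_gt0// powR_gt0.
move=> n s M n0 hM.
have vn : (v <= n)%N by case: hM => _ + _; rewrite mul1n.
have N0 : (0 < b ^ n)%N by rewrite expn_gt0 prime_gt0.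
have P01 (z : 'I_(b ^ n)) i : 0 <= digital_net R M z 0 i < 1 by exact: zeta01.
have nR : 0 < n%:R :> R by rewrite ltr0n.
pose Q := C3 * n%:R ^+ d.-1.
have Q0 : 0 < Q by rewrite mulr_gt0// exprn_gt0.
pose bm := (b%:R : R) `^ ((r - 1) * n%:R * m).
have bm0 : 0 < bm by exact: powR_gt0.
have ccQ L : \sum_(k <- box_seq d L) cc n k <= Q.
  rewrite big_map; apply: (@le_trans _ _ (C2 * (n - v).+1%:R ^+ d.-1)).
    apply: le_trans (hcount (n - v)%N L); rewrite le_eqVlt; apply/orP; left; apply/eqP.
    apply: eq_bigr => k _; apply: eq_bigr => J _; congr (_ ^+ _).
    rewrite /gap; congr addn; first by apply: eq_bigr => i _; rewrite ffunE.
    have -> : (\sum_(i in J) lev b ([ffun i => val (k i)] i) = \sum_(i in J) lev b (k i))%N.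
      by apply: eq_bigr => i _; rewrite ffunE.
    by [].
  rewrite /Q /C3 -[leRHS]mulrA -exprMn; apply: ler_wpM2l; first exact: ltW.
  apply: lerXn2r; rewrite ?nnegrE ?mulr_ge0//.
  rewrite -natrM ler_nat mul2n -addnn; apply: (@leq_ltn_trans (n + 0)%N); first by rewrite addn0 leq_subr.
  by rewrite ltn_add2l.
pose T := cube_distribution (discrepancy (digital_net R M)).
pose a (k : {ffun 'I_d -> nat}) x := 2 `^ (r * (\sum_i k i)%:R * q) *
  normc (block (digital_net R M) Psi X k x) `^ q.
have a0 k x : 0 <= a k x by rewrite mulr_ge0 ?powR_ge0.
have aD k x : (a k x * wgt x `^ q) `^ (m / q) <= dominator v M C m r k x.
  have n_ge0 := normc_ge0 (block (digital_net R M) Psi X k x).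
  have w_ge0 := wgt_ge0 x.
  rewrite /a -mulrA -powRM// -/(wblock M Psi X k x).
  have wb0 : 0 <= wblock M Psi X k x by rewrite mulr_ge0.
  rewrite (powRM (m / q) (powR_ge0 _ _) (powR_ge0 _ _)) -!powRrM.
  have -> : q * (m / q) = m by rewrite mulrCA divff ?mulr1// gt_eqF.
  have -> : r * (\sum_i k i)%:R * q * (m / q) = r * m * (\sum_i k i)%:R.
    by field; rewrite gt_eqF.
  apply: ler_wpM2l; first exact: powR_ge0.
  exact: (wblock_powR hb hM C0 K1 K2 K3 k x m1).
have DE k : rbound (lebesgue R d) (fun t => dominator v M C m r k (row_of t))
    (e * bm * cc n k `^ (m / q)).
  have B0 : 0 <= C1 * bm by rewrite mulr_ge0// ltW.
  apply: rbound_le (dominator_rbound M hb k B0 t0 (fun kJ kc T => hexp n kJ kc T vn)).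
  rewrite /e mulrA -!(mulrA (_ * C1)) [leRHS](_ : _ = (1 + #|{set 'I_d}|%:R) `^ (m - 1) * (2 * (2 * pi) ^+ d) * C1 *
     (bm * (#|{set 'I_d}|%:R * cc n k `^ (m / q)))); last by ring.
  apply: ler_wpM2l; first by rewrite !mulr_ge0 ?powR_ge0 ?exprn_ge0 ?mulr_ge0 ?pi_ge0// ltW.
  apply: ler_wpM2l; first exact: ltW.
  apply: (@le_trans _ _ (\sum_(J : {set 'I_d}) cc n k `^ (m / q))); last first.
    by rewrite sumr_const [leRHS]mulr_natl.
  rewrite big_mkcond/=; apply: ler_sum => J _; case: ifPn => [J0|_]; last exact: powR_ge0.
  rewrite taE; apply: ge0_ler_powR; rewrite ?nnegrE ?exprn_ge0 ?(ltW ta0) ?(ltW (cc0 n k)) ?(ltW s0)//.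
  rewrite /cc (bigD1 J)//= lerDl; apply: sumr_ge0 => J' _.
  by rewrite exprn_ge0// ltW.
have key := @Lnorm_bound R d p q m bm Q e (cc n) (dominator v M C m r) a
  hp hq pm qm bm0 Q0 e0 (cc0 n) ccQ a0 aD DE.
have SE : SF_quasinorm phi0 p q r T = Lnorm (lebesgue R d) p%:E (fun t =>
    poweR (\esum_(k in [set: {ffun 'I_d -> nat}]) (a k (row_of t))%:E) q^-1).
  rewrite /SF_quasinorm; apply: eq_Lnorm => t; congr poweR; apply: eq_esum => k _.
  by rewrite /T (dyadic_blockE hphi0 N0 P01 dP dX).
have final : ((e + pi ^+ d) * envelope_scale q m bm Q `^ (p / m)) `^ p^-1 =
    (e + pi ^+ d) `^ p^-1 * C3 `^ q^-1 * b%:R `^ (n%:R * (r - 1)) * n%:R `^ ((d%:R - 1) / q).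
  rewrite (powRM p^-1 (ltW ep0) (powR_ge0 _ _)) -powRrM.
  have -> : p / m * p^-1 = m^-1 by field; rewrite !gt_eqF.
  rewrite /envelope_scale (powRM m^-1 (ltW bm0) (powR_ge0 _ _)) -powRrM.
  have -> : m / q * m^-1 = q^-1 by field; rewrite !gt_eqF.
  rewrite /bm -powRrM; have -> : (r - 1) * n%:R * m * m^-1 = n%:R * (r - 1).
    by field; rewrite gt_eqF.
  rewrite /Q (powRM q^-1 (ltW C30) (exprn_ge0 _ (ltW nR))) -(powR_mulrn d.-1 (ltW nR)) -powRrM.
  have -> : d.-1%:R / q = (d%:R - 1) / q by rewrite -{2}(prednK hd) -natr1 addrK.
  by ring.
rewrite -SE final in key.
(* The functional on the cube, read on all of R^d, is the extension by zero and competes in the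
   infimum. *)
apply: (le_trans _ key); apply: ereal_inf_lbound; exists T => //; split; last by [].
split; first exact: tempered_discrepancy.
by rewrite (le_lt_trans key)// ltry.
Qed.
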